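(* Let $(X_i,\mathcal F_i)_{i\ge1}$ be a stationary martingale difference sequence with $\sigma^2:=\mathbf E X_1^2>0$, and suppose that $\mathbf E|X_1|^{2p}<\infty$ for some $p>1$. Then there exists a constant $C_p$, which does not depend on $n$, such that for all $n\ge2$, $$\sup_{x\in\mathbf R}\Big|\mathbf P(T_n\le x)-\Phi(x)\Big|\le C_p\Big(n^{1-p}+\mathbf E\Big|\frac{\langle S\rangle_n}{n\sigma^2}-1\Big|^p\Big)^{1/(2p+1)},$$ where $T_n=\sqrt n\,\overline X_n/\widehat\sigma$ is Student's $t$-statistic.
   Context: Here $\mathcal F_0=\{\emptyset,\Omega\}\subseteq\mathcal F_1\subseteq\cdots$ are increasing $\sigma$-fields, each $X_i$ is $\mathcal F_i$-measurable and integrable with $\mathbf E[X_i\mid\mathcal F_{i-1}]=0$ for $i\ge1$, and $(X_i)_{i\ge1}$ is (strictly) stationary. Notation: $S_n=\sum_{i=1}^nX_i$, $\langle S\rangle_n=\sum_{i=1}^n\mathbf E[X_i^2\mid\mathcal F_{i-1}]$, $\overline X_n=S_n/n$, $\widehat\sigma=\sqrt{\widehat\sigma^2}\ge0$ with $\widehat\sigma^2=\sum_{i=1}^n\frac{(X_i-\overline X_n)^2}{n-1}$. $\Phi$ is the standard normal distribution function. The event $\{T_n\le x\}$ is understood as $\{\sqrt n\,\overline X_n\le x\,\widehat\sigma\}$. The constant $C_p$ may depend on $p$ and on the law of the sequence, but not on $n$ or $x$. *)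

(* Defs.v *)
From HB Require Import structures.
From mathcomp Require Import all_boot all_order all_algebra.
From mathcomp Require Import all_classical all_reals all_analysis.

Set Implicit Arguments.
Unset Strict Implicit.
Unset Printing Implicit Defensive.

Import Order.TTheory GRing.Theory Num.Theory.
Import numFieldNormedType.Exports.

Local Open Scope classical_set_scope.
Local Open Scope ring_scope.

Section martingale_differences.
Context {d : measure_display} {T : measurableType d} {R : realType}.
Implicit Types (P : probability T R) (G : set_system T) (F : nat -> set_system T).

Record is_filtration F : Prop := IsFiltration {
  filtration_sigma : forall n, sigma_algebra [set: T] (F n) ;
  filtration_measurable : forall n A, F n A -> measurable A ;
  filtration_incr : forall n, F n `<=` F n.+1 ;
  filtration_0 : F 0%N = [set set0; [set: T]] }.

Definition measurable_wrt G (Y : T -> R) : Prop :=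
  forall B : set R, measurable B -> G (Y @^-1` B).

(* Conditional expectations are only determined up to P-null sets:
   [is_cond_exp P G X Y] says that [Y] is a version of E[X | G]. *)
Record is_cond_exp P G (X Y : T -> R) : Prop := IsCondExp {
  cond_exp_measurable : measurable_wrt G Y ;
  cond_exp_integrable : P.-integrable [set: T] (EFin \o Y) ;
  cond_exp_integral : forall A, G A ->
    (\int[P]_(t in A) (Y t)%:E = \int[P]_(t in A) (X t)%:E)%E }.

(* Sequences of random variables start at index 1, hence the [i.+1];
   the value at index 0 is never used. *)
Record is_martingale_difference P F (X : nat -> T -> R) : Prop :=
  IsMartingaleDifference {
  mdiff_adapted : forall i, measurable_wrt (F i.+1) (X i.+1) ;
  mdiff_integrable : forall i, P.-integrable [set: T] (EFin \o X i.+1) ;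
  mdiff_cond_exp : forall i, is_cond_exp P (F i) (X i.+1) (cst 0) }.

(* (X_{k+1}, ..., X_{k+m}) *)
Definition block (X : nat -> T -> R) (k m : nat) (t : T) : m.-tuple R :=
  [tuple X (k + i).+1 t | i < m].

Definition strictly_stationary P (X : nat -> T -> R) : Prop :=
  forall (k m : nat) (A : set (m.-tuple R)), measurable A ->
    P (block X k m @^-1` A) = P (block X 0 m @^-1` A).

(* [V i] is a version of E[X_i^2 | F_{i-1}] for every i >= 1 *)
Definition is_cond_variance P F (X V : nat -> T -> R) : Prop :=
  forall i, is_cond_exp P (F i) (fun t => X i.+1 t ^+ 2) (V i.+1).

(* S_n for the sequence X, and <S>_n for a sequence of conditional variances *)
Definition partial_sum (X : nat -> T -> R) (n : nat) (t : T) : R :=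
  \sum_(1 <= i < n.+1) X i t.

Definition sample_mean (X : nat -> T -> R) (n : nat) (t : T) : R :=
  partial_sum X n t / n%:R.

Definition sample_variance (X : nat -> T -> R) (n : nat) (t : T) : R :=
  \sum_(1 <= i < n.+1) ((X i t - sample_mean X n t) ^+ 2 / (n%:R - 1)).

Definition sample_sd (X : nat -> T -> R) (n : nat) (t : T) : R :=
  Num.sqrt (sample_variance X n t).

(* The event T_n <= x, cleared of the denominator so that it is meaningful
   when the sample standard deviation vanishes. *)
Definition student_le (X : nat -> T -> R) (n : nat) (x : R) : set T :=
  [set t | Num.sqrt n%:R * sample_mean X n t <= x * sample_sd X n t].

End martingale_differences.

Definition std_normal_cdf {R : realType} (x : R) : \bar R :=
  normal_prob (0 : R) 1 `]-oo, x]%classic.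

(* Main.v *)
Require Import Defs.
From HB Require Import structures.
From mathcomp Require Import all_boot all_order all_algebra.
From mathcomp Require Import all_classical all_reals all_analysis.
From mathcomp Require Import measurable_realfun ring lra zify.

Set Implicit Arguments.
Unset Strict Implicit.
Unset Printing Implicit Defensive.

Import Order.TTheory GRing.Theory Num.Theory.
Import numFieldNormedType.Exports.

Local Open Scope classical_set_scope.
Local Open Scope ring_scope.

(** The martingale is compared with the heat equation run along its own clock
    <S>. Divide by sigma sqrt(n), and let eps be a large multiple of the
    power 1/(2p+1) of the right-hand side. Then the sum of the E|X_i|^(2p) is
    at most eps^(2p+1), and the clock at time n differs from 1 by more than
    eps^2 with probability at most eps; so an error O(eps) is what is allowed.

    Freeze the martingale just before its clock exceeds 1 + eps^2, and put
    r = sqrt(1 + 2 eps^2 - v) >= eps, z = (x - s) / r. The function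
    Phi(z) of (s, v) solves the backward heat equation, so by Taylor's
    formula the expectation of Phi(z) along (S_k, <S>_k) only changes by terms
    of order (|X_k| / r)^3 at each step. Summed without care, these terms are
    too large when r is close to eps. Therefore a small function is added to
    Phi(z): with rho = r / eps, alpha = 1/(2p), G = exp(-z^2/2) and
    h = (1 + z^2)^(-2), it is
        K (rho^(-1) G - rho^(-1-alpha) G + B rho^(-1-alpha) h).
    Its first term solves the heat equation. The second one has a strict
    defect of the right sign, proportional to rho^(-1-alpha) G. The third one,
    for B small, spreads this defect to the weight h, which decays
    polynomially and so, unlike G, changes only by a bounded factor when z is
    shifted by X_k / r. The sum of all this is [barrier]. Its defect absorbs
    (|X_k| / r)^3 when |X_k| / r is at most a small multiple of
    rho^(-1-alpha), and otherwise (|X_k| / r)^3 is bounded by a multiple of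
    (|X_k| / eps)^(2p); this is [young_cubic], and it is why the exponent is
    2p+1 with no logarithm. At the end of the clock r is comparable to eps, and
    for K large the h-term exceeds the Gaussian tail 1 - Phi(z), so that the
    function dominates the indicator of s <= x there, while at the start it is
    Phi(x) + O(eps). These facts are collected in [supersolution_exists], and
    summing over the steps gives [one_sided_normal_approx].

    For Student's statistic one has to replace sigma by the sample deviation.
    The sums of the X_i^2 and of their conditional expectations differ by a
    martingale whose increments have a p-th moment, and [martingale_moment]
    shows that the relative difference exceeds eps with probability O(eps).
    Hence the sample deviation is sigma (1 + O(eps)) outside an event of
    probability O(eps), and Phi (x (1 + O(eps))) = Phi(x) + O(eps) uniformly in
    x. This is [student_upper]; the lower bound is the same statement for the
    martingale -S. *)

(** * Differentiation of explicit functions *)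
Section calculus.
Context {R : realType}.
Implicit Types (f g : R -> R) (x a b : R).

Lemma drvD f g x a b : is_derive x 1 f a -> is_derive x 1 g b ->
  is_derive x 1 (fun y => f y + g y) (a + b).
Proof. move=> fa gb; exact: is_deriveD. Qed.

Lemma drvB f g x a b : is_derive x 1 f a -> is_derive x 1 g b ->
  is_derive x 1 (fun y => f y - g y) (a - b).
Proof. move=> fa gb; exact: is_deriveB. Qed.

Lemma drvN f x a : is_derive x 1 f a -> is_derive x 1 (fun y => - f y) (- a).
Proof. move=> fa; exact: is_deriveN. Qed.

Lemma drvM f g x a b : is_derive x 1 f a -> is_derive x 1 g b ->
  is_derive x 1 (fun y => f y * g y) (a * g x + f x * b).
Proof.
move=> fa gb; apply: (is_derive_eq (is_deriveM fa gb)).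
by rewrite addrC -![_ *: _]/(_ * _) (mulrC a).
Qed.

Lemma drvC c x : is_derive x 1 (fun _ : R => c : R) 0.
Proof. exact: is_derive_cst. Qed.

Lemma drvI x : is_derive x 1 (fun y : R => y) 1.
Proof. exact: is_derive_id. Qed.

Lemma drvZ c f x a : is_derive x 1 f a -> is_derive x 1 (fun y => c * f y) (c * a).
Proof.
move=> fa; apply: (is_derive_eq (drvM (drvC c x) fa)).
by rewrite mul0r add0r.
Qed.

Lemma drvX n f x a : is_derive x 1 f a ->
  is_derive x 1 (fun y => f y ^+ n) (n%:R * f x ^+ n.-1 * a).
Proof.
move=> fa.
have -> : (fun y => f y ^+ n) = f ^+ n by apply/funext => y; rewrite fctE.
exact: is_deriveX.
Qed.

Lemma drv_comp f g x a b : is_derive (g x) 1 f a -> is_derive x 1 g b ->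
  is_derive x 1 (fun y => f (g y)) (a * b).
Proof. move=> fa gb; exact: is_derive1_comp. Qed.

Lemma drv_expR f x a : is_derive x 1 f a ->
  is_derive x 1 (fun y => expR (f y)) (expR (f x) * a).
Proof. by move=> fa; apply: drv_comp. Qed.

Lemma drv_cont f (df : R -> R) : (forall x, is_derive x 1 f (df x)) -> continuous f.
Proof.
move=> fd x; apply: differentiable_continuous; apply/derivable1_diffP.
exact: ex_derive.
Qed.

Lemma mean_value f (df : R -> R) a b : (forall x, is_derive x 1 f (df x)) ->
  exists2 c, f b - f a = df c * (b - a) & Num.min a b <= c <= Num.max a b.
Proof.
move=> fd; have cf := drv_cont fd.
have [ab|/ltW ba] := leP a b.
  have [c ] := MVT_segment ab (fun x _ => fd x) (continuous_subspaceT cf).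
  by rewrite in_itv /= => cab ->; exists c.
have [c ] := MVT_segment ba (fun x _ => fd x) (continuous_subspaceT cf).
rewrite in_itv /= => cab E; exists c; last by [].
by rewrite -opprB E -mulrN opprB.
Qed.

Lemma norm_between0 (c t : R) : Num.min 0 t <= c <= Num.max 0 t -> `|c| <= `|t|.
Proof.
have [t0|/ltW t0] := leP 0 t => /andP[c1 c2].
  by rewrite !ger0_norm.
by rewrite !ler0_norm// lerN2.
Qed.

(** Each application raises the order of vanishing at the origin by one, so that a
    bound on the top derivative becomes a bound on a Taylor remainder. *)
Lemma integrate_bound f (df : R -> R) (M : R) (n : nat) :
  (forall x, is_derive x 1 f (df x)) -> f 0 = 0 ->
  (forall t, `|t| <= 1 -> `|df t| <= M * `|t| ^+ n) ->
  forall t, `|t| <= 1 -> `|f t| <= M * `|t| ^+ n.+1.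
Proof.
move=> fd f0 H t t1; have [c] := mean_value 0 t fd.
rewrite f0 !subr0 => -> /norm_between0 ct.
rewrite normrM exprSr mulrA ler_wpM2r//.
have := H _ (le_trans ct t1) => /le_trans; apply.
have M0 : 0 <= M.
  have := H 1; rewrite normr1 expr1n mulr1 => /(_ (lexx _)); exact: le_trans.
by rewrite ler_wpM2l// lerXn2r// nnegrE.
Qed.

End calculus.

(** * The Gaussian and Cauchy weights *)
Section gaussian.
Context {R : realType}.
Implicit Types (x y z : R).

Definition gauss z : R := expR (- (z ^+ 2) / 2).
Definition cauchy z : R := (1 + z ^+ 2)^-1.
Definition Phi x : R := fine (std_normal_cdf x).
Definition kappa : R := normal_peak 1.

Lemma one_sqr_gt0 z : 0 < 1 + z ^+ 2.
Proof. by have := sqr_ge0 z; lra. Qed.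

Lemma cauchy_gt0 z : 0 < cauchy z.
Proof. by rewrite invr_gt0 one_sqr_gt0. Qed.

Lemma cauchy_le1 z : cauchy z <= 1.
Proof. by rewrite invf_le1 ?one_sqr_gt0//; have := sqr_ge0 z; lra. Qed.

Lemma cauchyE z : cauchy z * (1 + z ^+ 2) = 1.
Proof. by rewrite /cauchy mulVf// gt_eqF// one_sqr_gt0. Qed.

Lemma gauss_gt0 z : 0 < gauss z. Proof. exact: expR_gt0. Qed.

Lemma gauss_le1 z : gauss z <= 1.
Proof. by rewrite -expR0 ler_expR; have := sqr_ge0 z; lra. Qed.

Lemma kappa_gt0 : 0 < kappa. Proof. by apply: normal_peak_gt0; rewrite oner_neq0. Qed.

Lemma normal_pdf01 z : normal_pdf 0 1 z = kappa * gauss z.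
Proof.
rewrite normal_pdfE ?oner_neq0//; congr (_ * expR _).
by rewrite subr0 expr1n mulrS mulr1n.
Qed.

Lemma std_normal_cdfE x : std_normal_cdf x = (Phi x)%:E.
Proof. by rewrite /Phi fineK// fin_num_measure. Qed.

Lemma Phi_ge0 x : 0 <= Phi x.
Proof. by rewrite fine_ge0. Qed.

Lemma Phi_le1 x : Phi x <= 1.
Proof. by rewrite -lee_fin -std_normal_cdfE probability_le1. Qed.

Lemma Phi_derive x : is_derive x 1 Phi (kappa * gauss x).
Proof.
have i01 : lebesgue_measure.-integrable [set: R]
    (EFin \o normal_pdf (0 : R) 1) by exact: integrable_normal_pdf.
have [||||dF vF] := @continuous_FTC1 R (normal_pdf 0 1) -oo%O x (x + 1).
- by rewrite ltrDl.
- by apply: (integrableS _ _ (@subsetT _ _) i01).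
- by rewrite /= ltNyr.
- exact: continuous_normal_pdf (oner_neq0 _) x.
rewrite derive1E in vF.
by rewrite -normal_pdf01 -vF; exact: derivableP.
Qed.

Let idR : measurableTypeR R -> R := idfun.

#[local] HB.instance Definition _ :=
  @isMeasurableFun.Build _ _ _ _ idR (@measurable_id _ _ setT).

Lemma Phi_cdf : cdf (idR : {RV (normal_prob 0 1) >-> R}) = EFin \o Phi.
Proof. by apply/funext => x; rewrite /= -std_normal_cdfE. Qed.

Lemma Phi_cvg1 : Phi x @[x --> +oo] --> (1 : R).
Proof.
have := @cvg_cdfy1 _ _ _ (normal_prob 0 1) idR.
by rewrite Phi_cdf => /fine_cvg.
Qed.

Lemma Phi_cvg0 : Phi x @[x --> -oo] --> (0 : R).
Proof.
have := @cvg_cdfNy0 _ _ _ (normal_prob 0 1) idR.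
by rewrite Phi_cdf => /fine_cvg.
Qed.

Lemma gauss_even z : gauss (- z) = gauss z.
Proof. by rewrite /gauss sqrrN. Qed.

(** The derivative of Phi(x) + Phi(-x) vanishes because the density is even; the
    constant is found at infinity. *)
Lemma Phi_opp x : Phi (- x) = 1 - Phi x.
Proof.
pose f y := Phi y + Phi (- y).
have fd y : is_derive y 1 f 0.
  apply: (is_derive_eq (drvD (Phi_derive y) (drv_comp (Phi_derive _) (drvN (drvI y))))).
  by rewrite gauss_even; ring.
have fc y : f y = f x.
  by apply/eqP; rewrite -subr_eq0; have [c -> _] := mean_value x y fd; rewrite mul0r.
have f1 : f y @[y --> +oo] --> (1 + 0 : R).
  apply: cvgD; first exact: Phi_cvg1.
  apply: (@cvg_comp _ _ _ -%R Phi); last exact: Phi_cvg0.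
  by rewrite ninfty.
have f2 : f y @[y --> +oo] --> f x.
  by under eq_fun do rewrite fc; exact: cvg_cst.
have fE : f x = 1 + 0 by exact: (cvg_unique _ f2 f1).
by move: fE; rewrite /f addr0; lra.
Qed.

Lemma gauss_derive x : is_derive x 1 gauss (- x * gauss x).
Proof.
have -> : gauss = fun y => expR ((-1/2) * y ^+ 2).
  by apply/funext => y; rewrite /gauss; congr expR; field.
apply: (is_derive_eq (drv_expR (drvZ _ (drvX 2 (drvI x))))).
by rewrite /= expr1; field.
Qed.

Lemma cauchy_derive x : is_derive x 1 cauchy (- 2 * x * cauchy x ^+ 2).
Proof.
have d1 : is_derive x 1 (fun y => 1 + y ^+ 2) (2 * x).
  by apply: (is_derive_eq (drvD (drvC 1 x) (drvX 2 (drvI x)))); rewrite /=; ring.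
have n0 : 1 + x ^+ 2 != 0 by rewrite gt_eqF// one_sqr_gt0.
apply: (is_derive_eq (@is_deriveV R (fun y => 1 + y ^+ 2) x _ _ n0 d1)).
by rewrite -[_ *: _]/(_ * _) /cauchy -exprVn; ring.
Qed.

(** Because exp(u) = exp(u/n)^n is at least (1 + u/n)^n. *)
Lemma gauss_le_cauchy (n : nat) : exists2 C, 0 < C & forall z, gauss z <= C * cauchy z ^+ n.
Proof.
have [->|n0] := eqVneq n 0%N.
  by exists 1 => // z; rewrite expr0 mulr1 gauss_le1.
have n0' : 0 < n%:R :> R by rewrite ltr0n lt0n.
have n1 : 1 <= n%:R :> R by rewrite ler1n lt0n.
exists ((2 * n%:R) ^+ n) => [|z]; first by rewrite exprn_gt0// mulr_gt0.
have -> : gauss z = (expR (- (z ^+ 2 / (2 * n%:R)))) ^+ n.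
  rewrite -expRM_natl /gauss; congr expR; field.
  by rewrite pnatr_eq0.
rewrite -exprMn lerXn2r ?nnegrE ?expR_ge0//.
  by rewrite mulr_ge0 ?ltW ?cauchy_gt0// mulr_gt0.
rewrite expRN -[leRHS]invrK lef_pV2 ?posrE ?expR_gt0//; last first.
  by rewrite invr_gt0 mulr_gt0 ?cauchy_gt0// mulr_gt0.
apply: le_trans (expR_ge1Dx _).
rewrite invfM /cauchy invrK ler_pdivrMl ?mulr_gt0//.
have -> : 2 * n%:R * (1 + z ^+ 2 / (2 * n%:R)) = 2 * n%:R + z ^+ 2.
  by field; rewrite pnatr_eq0.
lra.
Qed.

(** For z >= 1 the function Phi + C cauchy^2 decreases to 1, because its
    derivative is negative as soon as C is large against the constant of
    [gauss_le_cauchy]. *)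
Lemma normal_tail : exists2 C, 0 < C & forall z, 0 <= z -> 1 - Phi z <= C * cauchy z ^+ 2.
Proof.
have [C0 C00 HC0] := gauss_le_cauchy 3.
pose C := 4 + kappa * C0.
have k0 := kappa_gt0.
have kC : 0 < kappa * C0 by rewrite mulr_gt0.
exists C => [|z z0]; first by rewrite /C; lra.
have [z1|/ltW z1] := leP z 1.
  have c2 : 1 / 2 <= cauchy z.
    rewrite /cauchy div1r lef_pV2 ?posrE ?one_sqr_gt0//.
    have : z * z <= 1 by rewrite mulr_ile1.
    rewrite expr2; lra.
  have c4 : 1 / 4 <= cauchy z ^+ 2 by rewrite expr2; nra.
  have P0 := Phi_ge0 z; rewrite /C; nra.
pose g y := Phi y + C * cauchy y ^+ 2.
have gd y : is_derive y 1 g (kappa * gauss y - 4 * C * y * cauchy y ^+ 3).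
  apply: (is_derive_eq (drvD (Phi_derive y) (drvZ _ (drvX 2 (cauchy_derive y))))).
  by rewrite /=; ring.
have gle y : z <= y -> g y <= g z.
  move=> zy; rewrite -subr_le0; have [c -> ] := mean_value z y gd.
  rewrite min_l// => /andP[zc _].
  rewrite mulr_le0_ge0 ?subr_ge0//.
  have /(ler_wpM2l (ltW k0)) := HC0 c; rewrite mulrA => HH.
  have c3 : 0 < cauchy c ^+ 3 by rewrite exprn_gt0 ?cauchy_gt0.
  have : kappa * C0 <= 4 * C * c by rewrite /C; nra.
  move/(ler_wpM2r (ltW c3)); lra.
suff : 1 <= g z by rewrite /g; lra.
apply: (cvgr_to_le Phi_cvg1); near=> y.
apply: le_trans (gle y _).
  by rewrite /g lerDl mulr_ge0 ?exprn_ge0 ?ltW ?cauchy_gt0// /C; lra.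
near: y; apply: nbhs_pinfty_ge; exact: num_real.
Unshelve. all: by end_near. Qed.

End gaussian.

(** * Expansions with a Cauchy remainder *)
Section domination.
Context {R : realType}.
Implicit Types (f g H : R -> R) (x y z q l : R).

(** The weight must change at most by a bounded factor under bounded shifts
    ([cauchy_shift]), which excludes a Gaussian. *)
Definition dominated f := exists2 C, 0 <= C & forall z, `|f z| <= C * cauchy z ^+ 2.

Lemma dominatedD f g : dominated f -> dominated g -> dominated (fun z => f z + g z).
Proof.
move=> [C C0 fC] [D D0 gD]; exists (C + D) => [|z]; first by rewrite addr_ge0.
by rewrite mulrDl (le_trans (ler_normD _ _))// lerD.
Qed.

Lemma dominatedZ c f : dominated f -> dominated (fun z => c * f z).
Proof.
move=> [C C0 fC]; exists (`|c| * C) => [|z]; first by rewrite mulr_ge0.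
by rewrite normrM -mulrA ler_wpM2l.
Qed.

Lemma dominated_cauchy i j : (i + 4 <= 2 * j)%N -> dominated (fun z : R => z ^+ i * cauchy z ^+ j).
Proof.
move=> ij; exists 1 => // z.
have c0 := cauchy_gt0 z; have c1 := cauchy_le1 z.
have cz : `|z| ^+ 2 * cauchy z <= 1.
  by rewrite real_normK ?num_real// -(cauchyE z); lra.
have cz1 : `|z| * cauchy z <= 1.
  have [z1|z1] := leP `|z| 1; first by rewrite mulr_ile1// ltW.
  have z2 : `|z| <= `|z| ^+ 2 by rewrite expr2 ler_peMr// ltW.
  by apply: le_trans cz; rewrite ler_pM2r.
rewrite mul1r normrM !normrX (ger0_norm (ltW c0)).
have ji : (i <= 2 * (j - 2))%N by lia.
have -> : j = ((j - 2) + 2)%N by lia.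
rewrite exprD mulrA ler_piMl ?sqr_ge0//.
move: (j - 2)%N ji => {ij}k ik.
have [k1 [k2 [-> ->]]] : exists k1 k2, (i = k1 * 2 + k2 /\ k = k1 + k2 + (k - k1 - k2))%N.
  exists (i %/ 2)%N, (i %% 2)%N; split; first by rewrite -divn_eq.
  have := ltn_pmod i (isT : (0 < 2)%N); have := divn_eq i 2; lia.
rewrite !exprD mulnC exprM.
have -> : (`|z| ^+ 2) ^+ k1 * `|z| ^+ k2 * (cauchy z ^+ k1 * cauchy z ^+ k2 * cauchy z ^+ (k - k1 - k2)) =
  ((`|z| ^+ 2 * cauchy z) ^+ k1 * (`|z| * cauchy z) ^+ k2) * cauchy z ^+ (k - k1 - k2).
  rewrite !exprMn; ring.
have h1 : 0 <= `|z| ^+ 2 * cauchy z by rewrite mulr_ge0 ?sqr_ge0 ?ltW.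
have h2 : 0 <= `|z| * cauchy z by rewrite mulr_ge0 // ltW.
have h3 : 0 <= cauchy z by exact: ltW.
have h4 : (`|z| ^+ 2 * cauchy z) ^+ k1 * (`|z| * cauchy z) ^+ k2 <= 1.
  by apply: mulr_ile1; rewrite ?exprn_ge0 ?exprn_ile1.
by apply: mulr_ile1 => //; rewrite ?mulr_ge0 ?exprn_ge0 ?exprn_ile1.
Qed.

Lemma dominated_gauss i : dominated (fun z : R => z ^+ i * gauss z).
Proof.
have [C C0 HC] := @gauss_le_cauchy R (i + 4).
have [D D0 HD] := @dominated_cauchy i (i + 4)%N ltac:(lia).
exists (C * D) => [|z]; first by rewrite mulr_ge0 ?(ltW C0).
apply: (@le_trans _ _ (C * `|z ^+ i * cauchy z ^+ (i + 4)|)).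
  rewrite !normrM mulrCA ler_wpM2l// (ger0_norm (ltW (gauss_gt0 z))).
  by rewrite (le_trans (HC z))// ler_wpM2l ?ler_norm// ltW.
by rewrite -mulrA ler_wpM2l// ltW.
Qed.

Lemma ler_exprn2r n x y : 0 <= x -> x <= y -> x ^+ n <= y ^+ n.
Proof. by move=> x0 xy; rewrite lerXn2r// nnegrE (le_trans x0). Qed.

Lemma cauchy_shift z q : `|q| <= 1 -> cauchy (z - q) ^+ 2 <= 9 * cauchy z ^+ 2.
Proof.
move=> q1.
have q2 : q ^+ 2 <= 1 by rewrite -[q ^+ 2]real_normK ?num_real// exprn_ile1.
have -> : 9 * cauchy z ^+ 2 = (3 * cauchy z) ^+ 2 by ring.
apply: ler_exprn2r; first exact/ltW/cauchy_gt0.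
rewrite /cauchy -[leRHS]invrK lef_pV2 ?posrE ?one_sqr_gt0//; last first.
  by rewrite invr_gt0 mulr_gt0// invr_gt0 one_sqr_gt0.
rewrite invfM invrK ler_pdivrMl//.
have := sqr_ge0 (z - q); have := sqr_ge0 (z - 2 * q); move: q2; rewrite !expr2; lra.
Qed.

Lemma cauchy_scale z l : `|l| <= 1 -> cauchy (z * expR (- l)) ^+ 2 <= expR 4 * cauchy z ^+ 2.
Proof.
move=> l1.
have -> : expR 4 * cauchy z ^+ 2 = (expR 2 * cauchy z) ^+ 2.
  by rewrite exprMn -expRM_natl; congr (expR _ * _); ring.
apply: ler_exprn2r; first exact/ltW/cauchy_gt0.
rewrite /cauchy -[leRHS]invrK lef_pV2 ?posrE ?one_sqr_gt0//; last first.
  by rewrite invr_gt0 mulr_gt0 ?expR_gt0// invr_gt0 one_sqr_gt0.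
rewrite invfM invrK ler_pdivrMl ?expR_gt0//.
rewrite exprMn -expRM_natl mulrDr mulr1 lerD//.
  by rewrite -expR0 ler_expR.
rewrite mulrCA -expRD ler_peMr ?sqr_ge0//.
rewrite -[leLHS]expR0 ler_expR.
have := ler_norm l; lra.
Qed.

Lemma space_taylor H H1 H2 H3 :
  (forall z, is_derive z 1 H (H1 z)) -> (forall z, is_derive z 1 H1 (H2 z)) ->
  (forall z, is_derive z 1 H2 (H3 z)) -> dominated H3 ->
  exists2 C, 0 <= C & forall z q, `|q| <= 1 ->
    `|H (z - q) - H z + q * H1 z - q ^+ 2 / 2 * H2 z| <= C * `|q| ^+ 3 * cauchy z ^+ 2.
Proof.
move=> d1 d2 d3 [C C0 HC]; exists (C * 9) => [|z q q1]; first by rewrite mulr_ge0.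
have dz (t : R) : is_derive t 1 (fun q : R => z - q) (-1 : R).
  by apply: (is_derive_eq (drvB (drvC z t) (drvI t))); ring.
rewrite [leRHS]mulrAC; move: q q1.
pose f2 q := H2 (z - q) - H2 z.
pose f1 q := - H1 (z - q) + H1 z - q * H2 z.
apply: (@integrate_bound _ (fun q => H (z - q) - H z + q * H1 z - q ^+ 2 / 2 * H2 z) f1 _ 2).
- move=> t; apply: (is_derive_eq (drvB (drvD (drvB (drv_comp (d1 _) (dz t))
    (drvC (H z) t)) (drvM (drvI t) (drvC (H1 z) t)))
    (drvM (drvM (drvX 2 (drvI t)) (drvC (2^-1) t)) (drvC (H2 z) t)))).
  by rewrite /f1 /=; field.
- by rewrite subr0 mul0r expr0n /= !mul0r; ring.
apply: (@integrate_bound _ f1 f2 _ 1).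
- move=> t; apply: (is_derive_eq (drvB (drvD (drvN (drv_comp (d2 _) (dz t)))
    (drvC (H1 z) t)) (drvM (drvI t) (drvC (H2 z) t)))).
  by rewrite /f2 /=; ring.
- by rewrite /f1 subr0 mul0r; ring.
apply: (@integrate_bound _ f2 (fun q => - H3 (z - q)) _ 0).
- move=> t; apply: (is_derive_eq (drvB (drv_comp (d3 _) (dz t)) (drvC (H2 z) t))).
  by ring.
- by rewrite /f2 subr0 subrr.
move=> t t1; rewrite normrN expr0 mulr1 (le_trans (HC _))// -mulrA ler_wpM2l//.
exact: cauchy_shift.
Qed.

(** A step of the clock changes r into r e^l, hence z into z e^(-l) and the
    prefactor r^(-b) into r^(-b) e^(-b l). *)
Lemma time_taylor (b : R) H H1 H2 : 0 <= b ->
  (forall z, is_derive z 1 H (H1 z)) -> (forall z, is_derive z 1 H1 (H2 z)) ->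
  dominated (fun z => b ^+ 2 * H z + (2 * b + 1) * (z * H1 z) + z ^+ 2 * H2 z) ->
  exists2 C, 0 <= C & forall z l, `|l| <= 1 ->
    `|expR (- b * l) * H (z * expR (- l)) - H z + l * (b * H z + z * H1 z)|
      <= C * `|l| ^+ 2 * cauchy z ^+ 2.
Proof.
move=> b0 d1 d2 [C C0 HC].
exists (expR b * C * expR 4) => [|z l l1]; first by rewrite !mulr_ge0 ?expR_ge0.
rewrite [leRHS]mulrAC; move: l l1.
have dz (t : R) : is_derive t 1 (fun l : R => z * expR (- l)) (- (z * expR (- t))).
  by apply: (is_derive_eq (drvZ z (drv_expR (drvN (drvI t))))); ring.
have db (t : R) : is_derive t 1 (fun l : R => expR (- b * l)) (- b * expR (- b * t)).
  by apply: (is_derive_eq (drv_expR (drvZ (- b) (drvI t)))); ring.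
pose f1 l := - (expR (- b * l) * (b * H (z * expR (- l)) + z * expR (- l) * H1 (z * expR (- l)))) +
   (b * H z + z * H1 z).
apply: (@integrate_bound _ (fun l => expR (- b * l) * H (z * expR (- l)) - H z + l * (b * H z + z * H1 z)) f1 _ 1).
- move=> t; apply: (is_derive_eq (drvD (drvB (drvM (db t) (drv_comp (d1 _) (dz t)))
    (drvC (H z) t)) (drvM (drvI t) (drvC (b * H z + z * H1 z) t)))).
  by rewrite /f1; ring.
- by rewrite !(mulr0, oppr0, expR0, mulr1, mul1r, mul0r); ring.
pose f2 l := expR (- b * l) * (b ^+ 2 * H (z * expR (- l)) + (2 * b + 1) * ((z * expR (- l)) * H1 (z * expR (- l)))
  + (z * expR (- l)) ^+ 2 * H2 (z * expR (- l))).
apply: (@integrate_bound _ f1 f2 _ 0).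
- move=> t; apply: (is_derive_eq (drvD (drvN (drvM (db t)
    (drvD (drvZ b (drv_comp (d1 _) (dz t))) (drvM (dz t) (drv_comp (d2 _) (dz t))))))
    (drvC (b * H z + z * H1 z) t))).
  by rewrite /f2; ring.
- by rewrite /f1 !(mulr0, oppr0, expR0, mulr1, mul1r); ring.
move=> t t1; rewrite expr0 mulr1 /f2 normrM ger0_norm ?expR_ge0// -2![leRHS]mulrA.
apply: ler_pM => //.
  rewrite ler_expR; have : - t <= 1 by rewrite (le_trans _ t1)// -normrN ler_norm.
  nra.
rewrite (le_trans (HC _))// ler_wpM2l//.
exact: cauchy_scale.
Qed.

Lemma ln1p_half (x : R) : 0 <= x <= 1 ->
  0 <= ln (1 + x) / 2 <= 1 /\ `|ln (1 + x) / 2 - x / 2| <= x ^+ 2 / 2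
  /\ ln (1 + x) / 2 <= x / 2.
Proof.
move=> /andP[x0 x1].
have l0 : 0 <= ln (1 + x) by rewrite ln_ge0// lerDl.
have l1 : ln (1 + x) <= x.
  by rewrite -ler_expR lnK ?posrE ?expR_ge1Dx//; lra.
have l2 : x - x ^+ 2 <= ln (1 + x).
  apply: (@le_trans _ _ (x / (1 + x))).
    rewrite ler_pdivlMr; last lra.
    have : 0 <= x ^+ 3 by rewrite exprn_ge0.
    rewrite !exprS expr0; nra.
  have xE : x / (1 + x) = 1 - (1 + x)^-1 by field; lra.
  rewrite -ler_expR lnK ?posrE; last lra.
  rewrite -[leRHS]invrK -[leLHS]invrK -expRN lef_pV2 ?posrE ?invr_gt0 ?expR_gt0//; last lra.
  by apply: le_trans (expR_ge1Dx _); rewrite xE; lra.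
split; first by apply/andP; split; lra.
split; last by lra.
rewrite ler_norml; apply/andP; split; lra.
Qed.

(** One step for a function of the form r^(-b) H(z), in units where r = 1: the
    martingale moves by q and the clock by x, so that r^2 becomes 1 + x before
    the step. The main term is arranged as a multiple of q, which has mean zero,
    a multiple of q^2 - x, which has mean zero when x is the conditional
    variance, and the image H'' + b H + z H' of H under the heat operator. *)
Lemma profile_step (b : R) H H1 H2 H3 : 0 <= b ->
  (forall z, is_derive z 1 H (H1 z)) -> (forall z, is_derive z 1 H1 (H2 z)) ->
  (forall z, is_derive z 1 H2 (H3 z)) -> dominated H3 ->
  dominated (fun z => b * H z + z * H1 z) ->
  dominated (fun z => b ^+ 2 * H z + (2 * b + 1) * (z * H1 z) + z ^+ 2 * H2 z) ->
  exists2 C, 0 <= C & forall z q x, `|q| <= 1 -> 0 <= x <= 1 ->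
    let l := ln (1 + x) / 2 in
    `|H (z - q) - expR (- b * l) * H (z * expR (- l)) -
      (- q * H1 z + (q ^+ 2 - x) / 2 * H2 z + x / 2 * (H2 z + b * H z + z * H1 z))|
      <= C * (`|q| ^+ 3 + x ^+ 2) * cauchy z ^+ 2.
Proof.
move=> b0 d1 d2 d3 D3 [D0 D00 HD0] D2.
have [C1 C10 HC1] := space_taylor d1 d2 d3 D3.
have [C2 C20 HC2] := time_taylor b0 d1 d2 D2.
exists (C1 + C2 + D0) => [|z q x q1 x01 /=]; first by rewrite !addr_ge0.
set l := ln (1 + x) / 2.
have [/andP[l0 l1] [lx lx']] := ln1p_half x01; rewrite -/l in l0 l1 lx lx'.
have h0 : 0 <= cauchy z ^+ 2 by exact: sqr_ge0.
have {}HC1 := HC1 z q q1.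
have nl : `|l| <= 1 by rewrite ger0_norm.
have {}HC2 := HC2 z l nl.
have {}HD0 := HD0 z.
have lD : `|(l - x / 2) * (b * H z + z * H1 z)| <= (x ^+ 2 / 2) * (D0 * cauchy z ^+ 2).
  by rewrite normrM ler_pM.
have q3 : 0 <= `|q| ^+ 3 by rewrite exprn_ge0.
have l2 : `|l| ^+ 2 <= x ^+ 2.
  by rewrite ger0_norm//; apply: ler_exprn2r => //; case/andP: x01; lra.
have -> : H (z - q) - expR (- b * l) * H (z * expR (- l)) -
      (- q * H1 z + (q ^+ 2 - x) / 2 * H2 z + x / 2 * (H2 z + b * H z + z * H1 z)) =
  (H (z - q) - H z + q * H1 z - q ^+ 2 / 2 * H2 z) -
  (expR (- b * l) * H (z * expR (- l)) - H z + l * (b * H z + z * H1 z)) +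
  (l - x / 2) * (b * H z + z * H1 z) by field.
apply: le_trans (ler_normD _ _) _.
apply: le_trans (lerD (ler_normB _ _) lD) _.
apply: le_trans (lerD (lerD HC1 HC2) (lexx _)) _.
have -> : (C1 + C2 + D0) * (`|q| ^+ 3 + x ^+ 2) * cauchy z ^+ 2 =
  C1 * `|q| ^+ 3 * cauchy z ^+ 2 + C1 * x ^+ 2 * cauchy z ^+ 2 + (C2 * (`|q| ^+ 3 + x ^+ 2)) * cauchy z ^+ 2
  + D0 * (`|q| ^+ 3 + x ^+ 2) * cauchy z ^+ 2 by ring.
have x2 := sqr_ge0 x.
apply: lerD; first apply: lerD.
- by rewrite lerDl; exact: mulr_ge0 (mulr_ge0 C10 x2) h0.
- rewrite ler_wpM2r// ler_wpM2l//; lra.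
- rewrite mulrCA mulrA ler_wpM2r// ler_wpM2l//; lra.
Qed.

End domination.

(** * The three profiles *)
Section profiles.
Context {R : realType}.
Implicit Types (f g : R -> R) (x y z q b : R).

Lemma eq_dominated f g : f =1 g -> dominated g -> dominated f.
Proof. by move=> fg; rewrite (_ : f = g)//; apply/funext. Qed.

Lemma gauss2_derive z : is_derive z 1 (fun y : R => - y * gauss y) ((z ^+ 2 - 1) * gauss z).
Proof.
apply: (is_derive_eq (drvM (drvN (drvI z)) (gauss_derive z))); ring.
Qed.

Lemma gauss3_derive z :
  is_derive z 1 (fun y : R => (y ^+ 2 - 1) * gauss y) ((3 * z - z ^+ 3) * gauss z).
Proof.
apply: (is_derive_eq (drvM (drvB (drvX 2 (drvI z)) (drvC 1 z)) (gauss_derive z))).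
by rewrite /=; ring.
Qed.

Lemma cauchyX_derive n z :
  is_derive z 1 (fun y : R => cauchy y ^+ n.+1) (- (2 * n.+1%:R) * z * cauchy z ^+ n.+2).
Proof.
apply: (is_derive_eq (drvX n.+1 (cauchy_derive z))).
by rewrite /= !exprS expr0; ring.
Qed.

Lemma cauchy2_derive z :
  is_derive z 1 (fun y : R => cauchy y ^+ 2) (- 4 * z * cauchy z ^+ 3).
Proof. by apply: (is_derive_eq (cauchyX_derive 1 z)); ring. Qed.

Lemma cauchy3_derive z :
  is_derive z 1 (fun y : R => - 4 * y * cauchy y ^+ 3)
    (- 4 * cauchy z ^+ 3 + 24 * (z ^+ 2 * cauchy z ^+ 4)).
Proof.
apply: (is_derive_eq (drvM (drvZ (-4) (drvI z)) (cauchyX_derive 2 z))); ring.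
Qed.

Lemma cauchy4_derive z :
  is_derive z 1 (fun y : R => - 4 * cauchy y ^+ 3 + 24 * (y ^+ 2 * cauchy y ^+ 4))
    (72 * (z * cauchy z ^+ 4) - 192 * (z ^+ 3 * cauchy z ^+ 5)).
Proof.
apply: (is_derive_eq (drvD (drvZ (-4) (cauchyX_derive 2 z))
  (drvZ 24 (drvM (drvX 2 (drvI z)) (cauchyX_derive 3 z))))).
by rewrite /=; ring.
Qed.

Lemma normal_step : exists2 C, 0 <= C & forall z q x, `|q| <= 1 -> 0 <= x <= 1 ->
  let l := ln (1 + x) / 2 in
  `|Phi (z - q) - Phi (z * expR (- l)) -
    (- q * (kappa * gauss z) + (q ^+ 2 - x) / 2 * (kappa * (- z * gauss z)))|
  <= C * (`|q| ^+ 3 + x ^+ 2) * cauchy z ^+ 2.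
Proof.
have [|||||C C0 HC] := @profile_step R 0 Phi (fun z => kappa * gauss z) (fun z => kappa * (- z * gauss z))
  (fun z => kappa * ((z ^+ 2 - 1) * gauss z)) (lexx _) (@Phi_derive R).
- by move=> z; exact: drvZ (gauss_derive z).
- by move=> z; exact: drvZ (gauss2_derive z).
- apply: (@eq_dominated _ (fun z => kappa * (z ^+ 2 * gauss z + (-1) * (z ^+ 0 * gauss z)))).
    by move=> z; ring.
  by apply: dominatedZ; apply: dominatedD; [|apply: dominatedZ]; exact: dominated_gauss.
- apply: (@eq_dominated _ (fun z => kappa * (z ^+ 1 * gauss z))) => [z|]; first by ring.
  by apply: dominatedZ; exact: dominated_gauss.
- apply: (@eq_dominated _ (fun z => kappa * (z ^+ 1 * gauss z) + (- kappa) * (z ^+ 3 * gauss z))).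
    by move=> z; ring.
  by apply: dominatedD; apply: dominatedZ; exact: dominated_gauss.
exists C => // z q x q1 x1 /=; apply: le_trans (HC z q x q1 x1).
rewrite /= oppr0 mul0r expR0 mul1r mul0r addr0.
rewrite (_ : kappa * (- z * gauss z) + z * (kappa * gauss z) = 0); last by ring.
by rewrite mulr0 addr0.
Qed.

Lemma gauss_step b : 0 <= b -> exists2 C, 0 <= C & forall z q x, `|q| <= 1 -> 0 <= x <= 1 ->
  let l := ln (1 + x) / 2 in
  `|gauss (z - q) - expR (- b * l) * gauss (z * expR (- l)) -
    (- q * (- z * gauss z) + (q ^+ 2 - x) / 2 * ((z ^+ 2 - 1) * gauss z) + x / 2 * ((b - 1) * gauss z))|
  <= C * (`|q| ^+ 3 + x ^+ 2) * cauchy z ^+ 2.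
Proof.
move=> b0.
have [|||C C0 HC] := @profile_step R b gauss _ _ _ b0 (@gauss_derive R) gauss2_derive gauss3_derive.
- apply: (@eq_dominated _ (fun z => 3 * (z ^+ 1 * gauss z) + (-1) * (z ^+ 3 * gauss z))).
    by move=> z; ring.
  by apply: dominatedD; apply: dominatedZ; exact: dominated_gauss.
- apply: (@eq_dominated _ (fun z => b * (z ^+ 0 * gauss z) + (-1) * (z ^+ 2 * gauss z))).
    by move=> z; ring.
  by apply: dominatedD; apply: dominatedZ; exact: dominated_gauss.
- apply: (@eq_dominated _ (fun z => b ^+ 2 * (z ^+ 0 * gauss z) + (- 2 * b - 2) * (z ^+ 2 * gauss z)
     + 1 * (z ^+ 4 * gauss z))).
    by move=> z; ring.
  by apply: dominatedD; first apply: dominatedD; apply: dominatedZ; exact: dominated_gauss.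
exists C => // z q x q1 x1 /=; apply: le_trans (HC z q x q1 x1).
rewrite /= (_ : (z ^+ 2 - 1) * gauss z + b * gauss z + z * (- z * gauss z) = (b - 1) * gauss z) //.
by ring.
Qed.

Lemma cauchy_step b : 0 <= b -> exists2 C, 0 <= C & forall z q x, `|q| <= 1 -> 0 <= x <= 1 ->
  let l := ln (1 + x) / 2 in
  `|cauchy (z - q) ^+ 2 - expR (- b * l) * cauchy (z * expR (- l)) ^+ 2 -
    (- q * (- 4 * z * cauchy z ^+ 3) + (q ^+ 2 - x) / 2 * (- 4 * cauchy z ^+ 3 + 24 * (z ^+ 2 * cauchy z ^+ 4))
     + x / 2 * ((b - 4 + 24 * cauchy z * (1 - cauchy z)) * cauchy z ^+ 2))|
  <= C * (`|q| ^+ 3 + x ^+ 2) * cauchy z ^+ 2.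
Proof.
move=> b0.
have [|||C C0 HC] := @profile_step R b (fun z => cauchy z ^+ 2) _ _ _ b0 cauchy2_derive cauchy3_derive cauchy4_derive.
- apply: (@eq_dominated _ (fun z => 72 * (z ^+ 1 * cauchy z ^+ 4) + (-192) * (z ^+ 3 * cauchy z ^+ 5))).
    by move=> z; ring.
  by apply: dominatedD; apply: dominatedZ; exact: dominated_cauchy.
- apply: (@eq_dominated _ (fun z => b * (z ^+ 0 * cauchy z ^+ 2) + (-4) * (z ^+ 2 * cauchy z ^+ 3))).
    by move=> z; ring.
  by apply: dominatedD; apply: dominatedZ; exact: dominated_cauchy.
- apply: (@eq_dominated _ (fun z => b ^+ 2 * (z ^+ 0 * cauchy z ^+ 2) + (- 8 * b - 8) * (z ^+ 2 * cauchy z ^+ 3)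
     + 24 * (z ^+ 4 * cauchy z ^+ 4))).
    by move=> z; ring.
  by apply: dominatedD; first apply: dominatedD; apply: dominatedZ; exact: dominated_cauchy.
exists C => // z q x q1 x1 /=; apply: le_trans (HC z q x q1 x1).
have zc : z ^+ 2 * cauchy z = 1 - cauchy z by have := cauchyE z; lra.
rewrite /= (_ : - 4 * cauchy z ^+ 3 + 24 * (z ^+ 2 * cauchy z ^+ 4) + b * cauchy z ^+ 2 + z * (- 4 * z * cauchy z ^+ 3)
  = (b - 4 + 24 * cauchy z * (1 - cauchy z)) * cauchy z ^+ 2) //.
rewrite (_ : _ + z * _ = - 4 * cauchy z ^+ 3 + 24 * cauchy z ^+ 3 * (z ^+ 2 * cauchy z) + b * cauchy z ^+ 2
   - 4 * cauchy z ^+ 2 * (z ^+ 2 * cauchy z)); last by ring.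
by rewrite zc; ring.
Qed.

(** The density decays faster than 1/|x|, so a relative perturbation of x has an
    effect that is uniform in x. *)
Lemma Phi_scale : exists2 C : R, 0 <= C &
  forall x t, 1 / 2 <= t -> `|Phi (x * t) - Phi x| <= C * `|t - 1|.
Proof.
have [C C0 HC] := @dominated_gauss R 1.
exists (kappa * (2 * C)) => [|x t t2]; first by rewrite !mulr_ge0 // ltW ?kappa_gt0.
have [c -> cxt] := mean_value x (x * t) (@Phi_derive R).
have xc : `|x| <= 2 * `|c|.
  have [x0|/ltW x0] := leP 0 x.
    have xm : x / 2 <= Num.min x (x * t) by rewrite le_min; apply/andP; split; nra.
    have : x / 2 <= c by rewrite (le_trans xm)//; case/andP: cxt.
    by rewrite ger0_norm// => xc; rewrite ger0_norm; lra.
  have xm : Num.max x (x * t) <= x / 2 by rewrite ge_max; apply/andP; split; nra.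
  have : c <= x / 2 by apply: le_trans xm; case/andP: cxt.
  by rewrite ler0_norm// => xc; rewrite ler0_norm; lra.
rewrite (_ : kappa * gauss c * (x * t - x) = kappa * (gauss c * x) * (t - 1)); last by ring.
rewrite !normrM (ger0_norm (ltW kappa_gt0)) ler_wpM2r// ler_wpM2l ?(ltW kappa_gt0)//.
rewrite (ger0_norm (ltW (gauss_gt0 c))).
apply: (@le_trans _ _ (2 * `|c ^+ 1 * gauss c|)).
  rewrite normrM expr1 (ger0_norm (ltW (gauss_gt0 c))); have := gauss_gt0 c; nra.
rewrite ler_wpM2l// (le_trans (HC c))// ler_piMr// exprn_ile1 ?cauchy_le1//.
exact/ltW/cauchy_gt0.
Qed.

End profiles.

(** * Powers with real exponents *)
Section young.
Context {R : realType}.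
Implicit Types (p c q x m : R).

Lemma powR_exp q a : 0 < q -> q `^ a = expR (a * ln q).
Proof. by move=> q0; rewrite /powR gt_eqF. Qed.

(** Here q is |X| / r and e^m is rho = r / eps. If q exceeds c rho^(-b), then
    q^(2p-3) rho^(2p) is bounded below, because b (2p - 3) <= 2p. *)
Lemma young_cubic p c : 1 < p -> 0 < c -> let b := 1 + (2 * p)^-1 in
  exists2 C, 0 <= C & forall q m, 0 <= q -> q <= 1 -> 0 <= m ->
    q ^+ 3 <= c * expR (- b * m) * q ^+ 2 + C * expR (2 * p * m) * q `^ (2 * p).
Proof.
move=> p1 c0 b; exists (expR (`|2 * p - 3| * `|ln c|)) => [|q m q0 q1 m0]; first exact: expR_ge0.
set C := expR (`|2 * p - 3| * _); have C0 : 0 < C by exact: expR_gt0.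
have [qc|qc] := leP q (c * expR (- b * m)).
  rewrite (@le_trans _ _ (c * expR (- b * m) * q ^+ 2))//.
    by rewrite exprS ler_wpM2r// exprn_ge0.
  by rewrite lerDl !mulr_ge0 ?expR_ge0 ?powR_ge0// ltW.
have qp : 0 < q by rewrite (lt_trans _ qc)// mulr_gt0// expR_gt0.
apply: (@le_trans _ _ (C * expR (2 * p * m) * q `^ (2 * p))); last first.
  by rewrite lerDr !mulr_ge0 ?expR_ge0 ?exprn_ge0// ltW.
have u0 : ln q <= 0 by exact: ln_le0.
have uc : ln c - b * m <= ln q.
  rewrite -ler_expR (@lnK _ q) ?posrE// expRD lnK ?posrE//.
  by rewrite -mulNr ltW.
rewrite powR_exp// -{1}(@lnK _ q) ?posrE// -expRM_natl -!expRD ler_expR.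
have [p3|p3] := leP (2 * p) 3.
  have := normr_ge0 (2 * p - 3); have := normr_ge0 (ln c); nra.
rewrite gtr0_norm; last lra.
have h1 : (2 * p - 3) * (ln c - b * m) <= (2 * p - 3) * ln q by rewrite ler_wpM2l//; lra.
have h2 : - ((2 * p - 3) * `|ln c|) <= (2 * p - 3) * ln c.
  by rewrite -mulrN ler_wpM2l//; [lra|have := ler_norm (- ln c); rewrite normrN; lra].
have h3 : (2 * p - 3) * b <= 2 * p.
  have -> : (2 * p - 3) * b = 2 * p - 2 - 3 * (2 * p)^-1 by rewrite /b; field; lra.
  have : 0 < (2 * p)^-1 by rewrite invr_gt0; lra.
  lra.
have h4 : (2 * p - 3) * b * m <= 2 * p * m by rewrite ler_wpM2r.
lra.
Qed.

Lemma powR_ge_min (x a : R) : 0 <= x -> 1 <= a -> x <= 1 + x `^ a.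
Proof.
move=> x0 a1; have [x1|/ltW x1] := leP x 1; first by have := powR_ge0 x a; lra.
by rewrite -[leLHS]powRr1// (@le_trans _ _ (x `^ a)) ?ler_powR//; lra.
Qed.

Lemma powR_sqr (x a : R) : (x ^+ 2) `^ a = `|x| `^ (2 * a).
Proof. by rewrite powRrM (powR_mulrn 2 (normr_ge0 x)) real_normK ?num_real. Qed.

End young.

(** * The barrier *)
Section barrier.
Context {R : realType}.
Variables (p K al B : R).

Local Notation b := (1 + al).
(* The factor 7 / 2 of [drift_le] and the value exp(-11/2) of the Gaussian at
   z^2 = 11 determine B. *)
Local Notation admissible :=
  [/\ 1 < p, 0 < K, al = (2 * p)^-1 & 7 * B = al * expR (- (11 / 2))].

Lemma admissible_pos : admissible -> [/\ 0 < 2 * p, 0 < al, al < 1 / 2 & 0 < B].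
Proof.
move=> [p1 K0 alE BE].
have p2 : 0 < 2 * p by lra.
have al0 : 0 < al by rewrite alE invr_gt0.
split=> //; first by rewrite alE div1r ltf_pV2 ?posrE//; lra.
by rewrite -(pmulr_rgt0 _ (ltr0n _ 7)) BE mulr_gt0 ?expR_gt0.
Qed.

(** The variables are z = (x - s) / r and m = ln (r / eps), so that e^(-m) is
    1 / rho. *)
Definition barrier z m : R := Phi z +
  K * ((expR (- 1 * m) - expR (- b * m)) * gauss z + B * expR (- b * m) * cauchy z ^+ 2).

(** The coefficients of the increment and of the difference between its square
    and the conditional variance in [barrier_step]; up to the last term of
    [barrier2], which pays for the remainder, they are the first derivative and
    half the second derivative of [barrier] in z. *)
Definition barrier1 z m : R := kappa * gauss z +
  K * ((expR (- 1 * m) - expR (- b * m)) * (- z * gauss z) + B * expR (- b * m) * (- 4 * z * cauchy z ^+ 3)).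

Definition barrier2 z m : R := (kappa * (- z * gauss z) +
  K * ((expR (- 1 * m) - expR (- b * m)) * ((z ^+ 2 - 1) * gauss z) +
    B * expR (- b * m) * (- 4 * cauchy z ^+ 3 + 24 * (z ^+ 2 * cauchy z ^+ 4)))) / 2 +
  K * B / 8 * expR (- b * m) * cauchy z ^+ 2.

(** The image of the h-term under the heat operator can be positive only for
    z^2 <= 11; it is at most 7/2 h there, and the Gaussian defect outweighs it by
    the choice of B. *)
Lemma drift_le (z : R) : admissible ->
  - al * gauss z + B * ((b - 4 + 24 * cauchy z * (1 - cauchy z)) * cauchy z ^+ 2)
  <= - (B / 2) * cauchy z ^+ 2.
Proof.
move=> adm; have [p2_gt0 al_gt0 al_lt B_gt0] := admissible_pos adm.
have [p_gt1 K_gt0 alE BE] := adm.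
have c0 := cauchy_gt0 z; have c1 := cauchy_le1 z.
have c2 : 0 <= cauchy z ^+ 2 by exact: sqr_ge0.
have [cz|cz] := leP (1 / 12) (cauchy z).
  have z11 : z ^+ 2 <= 11 by have := cauchyE z; have := sqr_ge0 z; nra.
  have g0 : expR (- (11 / 2)) <= gauss z by rewrite ler_expR; lra.
  have gc : expR (- (11 / 2)) * cauchy z ^+ 2 <= gauss z.
    by rewrite (le_trans _ g0)// ler_piMr ?expR_ge0// exprn_ile1// ltW.
  have gc' : 7 * B * cauchy z ^+ 2 <= al * gauss z.
    rewrite (_ : 7 * B = al * expR (- (11 / 2))); last by rewrite BE.
    by rewrite -mulrA ler_wpM2l// ltW.
  have h : b - 4 + 24 * cauchy z * (1 - cauchy z) <= 7 / 2.
    by have := sqr_ge0 (cauchy z - 1 / 2); rewrite expr2; nra.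
  have : B * ((b - 4 + 24 * cauchy z * (1 - cauchy z)) * cauchy z ^+ 2) <= B * (7 / 2 * cauchy z ^+ 2).
    by rewrite ler_wpM2l ?(ltW B_gt0)// ler_wpM2r.
  have : 0 <= B * cauchy z ^+ 2 by rewrite mulr_ge0// ltW.
  lra.
have h : b - 4 + 24 * cauchy z * (1 - cauchy z) <= - (1 / 2).
  by nra.
have : B * ((b - 4 + 24 * cauchy z * (1 - cauchy z)) * cauchy z ^+ 2) <= B * (- (1 / 2) * cauchy z ^+ 2).
  by rewrite ler_wpM2l ?(ltW B_gt0)// ler_wpM2r.
have : 0 <= al * gauss z by rewrite mulr_ge0// ltW// gauss_gt0.
lra.
Qed.

Let em (m : R) : 0 <= m -> 0 <= expR (- 1 * m) <= 1.
Proof. by move=> m0; rewrite expR_ge0 -[leRHS]expR0 ler_expR; lra. Qed.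

Let ebm (m : R) : admissible -> 0 <= m -> 0 <= expR (- b * m) <= 1.
Proof.
move=> adm; have [p2_gt0 al_gt0 al_lt B_gt0] := admissible_pos adm.
have [p_gt1 K_gt0 alE BE] := adm.
move=> m0; rewrite expR_ge0 -[leRHS]expR0 ler_expR.
by have : 0 <= b * m; [rewrite mulr_ge0//; lra|lra].
Qed.

(** The remainders of the four expansions are at most a constant times
    (|q|^3 + x^2) h. By [young_cubic] this is paid for by the defect of
    [drift_le] and by moments of order 2p. The defect is proportional to x, while
    part of the remainder is proportional to q^2; their difference goes into the
    last term of [barrier2], as q^2 - x has mean zero. *)
Lemma barrier_small_step : admissible -> exists2 C, 0 <= C &
  forall z q x m, `|q| <= 1 -> 0 <= x <= 1 -> 0 <= m ->
  let l := ln (1 + x) / 2 in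
  barrier (z - q) m - barrier (z * expR (- l)) (m + l) <=
  - q * barrier1 z m + (q ^+ 2 - x) * barrier2 z m +
  C * expR (2 * p * m) * (`|q| `^ (2 * p) + x `^ p).
Proof.
move=> adm; have [p2_gt0 al_gt0 al_lt B_gt0] := admissible_pos adm.
have [p_gt1 K_gt0 alE BE] := adm.
have b0 : 0 <= b by lra.
have [C1 C10 H1] := @normal_step R.
have [C2 C20 H2] := @gauss_step R 1 ler01.
have [C3 C30 H3] := @gauss_step R b b0.
have [C4 C40 H4] := @cauchy_step R b b0.
pose C' := C1 + K * C2 + K * C3 + K * B * C4.
have KB0 : 0 < K * B by rewrite mulr_gt0.
have C'0 : 0 <= C' by rewrite !addr_ge0 ?mulr_ge0 // ltW.
pose c := K * B / 8 / (C' + 1).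
have c0 : 0 < c by rewrite !divr_gt0//; lra.
have [C5 C50] := young_cubic p_gt1 c0; rewrite /= -alE => H5.
exists (C' * C5) => [|z q x m q1 x1 m0 /=]; first by rewrite mulr_ge0.
set l := ln (1 + x) / 2.
have /andP[x0 x1'] := x1.
have /andP[e10 e11] := em m0; have /andP[eb0 eb1] := ebm adm m0.
have cc0 : 0 <= cauchy z ^+ 2 by exact: sqr_ge0.
have cc1 : cauchy z ^+ 2 <= 1 by rewrite exprn_ile1 ?cauchy_le1// ltW// cauchy_gt0.
have := H1 z q x q1 x1; have := H2 z q x q1 x1; have := H3 z q x q1 x1; have := H4 z q x q1 x1.
rewrite /= -/l.
set E4 := _ - _ - _; set E3 := (X in `|X| <= C3 * _ * _);
  set E2 := (X in `|X| <= C2 * _ * _); set E1 := (X in `|X| <= C1 * _ * _) => N4 N3 N2 N1.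
have DE : barrier (z - q) m - barrier (z * expR (- l)) (m + l) =
  - q * barrier1 z m + (q ^+ 2 - x) * (barrier2 z m - K * B / 8 * expR (- b * m) * cauchy z ^+ 2) +
  x / 2 * (K * expR (- b * m) * (- al * gauss z + B * ((b - 4 + 24 * cauchy z * (1 - cauchy z)) * cauchy z ^+ 2)))
  + (E1 + K * expR (- 1 * m) * E2 - K * expR (- b * m) * E3 + K * B * expR (- b * m) * E4).
  rewrite /barrier !mulrDr !expRD /barrier1 /barrier2 /E1 /E2 /E3 /E4.
  rewrite (_ : al = b - 1); last by ring.
  by field.
pose W := (`|q| ^+ 3 + x ^+ 2) * cauchy z ^+ 2.
have W0 : 0 <= W by rewrite mulr_ge0// addr_ge0 ?exprn_ge0.
have NE : E1 + K * expR (- 1 * m) * E2 - K * expR (- b * m) * E3 + K * B * expR (- b * m) * E4 <= C' * W.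
  rewrite /C' !mulrDl; apply: lerD; first apply: lerD; first apply: lerD.
  - by rewrite (le_trans (ler_norm _))// mulrA.
  - rewrite -!mulrA ler_wpM2l ?(ltW K_gt0)// (le_trans (ler_norm _))// normrM.
    by rewrite ger0_norm// (le_trans (ler_piMl _ _))// mulrA.
  - rewrite -mulrN -!mulrA ler_wpM2l ?(ltW K_gt0)// (le_trans (ler_norm _))// normrM normrN.
    by rewrite ger0_norm// (le_trans (ler_piMl _ _))// mulrA.
  - rewrite -!mulrA ler_wpM2l ?(ltW K_gt0)// ler_wpM2l ?(ltW B_gt0)// (le_trans (ler_norm _))// normrM.
    by rewrite ger0_norm// (le_trans (ler_piMl _ _))// mulrA.
have Y1 : `|q| ^+ 3 <= c * expR (- b * m) * q ^+ 2 + C5 * expR (2 * p * m) * `|q| `^ (2 * p).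
  have := H5 `|q| m (normr_ge0 _) q1 m0.
  by rewrite real_normK ?num_real.
have Y2 : x ^+ 2 <= c * expR (- b * m) * x + C5 * expR (2 * p * m) * x `^ p.
  have s0 := sqrtr_ge0 x; have s1 : Num.sqrt x <= 1 by rewrite -sqrtr1 ler_sqrt.
  have := H5 (Num.sqrt x) m s0 s1 m0.
  have -> : Num.sqrt x `^ (2 * p) = x `^ p.
    by rewrite -[in LHS](ger0_norm s0) -powR_sqr sqr_sqrtr.
  have sx := sqr_sqrtr x0; rewrite sx => Y; apply: le_trans Y.
  rewrite -[X in X ^+ 2 <= _]sx -exprM (_ : (2 * 2 = 4)%N)// exprSr.
  by rewrite ler_piMr// exprn_ge0.
have YW : C' * W <= K * B / 8 * expR (- b * m) * (q ^+ 2 + x) * cauchy z ^+ 2 +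
    C' * C5 * expR (2 * p * m) * (`|q| `^ (2 * p) + x `^ p).
  set P := C5 * expR (2 * p * m) * (`|q| `^ (2 * p) + x `^ p).
  have P0 : 0 <= P by rewrite !mulr_ge0 ?addr_ge0 ?powR_ge0 ?expR_ge0.
  have -> : C' * C5 * expR (2 * p * m) * (`|q| `^ (2 * p) + x `^ p) = C' * P by rewrite /P; ring.
  set Q := expR (- b * m) * (q ^+ 2 + x) * cauchy z ^+ 2.
  have Q0 : 0 <= Q by apply: mulr_ge0 => //; rewrite mulr_ge0 ?addr_ge0 ?sqr_ge0.
  have h1 : W <= c * Q + P.
    have h2 : `|q| ^+ 3 + x ^+ 2 <= c * expR (- b * m) * (q ^+ 2 + x) + P by rewrite /P; lra.
    rewrite /W (le_trans (ler_wpM2r cc0 h2))// mulrDl lerD//.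
      by rewrite /Q; lra.
    by rewrite ler_piMr.
  rewrite (le_trans (ler_wpM2l C'0 h1))// mulrDr lerD//.
  have -> : K * B / 8 * expR (- b * m) * (q ^+ 2 + x) * cauchy z ^+ 2 = (C' + 1) * (c * Q).
    by rewrite /c /Q; field; lra.
  by apply: ler_wpM2r; [rewrite mulr_ge0// ltW|lra].
have DR : x / 2 * (K * expR (- b * m) * (- al * gauss z + B * ((b - 4 + 24 * cauchy z * (1 - cauchy z)) * cauchy z ^+ 2)))
   <= x / 2 * (K * expR (- b * m) * (- (B / 2) * cauchy z ^+ 2)).
  rewrite ler_wpM2l ?divr_ge0// ler_wpM2l ?mulr_ge0 ?(ltW K_gt0)//.
  exact: drift_le adm.
rewrite DE; lra.
Qed.

Lemma barrier_ge z m : admissible -> 0 <= m ->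
  Phi z + K * (B * expR (- b * m) * cauchy z ^+ 2) <= barrier z m.
Proof.
move=> adm m0; have [p2_gt0 al_gt0 al_lt B_gt0] := admissible_pos adm.
have [p_gt1 K_gt0 alE BE] := adm.
rewrite /barrier lerD2l ler_wpM2l ?(ltW K_gt0)// lerDr mulr_ge0 ?(ltW (gauss_gt0 _))//.
rewrite subr_ge0 ler_expR; have : 0 <= al * m by rewrite mulr_ge0// ltW.
lra.
Qed.

Lemma barrier_le z m : admissible -> 0 <= m -> barrier z m <= Phi z + K * (1 + B) * expR (- m).
Proof.
move=> adm m0; have [p2_gt0 al_gt0 al_lt B_gt0] := admissible_pos adm.
have [p_gt1 K_gt0 alE BE] := adm.
have /andP[e0 e1] := em m0; have /andP[eb0 eb1] := ebm adm m0.
rewrite /barrier lerD2l -[leRHS]mulrA ler_wpM2l ?(ltW K_gt0)// [leRHS]mulrDl mul1r mulN1r.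
have eb : expR (- b * m) <= expR (- m).
  rewrite ler_expR; have : 0 <= al * m by rewrite mulr_ge0// ltW.
  lra.
rewrite mulN1r in e0 e1.
apply: lerD.
  rewrite (@le_trans _ _ (expR (- m) * gauss z))//.
    by rewrite ler_wpM2r ?(ltW (gauss_gt0 _))//; lra.
  by rewrite ler_piMr// gauss_le1.
rewrite -mulrA ler_wpM2l ?(ltW B_gt0)//.
rewrite (le_trans _ eb)// ler_piMr// exprn_ile1 ?cauchy_le1// ltW// cauchy_gt0//.
Qed.

Lemma dominated_bounded (f : R -> R) : dominated f -> exists2 M, 0 <= M & forall z, `|f z| <= M.
Proof.
move=> [M M0 HM]; exists M => // z; apply: le_trans (HM z) _.
by rewrite ler_piMr// exprn_ile1 ?cauchy_le1// ltW// cauchy_gt0.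
Qed.

Lemma barrier_bounds : admissible -> exists2 M, 0 <= M & forall z m, 0 <= m ->
  [/\ 0 <= barrier z m <= M, `|barrier1 z m| <= M & `|barrier2 z m| <= M].
Proof.
move=> adm; have [p2_gt0 al_gt0 al_lt B_gt0] := admissible_pos adm.
have [p_gt1 K_gt0 alE BE] := adm.
have [M1 M10 H1] := dominated_bounded (@dominated_gauss R 1).
have [M2 M20 H2] := dominated_bounded (@dominated_gauss R 2).
have [M3 M30 H3] := dominated_bounded (@dominated_cauchy R 1 3 isT).
have [M4 M40 H4] := dominated_bounded (@dominated_cauchy R 2 4 isT).
have k0 := @kappa_gt0 R.
pose N1 := kappa + K * (M1 + B * (4 * M3)).
pose N2 := (kappa * M1 + K * (M2 + 1 + B * (4 + 24 * M4))) / 2 + K * B / 8.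
have KB : 0 < K * B by rewrite mulr_gt0.
have N10 : 0 <= N1 by rewrite addr_ge0 ?mulr_ge0 ?addr_ge0 ?mulr_ge0 // ltW.
have N20 : 0 <= N2.
  by rewrite addr_ge0 ?divr_ge0 ?addr_ge0 ?mulr_ge0 ?addr_ge0 ?mulr_ge0 ?addr_ge0 ?mulr_ge0// ltW.
have N30 : 0 <= K * (1 + B) by rewrite mulr_ge0 ?addr_ge0// ltW.
exists (1 + K * (1 + B) + N1 + N2) => [|z m m0]; first by do 3 apply: addr_ge0 => //.
have /andP[e0 e1] := em m0; have /andP[eb0 eb1] := ebm adm m0.
have d0 : `|expR (- 1 * m) - expR (- b * m)| <= 1 by rewrite ler_norml; lra.
have c0 := cauchy_gt0 z; have c1 := cauchy_le1 z.
have g0 := gauss_gt0 z; have g1 := gauss_le1 z.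
have nB : `|B * expR (- b * m)| <= B by rewrite ger0_norm ?ler_piMr// ?mulr_ge0// ltW.
split.
- apply/andP; split.
    apply: le_trans (barrier_ge z adm m0).
    by rewrite addr_ge0 ?Phi_ge0// !mulr_ge0// ?ltW// exprn_gt0.
  apply: le_trans (barrier_le z adm m0) _.
  have : K * (1 + B) * expR (- m) <= K * (1 + B) by rewrite ler_piMr// -mulN1r.
  by have := Phi_le1 z; lra.
- apply: (@le_trans _ _ N1); last by lra.
  rewrite /barrier1 /N1 (le_trans (ler_normD _ _))// lerD//.
    by rewrite normrM !gtr0_norm// ler_piMr// ltW.
  rewrite normrM gtr0_norm// ler_wpM2l ?(ltW K_gt0)// (le_trans (ler_normD _ _))// lerD//.
    rewrite normrM -[M1]mul1r ler_pM// (le_trans _ (H1 z))//.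
    by rewrite !normrM normrN expr1.
  rewrite normrM ler_pM// (le_trans _ (ler_wpM2l _ (H3 z)))//.
  by rewrite -mulrA normrM normrN normr_nat expr1.
- apply: (@le_trans _ _ N2); last by lra.
  rewrite /barrier2 /N2 (le_trans (ler_normD _ _))// lerD//; last first.
    rewrite ger0_norm; last by rewrite !mulr_ge0 ?exprn_ge0 ?expR_ge0// ltW.
    rewrite -mulrA ler_piMr//; first by lra.
    by rewrite mulr_ile1 ?exprn_ge0 ?exprn_ile1// ltW.
  rewrite normrM [`|2^-1|]gtr0_norm// ler_wpM2r// (le_trans (ler_normD _ _))// lerD//.
    rewrite normrM (gtr0_norm k0) ler_wpM2l ?(ltW k0)// (le_trans _ (H1 z))//.
    by rewrite !normrM normrN expr1.
  rewrite normrM gtr0_norm// ler_wpM2l ?(ltW K_gt0)// (le_trans (ler_normD _ _))// lerD//.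
    rewrite normrM -[_ + 1]mul1r ler_pM// mulrBl mul1r (le_trans (ler_normB _ _))// lerD//.
    by rewrite gtr0_norm.
  rewrite normrM ler_pM// (le_trans (ler_normD _ _))// lerD//.
    by rewrite normrM normrN normr_nat ger0_norm ?exprn_ge0// ?ler_piMr// ?exprn_ile1// ltW.
  by rewrite normrM normr_nat ler_wpM2l.
Qed.

(** For large steps the left-hand side is bounded, and the moments of order 2p are
    at least 1. *)
Lemma barrier_step : admissible -> exists2 C, 0 <= C & forall z q x m, 0 <= x -> 0 <= m ->
  let l := ln (1 + x) / 2 in
  barrier (z - q) m - barrier (z * expR (- l)) (m + l) <=
  - q * barrier1 z m + (q ^+ 2 - x) * barrier2 z m +
  C * expR (2 * p * m) * (`|q| `^ (2 * p) + x `^ p).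
Proof.
move=> adm; have [p2_gt0 al_gt0 al_lt B_gt0] := admissible_pos adm.
have [p_gt1 K_gt0 alE BE] := adm.
have [C C0 HC] := barrier_small_step adm.
have [M M0 HM] := barrier_bounds adm.
exists (C + 7 * M) => [|z q x m x0 m0 /=]; first by rewrite addr_ge0// mulr_ge0.
set l := ln (1 + x) / 2.
set S := `|q| `^ (2 * p) + x `^ p.
have S0 : 0 <= S by rewrite addr_ge0 ?powR_ge0.
have e1 : 1 <= expR (2 * p * m) by rewrite -[leLHS]expR0 ler_expR mulr_ge0// ltW.
have e0 := le_trans ler01 e1.
have [/andP[q1 x1]|] := boolP ((`|q| <= 1) && (x <= 1)).
  have := HC z q x m q1; rewrite x0 x1 => /(_ isT m0) /le_trans; apply.
  by rewrite lerD2l -/S ler_wpM2r// ler_wpM2r// lerDl mulr_ge0.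
move=> qx.
have l0 : 0 <= l by rewrite divr_ge0// ln_ge0// lerDl.
have [/andP[b0 bM] b1M b2M] := HM z m m0.
have [/andP[b0' bM'] _ _] := HM (z - q) m m0.
have [/andP[b0'' bM''] _ _] := HM (z * expR (- l)) (m + l) (addr_ge0 m0 l0).
have S1 : 1 <= S.
  move: qx; rewrite negb_and -!ltNge => /orP[q1|x1].
    have : 1 <= `|q| `^ (2 * p).
      by rewrite -[leLHS](powRr0 `|q|) ler_powR ?ltW.
    by rewrite /S; have := powR_ge0 x p; lra.
  have : 1 <= x `^ p by rewrite -[leLHS](powRr0 x) ler_powR ?ltW// (lt_trans _ p_gt1).
  by rewrite /S; have := powR_ge0 `|q| (2 * p); lra.
have p21 : 1 <= 2 * p by lra.
have q1 : `|q| <= 2 * S.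
  have := powR_ge_min (normr_ge0 q) p21; have := powR_ge0 x p; rewrite /S in S1 *; lra.
have q2 : q ^+ 2 <= 2 * S.
  have := powR_ge_min (sqr_ge0 q) (ltW p_gt1); rewrite powR_sqr.
  have := powR_ge0 x p; rewrite /S in S1 *; lra.
have x2 : x <= 2 * S.
  have := powR_ge_min x0 (ltW p_gt1); have := powR_ge0 `|q| (2 * p); rewrite /S in S1 *; lra.
have h1 : - (2 * S * M) <= - q * barrier1 z m.
  rewrite lerNl -mulNr opprK (le_trans (ler_norm _))// normrM ler_pM//.
have h2 : - (4 * S * M) <= (q ^+ 2 - x) * barrier2 z m.
  rewrite lerNl -mulNr (le_trans (ler_norm _))// normrM ler_pM// normrN.
  by rewrite (le_trans (ler_normB _ _))// (ger0_norm x0) ger0_norm ?sqr_ge0//; lra.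
have h3 : M <= M * S by rewrite ler_peMr.
have h4 : 7 * M * S <= (C + 7 * M) * expR (2 * p * m) * S.
  rewrite ler_wpM2r// (@le_trans _ _ ((C + 7 * M) * 1))//; first by lra.
  by rewrite ler_wpM2l// addr_ge0// mulr_ge0.
lra.
Qed.

End barrier.

(** * Supersolutions of the heat equation *)

(** Joint measurability, tested along pairs of measurable functions on arbitrary
    spaces; this includes functions measurable for a sub-sigma-algebra. *)
Definition measurable2 {R : realType} (f : R -> R -> R) : Prop :=
  forall (d : measure_display) (T : measurableType d) (S W : T -> R),
    measurable_fun [set: T] S -> measurable_fun [set: T] W ->
    measurable_fun [set: T] (fun t => f (S t) (W t)).

(** A function U of the position s and the clock v, whose expectation increases
    along the martingale at most by moments of order 2p ([ss_step], where the
    first two terms on the right have mean zero), that starts below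
    Phi(x) + O(eps) and ends above the indicator of s <= x. *)
Record supersolution {R : realType} (p C eps x : R) (U A D : R -> R -> R) : Prop :=
  Supersolution {
  ss_bounded : exists M, forall s v, [/\ `|U s v| <= M, `|A s v| <= M & `|D s v| <= M] ;
  ss_measurable : [/\ measurable2 U, measurable2 A & measurable2 D] ;
  ss_step : forall s v X V, 0 <= V -> v + V <= 1 + eps ^+ 2 ->
    U (s + X) (v + V) - U s v <=
      X * A s (v + V) + (X ^+ 2 - V) * D s (v + V) +
      C * ((`|X| / eps) `^ (2 * p) + (V / eps ^+ 2) `^ p) ;
  ss_start : U 0 0 <= Phi x + C * eps ;
  ss_ge0 : forall s v, 0 <= U s v ;
  ss_end : forall s v, s <= x -> `|v - 1| <= eps ^+ 2 -> 1 <= U s v }.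

Section measurability.
Context {R : realType} d (T : measurableType d).
Implicit Types (f : R -> R) (Y Z : T -> R).

Lemma measurable_cont f Y : continuous f -> measurable_fun [set: T] Y ->
  measurable_fun [set: T] (fun t => f (Y t)).
Proof. by move=> cf mY; exact: measurableT_comp (continuous_measurable_fun cf) mY. Qed.

Lemma continuous_gauss : continuous (@gauss R).
Proof. exact: drv_cont (@gauss_derive R). Qed.

Lemma continuous_cauchy : continuous (@cauchy R).
Proof. exact: drv_cont (@cauchy_derive R). Qed.

Lemma continuous_Phi : continuous (@Phi R).
Proof. exact: drv_cont (@Phi_derive R). Qed.

Lemma measurable_gauss Y : measurable_fun [set: T] Y ->
  measurable_fun [set: T] (fun t => gauss (Y t)).
Proof. exact: measurable_cont continuous_gauss. Qed.

Lemma measurable_cauchy Y : measurable_fun [set: T] Y ->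
  measurable_fun [set: T] (fun t => cauchy (Y t)).
Proof. exact: measurable_cont continuous_cauchy. Qed.

Lemma measurable_Phi Y : measurable_fun [set: T] Y -> measurable_fun [set: T] (fun t => Phi (Y t)).
Proof. exact: measurable_cont continuous_Phi. Qed.

Lemma measurable_exp Y : measurable_fun [set: T] Y -> measurable_fun [set: T] (fun t => expR (Y t)).
Proof. exact: measurableT_comp (@measurable_expR R). Qed.

Lemma measurable_log Y : measurable_fun [set: T] Y -> measurable_fun [set: T] (fun t => ln (Y t)).
Proof. exact: measurableT_comp (@measurable_ln R). Qed.

Lemma measurable_root Y : measurable_fun [set: T] Y ->
  measurable_fun [set: T] (fun t => Num.sqrt (Y t)).
Proof. exact: measurable_cont (@sqrt_continuous R). Qed.

Lemma measurable_barrier K al B Y Z : measurable_fun [set: T] Y -> measurable_fun [set: T] Z ->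
  [/\ measurable_fun [set: T] (fun t => barrier K al B (Y t) (Z t)),
      measurable_fun [set: T] (fun t => barrier1 K al B (Y t) (Z t)) &
      measurable_fun [set: T] (fun t => barrier2 K al B (Y t) (Z t))].
Proof.
move=> mY mZ.
have mG := measurable_gauss mY; have mC := measurable_cauchy mY; have mP := measurable_Phi mY.
have me b : measurable_fun [set: T] (fun t => expR (b * Z t)).
  by apply: measurable_exp; apply: measurable_funM.
have cst c : measurable_fun [set: T] (fun _ : T => c : R) by exact: measurable_cst.
have mD := measurable_funB (me (-1)) (me (- (1 + al))).
have mB := measurable_funM (cst B) (me (- (1 + al))).
have mYG := measurable_funM (measurable_funN mY) mG.
have mY2 := measurable_funX 2 mY.
have mC3 := measurable_funX 3 mC.
split.
- exact: measurable_funD mP (measurable_funM (cst K)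
    (measurable_funD (measurable_funM mD mG) (measurable_funM mB (measurable_funX 2 mC)))).
- exact: measurable_funD (measurable_funM (cst kappa) mG) (measurable_funM (cst K)
    (measurable_funD (measurable_funM mD mYG)
      (measurable_funM mB (measurable_funM (measurable_funM (cst (- 4)) mY) mC3)))).
- exact: measurable_funD (measurable_funM (measurable_funD (measurable_funM (cst kappa) mYG)
    (measurable_funM (cst K) (measurable_funD
      (measurable_funM mD (measurable_funM (measurable_funB mY2 (cst 1)) mG))
      (measurable_funM mB (measurable_funD (measurable_funM (cst (- 4)) mC3)
        (measurable_funM (cst 24) (measurable_funM mY2 (measurable_funX 4 mC))))))))
    (cst 2^-1)) (measurable_funM (measurable_funM (cst (K * B / 8)) (me (- (1 + al)))) (measurable_funX 2 mC)).
Qed.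

End measurability.

(** This is [barrier] in the variables (s, v). Taking the maximum with eps^2 under the
    root keeps r >= eps when v is beyond the range of the clock. *)
Lemma supersolution_exists {R : realType} (p : R) : 1 < p -> exists2 C, 0 <= C &
  forall eps x, 0 < eps <= 1 -> exists U A D : R -> R -> R, supersolution p C eps x U A D.
Proof.
move=> p1.
have [Ct Ct0 HCt] := @normal_tail R.
have [Cs Cs0 HCs] := @Phi_scale R.
pose al := (2 * p)^-1.
have p2 : 0 < 2 * p by lra.
have al0 : 0 < al by rewrite invr_gt0.
pose B := al * expR (- (11 / 2)) / 7.
have B0 : 0 < B by rewrite divr_gt0 ?mulr_gt0 ?expR_gt0.
(* At the end of the clock r <= 2 eps, so that rho^(-1-al) is at least 1/4 and
   K B rho^(-1-al) h dominates the Gaussian tail. *)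
pose K := 4 * Ct / B.
have K0 : 0 < K by rewrite divr_gt0 ?mulr_gt0.
have adm : [/\ 1 < p, 0 < K, al = (2 * p)^-1 & 7 * B = al * expR (- (11 / 2))].
  by split => //; rewrite /B; field.
have [_ _ al2 _] := admissible_pos adm.
have [C C0 HC] := barrier_step adm.
have [M M0 HM] := barrier_bounds adm.
exists (C + 2 * Cs + K * (1 + B)) => [|eps x /andP[e0 e1]].
  by have : 0 < K * (1 + B); [rewrite mulr_gt0// addr_gt0|lra].
have e20 : 0 < eps ^+ 2 by rewrite exprn_gt0.
pose r w := Num.sqrt (Num.max (eps ^+ 2) (1 + 2 * eps ^+ 2 - w)).
have re w : eps <= r w.
  rewrite -[leLHS](ger0_norm (ltW e0)) -sqrtr_sqr.
  by rewrite ler_wsqrtr// le_max lexx.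
have r0 w : 0 < r w := lt_le_trans e0 (re w).
pose m w := ln (r w / eps).
have m0 w : 0 <= m w by rewrite ln_ge0// ler_pdivlMr// mul1r.
pose z s w := (x - s) / r w.
exists (fun s w => barrier K al B (z s w) (m w)),
  (fun s w => - barrier1 K al B (z s w) (m w) / r w),
  (fun s w => barrier2 K al B (z s w) (m w) / r w ^+ 2).
have mz d (T : measurableType d) (S W : T -> R) : measurable_fun [set: T] S ->
    measurable_fun [set: T] W -> [/\ measurable_fun [set: T] (fun t => z (S t) (W t)),
      measurable_fun [set: T] (fun t => m (W t)) & measurable_fun [set: T] (fun t => (r (W t))^-1)].
  move=> mS mW.
  have mr : measurable_fun [set: T] (fun t => r (W t)).
    apply: measurable_root; apply: measurable_maxr; first exact: measurable_cst.
    by apply: measurable_funB => //; exact: measurable_cst.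
  have mri : measurable_fun [set: T] (fun t => (r (W t))^-1).
    rewrite (_ : (fun t => _) = fun t => expR (- ln (r (W t)))).
      by apply: measurable_exp; apply: measurable_funN; exact: measurable_log.
    by apply/funext => t; rewrite expRN lnK// posrE.
  split => //.
    by apply: measurable_funM => //; apply: measurable_funB => //; exact: measurable_cst.
  by apply: measurable_log; apply: measurable_funM => //; exact: measurable_cst.
split.
- exists (M + M / eps + M / eps ^+ 2) => s v.
  have [/andP[h0 h1] h2 h3] := HM (z s v) (m v) (m0 v).
  have Me : 0 <= M / eps by rewrite divr_ge0// ltW.
  have Me2 : 0 <= M / eps ^+ 2 by rewrite divr_ge0// ltW.
  have re2 : eps ^+ 2 <= r v ^+ 2 by apply: ler_exprn2r; [exact: ltW|].
  split.
  + by rewrite ger0_norm//; lra.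
  + rewrite normrM normrN (@le_trans _ _ (M / eps))//; last by lra.
    by rewrite ler_pM// gtr0_norm ?invr_gt0// lef_pV2 ?posrE.
  + rewrite normrM (@le_trans _ _ (M / eps ^+ 2))//; last by lra.
    by rewrite ler_pM// gtr0_norm ?invr_gt0 ?exprn_gt0// lef_pV2 ?posrE ?exprn_gt0.
- split => d T S W mS mW; have [mZ mm mr] := mz d T S W mS mW;
    have [b0 b1 b2] := measurable_barrier K al B mZ mm => //.
  + by apply: measurable_funM => //; exact: measurable_funN.
  + apply: measurable_funM => //.
    rewrite (_ : (fun t => _) = fun t => (r (W t))^-1 ^+ 2); first exact: measurable_funX.
    by apply/funext => t; rewrite exprVn.
- move=> s v X V V0 vV.
  move wE : (v + V) => w; rewrite wE in vV.
  have rw2 : r w ^+ 2 = 1 + 2 * eps ^+ 2 - w.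
    rewrite sqr_sqrtr; first by rewrite max_r; lra.
    by rewrite le_max ltW.
  have rv2 : r v ^+ 2 = r w ^+ 2 + V.
    rewrite rw2 sqr_sqrtr; first by rewrite max_r; lra.
    by rewrite le_max ltW.
  pose y := V / r w ^+ 2.
  have y0 : 0 <= y by rewrite divr_ge0// exprn_ge0// ltW.
  pose l := ln (1 + y) / 2.
  have lE : r v = r w * expR l.
    apply/eqP; rewrite -(eqrXn2 (n := 2))// ?ltW ?mulr_gt0 ?expR_gt0//.
    rewrite exprMn -expRM_natl rv2 (_ : 2%:R * l = ln (1 + y)); last by rewrite /l; field.
    rewrite lnK; last by rewrite posrE; lra.
    by rewrite /y mulrDr mulr1 mulrCA divff ?mulr1// gt_eqF// exprn_gt0.
  have zv : z s v = z s w * expR (- l).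
    by rewrite /z lE expRN invfM mulrA.
  have mv : m v = m w + l.
    by rewrite /m lE mulrAC lnM ?posrE ?expR_gt0 ?divr_gt0// expRK.
  have zX : z (s + X) w = z s w - X / r w by rewrite /z; field; rewrite gt_eqF.
  rewrite zX zv mv (le_trans (HC (z s w) (X / r w) y (m w) y0 (m0 w)))//.
  have em : expR (2 * p * m w) = (r w / eps) `^ (2 * p) by rewrite powR_exp ?divr_gt0.
  have rE : 0 <= r w / eps by rewrite divr_ge0 ?ltW.
  have e1' : expR (2 * p * m w) * `|X / r w| `^ (2 * p) = (`|X| / eps) `^ (2 * p).
    rewrite em -(powRM _ rE (normr_ge0 _)); congr (powR _ _).
    by rewrite normrM [`|_^-1|]gtr0_norm ?invr_gt0//; field; rewrite !gt_eqF.
  have e2' : expR (2 * p * m w) * y `^ p = (V / eps ^+ 2) `^ p.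
    rewrite em -(ger0_norm rE) -powR_sqr -(powRM _ (exprn_ge0 _ rE) y0); congr (powR _ _).
    by rewrite /y; field; rewrite !gt_eqF.
  rewrite (_ : C * expR (2 * p * m w) * _ = C * (expR (2 * p * m w) * `|X / r w| `^ (2 * p) +
    expR (2 * p * m w) * y `^ p)); last by ring.
  rewrite e1' e2'; apply: lerD.
    rewrite le_eqVlt; apply/orP; left; apply/eqP.
    by rewrite /y; field; rewrite gt_eqF.
  rewrite ler_wpM2r ?addr_ge0 ?powR_ge0// -addrA lerDl addr_ge0// mulr_ge0// ?addr_ge0// ltW//.
- have re0 : r 0 ^+ 2 = 1 + 2 * eps ^+ 2.
    rewrite sqr_sqrtr; first by rewrite max_r; lra.
    by rewrite le_max ltW.
  have rge1 : 1 <= r 0.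
    by rewrite -(ler_pXn2r (ltn0Sn 1)) ?nnegrE ?ltW// re0 expr1n; lra.
  have e2e : eps ^+ 2 <= eps by rewrite expr2 ler_piMr// ltW.
  have rle : r 0 <= 1 + 2 * eps ^+ 2 by rewrite -re0 expr2 ler_peMr// ltW.
  rewrite (le_trans (barrier_le _ adm (m0 0)))//.
  have rv : 0 < (r 0)^-1 by rewrite invr_gt0.
  have rE : (r 0)^-1 * r 0 = 1 by rewrite mulVf// gt_eqF.
  have rm : expR (- m 0) <= eps.
    by rewrite expRN lnK ?posrE ?divr_gt0// invf_div ler_piMr ?(ltW e0)// invf_le1.
  have h1 : 1 / 2 <= (r 0)^-1 by nra.
  have h2 : `|(r 0)^-1 - 1| <= 2 * eps.
    by rewrite ler_norml; apply/andP; split; nra.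
  have := HCs x (r 0)^-1 h1; rewrite ler_norml => /andP[_ h3].
  have h4 : Cs * `|(r 0)^-1 - 1| <= Cs * (2 * eps) by rewrite ler_wpM2l.
  have h5 : K * (1 + B) * expR (- m 0) <= K * (1 + B) * eps.
    have KB0 : 0 <= K * (1 + B) by apply: mulr_ge0; lra.
    exact: (ler_wpM2l KB0 rm).
  have h6 : 0 <= C * eps by rewrite mulr_ge0// ltW.
  rewrite /z subr0; lra.
- by move=> s v; have [/andP[h0 h1] _ _] := HM (z s v) (m v) (m0 v).
- move=> s v sx; rewrite ler_norml => /andP[v1 v2].
  have rv2 : r v ^+ 2 = 1 + 2 * eps ^+ 2 - v.
    rewrite sqr_sqrtr; first by rewrite max_r; lra.
    by rewrite le_max ltW.
  have z0 : 0 <= z s v by rewrite divr_ge0 ?subr_ge0// ltW.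
  apply: le_trans (barrier_ge _ adm (m0 v)).
  have eb : 1 / 4 <= expR (- (1 + al) * m v).
    have e4 : expR (- 2 * m v) <= expR (- (1 + al) * m v).
      rewrite ler_expR ler_wpM2r//; lra.
    apply: le_trans e4.
    rewrite mulNr expRN expRM_natl lnK ?posrE ?divr_gt0// expr_div_n invf_div.
    by rewrite ler_pdivlMr ?exprn_gt0// rv2; lra.
  have c2 : 0 < cauchy (z s v) ^+ 2 by rewrite exprn_gt0// cauchy_gt0.
  have := HCt _ z0.
  have : Ct * cauchy (z s v) ^+ 2 <= K * (B * expR (- (1 + al) * m v) * cauchy (z s v) ^+ 2).
    have KB : K * B = 4 * Ct by rewrite /K; field; rewrite gt_eqF.
    rewrite (_ : K * _ = K * B * expR (- (1 + al) * m v) * cauchy (z s v) ^+ 2); last by ring.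
    by rewrite KB; apply: ler_wpM2r; [exact: ltW|nra].
  lra.
Qed.

(** * Expectations of real random variables *)
Section expectation_calculus.
Context d (T : measurableType d) (R : realType) (P : probability T R).
Implicit Types (f g h W : T -> R) (A : set T).

Definition L1 f : Prop := P.-integrable [set: T] (EFin \o f).
Definition Ex f : R := \int[P]_t f t.

Lemma L1_measurable f : L1 f -> measurable_fun [set: T] f.
Proof. by move=> /integrableP[/measurable_EFinP]. Qed.

Lemma L1_le f g : measurable_fun [set: T] f -> (forall t, `|f t| <= g t) -> L1 g -> L1 f.
Proof.
move=> mf fg ig; apply: le_integrable ig => //; first exact/measurable_EFinP.
by move=> t _; rewrite lee_fin (le_trans (fg t))// ler_norm.
Qed.

Lemma L1_cst c : L1 (fun _ => c).
Proof. exact: (finite_measure_integrable_cst P c measurableT). Qed.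

Lemma L1_bounded f M : measurable_fun [set: T] f -> (forall t, `|f t| <= M) -> L1 f.
Proof. by move=> mf fM; apply: L1_le (L1_cst M). Qed.

Lemma L1D f g : L1 f -> L1 g -> L1 (fun t => f t + g t).
Proof.
move=> fi gi; rewrite /L1.
rewrite (_ : EFin \o _ = (EFin \o f) \+ (EFin \o g)); first exact: integrableD.
by apply/funext => t.
Qed.

Lemma L1Z c f : L1 f -> L1 (fun t => c * f t).
Proof.
move=> fi; rewrite /L1.
rewrite (_ : EFin \o _ = (fun t => c%:E * (EFin \o f) t)%E); first exact: integrableZl.
by apply/funext => t.
Qed.

Lemma L1B f g : L1 f -> L1 g -> L1 (fun t => f t - g t).
Proof.
move=> fi gi; rewrite (_ : (fun t => _) = fun t => f t + (-1) * g t).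
  by apply: L1D => //; exact: L1Z.
by apply/funext => t; rewrite mulN1r.
Qed.

Lemma L1_norm f : L1 f -> L1 (fun t => `|f t|).
Proof. by move=> /integrable_norm. Qed.

Lemma L1_mulb W f M : measurable_fun [set: T] W -> (forall t, `|W t| <= M) -> L1 f ->
  L1 (fun t => W t * f t).
Proof.
move=> mW WM fi; apply: (@L1_le _ (fun t => M * `|f t|)).
- exact: measurable_funM mW (L1_measurable fi).
- by move=> t; rewrite normrM ler_wpM2r.
- exact: L1Z (L1_norm fi).
Qed.

Lemma L1_sum (I : Type) (s : seq I) (f : I -> T -> R) : (forall i, L1 (f i)) ->
  L1 (fun t => \sum_(i <- s) f i t).
Proof.
move=> fi; elim: s => [|i s IH].
  by rewrite (_ : (fun t => _) = fun=> 0); [exact: L1_cst|apply/funext => t; rewrite big_nil].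
rewrite (_ : (fun t => _) = fun t => f i t + \sum_(j <- s) f j t); first exact: L1D.
by apply/funext => t; rewrite big_cons.
Qed.

Lemma ExD f g : L1 f -> L1 g -> Ex (fun t => f t + g t) = Ex f + Ex g.
Proof. exact: RintegralD. Qed.

Lemma ExB f g : L1 f -> L1 g -> Ex (fun t => f t - g t) = Ex f - Ex g.
Proof. exact: RintegralB. Qed.

Lemma ExZ c f : L1 f -> Ex (fun t => c * f t) = c * Ex f.
Proof. exact: RintegralZl. Qed.

Lemma Ex_cst c : Ex (fun _ => c) = c.
Proof. by rewrite /Ex Rintegral_cst// [X in fine X](@probability_setT _ _ _ P) mulr1. Qed.

Lemma Ex_le f g : L1 f -> L1 g -> (forall t, f t <= g t) -> Ex f <= Ex g.
Proof. by move=> fi gi fg; apply: le_Rintegral. Qed.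

Lemma Ex_ge0 f : (forall t, 0 <= f t) -> 0 <= Ex f.
Proof. by move=> f0; apply: Rintegral_ge0. Qed.

Lemma Ex_norm f : L1 f -> `|Ex f| <= Ex (fun t => `|f t|).
Proof. by move=> fi; apply: le_normr_Rintegral. Qed.

Lemma Ex_sum (I : Type) (s : seq I) (f : I -> T -> R) : (forall i, L1 (f i)) ->
  Ex (fun t => \sum_(i <- s) f i t) = \sum_(i <- s) Ex (f i).
Proof.
move=> fi; elim: s => [|i s IH].
  by rewrite big_nil -[RHS](Ex_cst 0); congr Ex; apply/funext => t; rewrite big_nil.
rewrite big_cons -IH -ExD//; last exact: L1_sum.
by congr Ex; apply/funext => t; rewrite big_cons.
Qed.

Lemma ExE f : L1 f -> (\int[P]_t (f t)%:E)%E = (Ex f)%:E.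
Proof. by move=> fi; rewrite /Ex /Rintegral fineK//; apply: integrable_fin_num. Qed.

Lemma Ex_prob A f : measurable A -> L1 f -> (forall t, 0 <= f t) ->
  (forall t, A t -> 1 <= f t) -> (P A <= (Ex f)%:E)%E.
Proof.
move=> mA fi f0 f1; rewrite -ExE// -(setIT A) -integral_indic//.
apply: ge0_le_integral => //.
- exact/measurable_EFinP/measurable_indic.
- exact/measurable_EFinP/L1_measurable.
move=> t _; rewrite lee_fin indicE.
by have [tA|tA] := boolP (t \in A); [apply: f1; rewrite inE in tA|exact: f0].
Qed.

Lemma Ex_cvg (f_ : nat -> T -> R) f g : (forall n, measurable_fun [set: T] (f_ n)) ->
  measurable_fun [set: T] f -> (forall t, f_ n t @[n --> \oo] --> f t) -> L1 g ->
  (forall n t, `|f_ n t| <= g t) -> Ex (f_ n) @[n --> \oo] --> Ex f.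
Proof.
move=> mf_ mf ff ig fg.
have [||||| fi _ cv] := @dominated_convergence _ _ _ P setT measurableT (fun n => EFin \o f_ n)
  (EFin \o f) (EFin \o g).
- move=> n; apply/measurable_EFinP; exact: mf_.
- exact/measurable_EFinP.
- by apply: aeW => t _; apply: cvg_EFin; [exact: nearW|exact: ff].
- by [].
- by apply: aeW => t n _; rewrite lee_fin.
move: cv; rewrite ExE// => /fine_cvgP[_]; exact.
Qed.

End expectation_calculus.

(** * Orthogonality to a sub-sigma-algebra *)
Section sub_sigma_algebra.
Context d (T : measurableType d) (R : realType) (P : probability T R).
Variable (G : set_system T).
Implicit Types (f g h W Y Z : T -> R) (A : set T).

Lemma measurable_wrtP Y : sigma_algebra [set: T] G ->
  measurable_wrt G Y <->
  measurable_fun [set: g_sigma_algebraType G] (Y : g_sigma_algebraType G -> R).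
Proof.
move=> sG; have mE := measurable_g_measurableTypeE sG.
split=> [mY _ B mB|mY B mB].
  by rewrite setTI mE; exact: mY.
have := mY measurableT B mB; rewrite setTI.
by rewrite mE.
Qed.

Lemma measurable_wrt_measurable Y : (forall A, G A -> measurable A) ->
  measurable_wrt G Y -> measurable_fun [set: T] Y.
Proof. by move=> GM mY _ B mB; rewrite setTI; apply: GM; exact: mY. Qed.

Lemma measurable2_wrt (U : R -> R -> R) Y Z : sigma_algebra [set: T] G -> measurable2 U ->
  measurable_wrt G Y -> measurable_wrt G Z -> measurable_wrt G (fun t => U (Y t) (Z t)).
Proof.
move=> sG mU /(measurable_wrtP _ sG) mY /(measurable_wrtP _ sG) mZ.
by apply/(measurable_wrtP _ sG); exact: mU.
Qed.

(** The conditional expectation of h given G vanishes. *)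
Definition centered h : Prop := L1 P h /\ forall A, G A -> \int[P]_(t in A) h t = 0.

Lemma centered_indic h A : centered h -> G A -> Ex P (fun t => \1_A t * h t) = 0.
Proof.
move=> [_ h0] /h0 <-; rewrite Rintegral_mkcond; congr (Rintegral _ _ _).
apply/funext => t; rewrite patchE indicE.
by case: ifP => _; rewrite ?mul1r ?mul0r.
Qed.

Lemma sum_indic_lt (n k : nat) : \sum_(0 <= j < k) ((j < n)%N%:R : R) = (minn n k)%:R.
Proof.
elim: k => [|k IH]; first by rewrite big_geq// minn0.
by rewrite big_nat_recr//= IH -natrD; congr (_%:R); case: ltnP; lia.
Qed.

(** W is uniformly approximated by its integer part in units of 1/n, which is a
    finite sum of indicators of events in G. *)
Lemma centered_mulb h W M : sigma_algebra [set: T] G -> (forall A, G A -> measurable A) ->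
  centered h -> measurable_wrt G W -> (forall t, `|W t| <= M) ->
  Ex P (fun t => W t * h t) = 0.
Proof.
move=> sG GM ch mW WM; have [hi h0] := ch.
wlog W0 : W M mW WM / forall t, 0 <= W t.
  move=> wlg.
  have mW' := measurable_wrt_measurable GM mW.
  have mWM : measurable_wrt G (fun t => W t + M).
    apply/(measurable_wrtP _ sG); apply: measurable_funD; last exact: measurable_cst.
    exact/(measurable_wrtP _ sG).
  have := wlg (fun t => W t + M) (M + M) mWM.
  have Wn t : `|W t + M| <= M + M.
    by rewrite (le_trans (ler_normD _ _))// lerD// ger0_norm// (le_trans _ (WM t)).
  have Wp t : 0 <= W t + M.
    by have := WM t; rewrite ler_norml => /andP[]; lra.
  move=> /(_ Wn Wp).
  have -> : (fun t => (W t + M) * h t) = fun t => W t * h t + M * h t.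
    by apply/funext => t; rewrite mulrDl.
  rewrite ExD ?ExZ//; last 2 first.
  - exact: L1_mulb mW' WM hi.
  - exact: L1Z.
  have -> : Ex P h = 0.
    have [sG0 sGD _] := sG.
    have GT : G setT by rewrite -(setD0 setT); exact: sGD.
    exact: h0 _ GT.
  by rewrite mulr0 addr0.
have mW' := measurable_wrt_measurable GM mW.
have Wi := L1_mulb mW' WM hi.
pose K := Ex P (fun t => `|h t|).
have K0 : 0 <= K by exact: Ex_ge0.
suff H N : `|Ex P (fun t => W t * h t)| <= K / N.+1%:R.
  apply/eqP; rewrite -normr_le0; apply/ler_addgt0Pr => e e0; rewrite add0r.
  pose N := Num.trunc (K / e).
  apply: le_trans (H N) _.
  rewrite ler_pdivrMr ?ltr0n// mulrC -ler_pdivrMr//.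
  have Ke : 0 <= K / e by rewrite divr_ge0// ltW.
  by have /andP[_ /ltW] := truncn_itv Ke.
pose n : R := N.+1%:R.
have n0 : 0 < n by rewrite ltr0n.
pose k := (Num.trunc (n * M)).+1.
pose A j := [set t | j.+1%:R <= n * W t].
have GA j : G (A j).
  rewrite (_ : A j = W @^-1` `[j.+1%:R / n, +oo[%classic).
    by apply: mW; exact: measurable_itv.
  by apply/seteqP; split => t /=; rewrite in_itv/= andbT ler_pdivrMr// mulrC.
pose WN t := n^-1 * \sum_(0 <= j < k) \1_(A j) t.
have WNE t : WN t = n^-1 * (Num.trunc (n * W t))%:R.
  have nW0 : 0 <= n * W t by rewrite mulr_ge0 ?(ltW n0).
  congr (_ * _).
  have kn : (Num.trunc (n * W t) <= k)%N.
    by rewrite leqW// le_truncn// ler_wpM2l ?(ltW n0)// (le_trans (ler_norm _)).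
  rewrite -[in RHS](minn_idPl kn) -sum_indic_lt.
  apply: eq_bigr => j _; rewrite indicE; congr (_%:R).
  by rewrite truncn_gt_nat; congr nat_of_bool; apply/idP/idP; rewrite inE.
have WW t : `|W t - WN t| <= n^-1.
  have nW0 : 0 <= n * W t by rewrite mulr_ge0 ?(ltW n0).
  have /andP[t1 t2] := truncn_itv nW0.
  have -> : W t - WN t = n^-1 * (n * W t - (Num.trunc (n * W t))%:R).
    by rewrite WNE; field; rewrite gt_eqF.
  rewrite normrM gtr0_norm ?invr_gt0// ler_piMr ?invr_ge0 ?(ltW n0)//.
  by rewrite -natr1 in t2; rewrite ler_norml; apply/andP; split; lra.
have mA j : measurable (A j) by apply: GM; exact: GA.
have Ai j : L1 P (fun t => \1_(A j) t * h t).
  apply: (@L1_mulb _ _ _ P (\1_(A j)) h 1) => //.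
  by move=> t; rewrite indicE; case: (_ \in _); rewrite /= ?normr1 ?normr0.
have WNi : L1 P (fun t => WN t * h t).
  rewrite (_ : (fun t => _) = fun t => n^-1 * \sum_(0 <= j < k) \1_(A j) t * h t).
    by apply: L1Z; exact: L1_sum.
  by apply/funext => t; rewrite /WN -mulrA mulr_suml.
have WN0 : Ex P (fun t => WN t * h t) = 0.
  rewrite (_ : (fun t => _) = fun t => n^-1 * \sum_(0 <= j < k) \1_(A j) t * h t).
    rewrite ExZ; last exact: L1_sum.
    rewrite Ex_sum// big1 ?mulr0// => j _; exact: centered_indic.
  by apply/funext => t; rewrite /WN -mulrA mulr_suml.
have -> : Ex P (fun t => W t * h t) = Ex P (fun t => (W t - WN t) * h t).
  under [in RHS]eq_fun do rewrite mulrBl.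
  by rewrite ExB// WN0 subr0.
have Di : L1 P (fun t => (W t - WN t) * h t).
  by under eq_fun do rewrite mulrBl; exact: L1B.
apply: le_trans (Ex_norm Di) _.
rewrite mulrC -ExZ; last exact: L1_norm.
apply: Ex_le; [exact: L1_norm|by apply: L1Z; exact: L1_norm|move=> t].
by rewrite normrM ler_wpM2r.
Qed.

(** Truncate W and use dominated convergence. *)
Lemma centered_mul h W : sigma_algebra [set: T] G -> (forall A, G A -> measurable A) ->
  centered h -> measurable_wrt G W -> L1 P (fun t => W t * h t) ->
  Ex P (fun t => W t * h t) = 0.
Proof.
move=> sG GM ch mW Whi; have [hi _] := ch.
pose W_ (n : nat) t := if `|W t| <= n%:R then W t else 0.
have mW_ n : measurable_wrt G (W_ n).
  apply/(measurable_wrtP _ sG).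
  have mW' := (measurable_wrtP _ sG).1 mW.
  apply: measurable_fun_ifT => //.
  apply: measurable_fun_ler; last exact: measurable_cst.
  exact: measurableT_comp mW'.
have W_b n t : `|W_ n t| <= n%:R.
  by rewrite /W_; case: ifP => // _; rewrite normr0.
have E0 n : Ex P (fun t => W_ n t * h t) = 0 by exact: centered_mulb (mW_ n) (W_b n).
have mWT n := measurable_wrt_measurable GM (mW_ n).
have : Ex P (fun t => W_ n t * h t) @[n --> \oo] --> Ex P (fun t => W t * h t).
  apply: (@Ex_cvg _ _ _ _ _ _ (fun t => `|W t * h t|)).
  - by move=> n; apply: measurable_funM => //; exact: L1_measurable hi.
  - exact: L1_measurable Whi.
  - move=> t; apply: cvgM; last exact: cvg_cst.
    apply: cvg_near_cst; near=> n; rewrite /W_ ifT//; near: n; exact: nbhs_infty_ger.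
  - exact: L1_norm.
  - move=> n t; rewrite !normrM ler_wpM2r// /W_; case: ifP => // _.
    by rewrite normr0.
rewrite (_ : (fun n => _) = fun=> 0); last by apply/funext => n; rewrite E0.
by move=> /(cvg_unique _ (cvg_cst 0)) <-.
Unshelve. all: by end_near. Qed.

Lemma cond_exp_centered Y Z : sigma_algebra [set: T] G -> (forall A, G A -> measurable A) ->
  L1 P Z -> is_cond_exp P G Z Y -> centered (fun t => Z t - Y t).
Proof.
move=> sG GM Zi [mY Yi YE]; split; first exact: L1B.
move=> A GA; have mA := GM A GA.
have ZA : P.-integrable A (EFin \o Z) by exact: integrableS Zi.
have YA : P.-integrable A (EFin \o Y) by exact: integrableS Yi.
by rewrite RintegralB// /Rintegral YE// subrr.
Qed.

End sub_sigma_algebra.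

(** * The conditional Jensen inequality for powers *)
Section powR_calculus.
Context {R : realType}.
Implicit Types (p x y z : R).

Lemma ln_le_sub1 (x : R) : 0 < x -> ln x <= x - 1.
Proof.
move=> x0; rewrite -ler_expR lnK ?posrE//.
by have := expR_ge1Dx (x - 1); lra.
Qed.

Lemma powR_bernoulli p x : 1 <= p -> 0 <= x -> 1 + p * (x - 1) <= x `^ p.
Proof.
move=> p1; rewrite le_eqVlt => /orP[/eqP <-|x0].
  rewrite powR0; first by lra.
  by rewrite gt_eqF//; lra.
have l1 : 1 - x^-1 <= ln x.
  have xi : 0 < x^-1 by rewrite invr_gt0.
  by have := ln_le_sub1 xi; rewrite lnV ?posrE//; lra.
have pE : expR (p * ln x) = x * expR ((p - 1) * ln x).
  transitivity (expR (ln x) * expR ((p - 1) * ln x)); last by rewrite lnK ?posrE.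
  by rewrite -expRD; congr expR; ring.
rewrite powR_exp// pE.
have h : 1 + (p - 1) * (1 - x^-1) <= expR ((p - 1) * ln x).
  by apply: le_trans (expR_ge1Dx _); rewrite lerD2l ler_wpM2l//; lra.
apply: le_trans (ler_wpM2l (ltW x0) h).
rewrite le_eqVlt; apply/orP; left; apply/eqP; field.
by rewrite gt_eqF.
Qed.

Lemma powR_tangent p y z : 1 < p -> 0 <= y -> 0 <= z ->
  y `^ p + p * y `^ (p - 1) * (z - y) <= z `^ p.
Proof.
move=> p1; rewrite le_eqVlt => /orP[/eqP <-|y0] z0.
  rewrite !powR0 ?mulr0 ?mul0r ?addr0 ?powR_ge0// gt_eqF//; lra.
have := @powR_bernoulli p (z / y) (ltW p1); rewrite divr_ge0 ?(ltW y0)// => /(_ isT) H.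
have yp : 0 < y `^ p by rewrite powR_gt0.
have -> : z `^ p = y `^ p * (z / y) `^ p.
  rewrite -powRM ?(ltW y0) ?divr_ge0 ?(ltW y0)//.
  by congr (powR _ _); field; rewrite gt_eqF.
apply: le_trans (ler_wpM2l (ltW yp) H).
have yE : y `^ p = y * y `^ (p - 1).
  rewrite -[X in X * _](powRr1 (ltW y0)) -powRD; last by apply/implyP => _; rewrite gt_eqF.
  by congr (powR _ _); ring.
rewrite yE le_eqVlt; apply/orP; left; apply/eqP; field.
by rewrite gt_eqF.
Qed.

End powR_calculus.

Section conditional_jensen.
Context d (T : measurableType d) (R : realType) (P : probability T R).
Variable (G : set_system T).
Hypotheses (sG : sigma_algebra [set: T] G) (GM : forall A, G A -> measurable A).

Lemma L1_powR_measurable (Y : T -> R) (p : R) : measurable_fun [set: T] Y ->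
  measurable_fun [set: T] (fun t => Y t `^ p).
Proof. exact: measurableT_comp (@measurable_powR R p). Qed.

(** Integrate the tangent inequality at Y, multiplied by the indicator of
    Y <= n so that the slope is bounded, and let n tend to infinity. *)
Lemma conditional_jensen (p : R) (Y Z : T -> R) : 1 < p ->
  (forall t, 0 <= Y t) -> (forall t, 0 <= Z t) -> measurable_wrt G Y ->
  centered P G (fun t => Z t - Y t) -> L1 P (fun t => Z t `^ p) ->
  L1 P (fun t => Y t `^ p) /\ Ex P (fun t => Y t `^ p) <= Ex P (fun t => Z t `^ p).
Proof.
move=> p1 Y0 Z0 mY cZY Zp.
have mYT := measurable_wrt_measurable GM mY.
have ZY1 := cZY.1.
pose Y_ (n : nat) t := if Y t <= n%:R then Y t else 0.
have Y_0 n t : 0 <= Y_ n t by rewrite /Y_; case: ifP.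
have Y_n n t : Y_ n t <= n%:R by rewrite /Y_; case: ifP.
have mY_ n : measurable_wrt G (Y_ n).
  apply/(measurable_wrtP _ sG); have mY' := (measurable_wrtP _ sG).1 mY.
  apply: measurable_fun_ifT => //; apply: measurable_fun_ler => //.
have mY_T n := measurable_wrt_measurable GM (mY_ n).
have Yp n : Ex P (fun t => Y_ n t `^ p) <= Ex P (fun t => Z t `^ p).
  pose W t := p * Y_ n t `^ (p - 1).
  have W0 t : 0 <= W t by rewrite mulr_ge0 ?powR_ge0//; lra.
  have mW : measurable_wrt G W.
    apply/(measurable_wrtP _ sG); apply: measurable_funM; first exact: measurable_cst.
    apply: measurableT_comp (@measurable_powR R (p - 1)) _.
    exact/(measurable_wrtP _ sG).
  have Wb t : `|W t| <= p * n%:R `^ (p - 1).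
    rewrite ger0_norm// ler_wpM2l//; first by lra.
    by rewrite ge0_ler_powR ?nnegrE//; lra.
  have E0 := centered_mulb sG GM cZY mW Wb.
  have WZY : L1 P (fun t => W t * (Z t - Y t)).
    exact: L1_mulb (measurable_wrt_measurable GM mW) Wb ZY1.
  have Ypi : L1 P (fun t => Y_ n t `^ p).
    apply: (@L1_bounded _ _ _ _ _ (n%:R `^ p)) => [|t].
      exact: L1_powR_measurable.
    by rewrite ger0_norm ?powR_ge0// ge0_ler_powR ?nnegrE//; lra.
  rewrite -[leLHS]addr0 -E0 -ExD//; apply: Ex_le => //; first exact: L1D.
  move=> t; rewrite /W /Y_; case: ifP => _; first exact: powR_tangent.
  by rewrite !powR0 ?mulr0 ?mul0r ?addr0 ?powR_ge0// gt_eqF//; lra.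
have iZ := ExE Zp.
have Y_cvg t : limn (fun n => (Y_ n t `^ p)%:E) = (Y t `^ p)%:E.
  apply/cvg_lim => //; apply: cvg_EFin; first exact: nearW.
  apply: cvg_near_cst; near=> n; rewrite /= /Y_ ifT//; near: n; exact: nbhs_infty_ger.
have F : (\int[P]_t (Y t `^ p)%:E <= (Ex P (fun t => Z t `^ p))%:E)%E.
  under eq_integral do rewrite -Y_cvg.
  have := @cvg_monotone_convergence _ _ _ P setT measurableT (fun n t => (Y_ n t `^ p)%:E).
  have -> : (fun n => \int[P]_t (Y_ n t `^ p)%:E)%E = fun n => (Ex P (fun t => Y_ n t `^ p))%:E.
    apply/funext => n; have Ypi : L1 P (fun t => Y_ n t `^ p).
      apply: (@L1_bounded _ _ _ _ _ (n%:R `^ p)) => [|t]; first exact: L1_powR_measurable.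
      by rewrite ger0_norm ?powR_ge0// ge0_ler_powR ?nnegrE//; lra.
    by rewrite (ExE Ypi).
  move=> H; apply: (cvge_to_le (H _ _ _)).
  - by move=> n; apply/measurable_EFinP; exact: L1_powR_measurable.
  - by move=> n t _; rewrite lee_fin powR_ge0.
  - move=> t _ n k nk; rewrite lee_fin ge0_ler_powR ?nnegrE//; first by lra.
    rewrite /Y_; case: ifP => Yn; last by case: ifP.
    by rewrite ifT// (le_trans Yn)// ler_nat.
  - by apply: nearW => n; rewrite lee_fin.
have Y1 : L1 P (fun t => Y t `^ p).
  apply/integrableP; split; first exact/measurable_EFinP/L1_powR_measurable.
  under eq_integral do rewrite /= ger0_norm ?powR_ge0//.
  by rewrite (le_lt_trans F)// ltry.
by split; [exact: Y1|rewrite -lee_fin -(ExE Y1)].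
Unshelve. all: by end_near. Qed.

End conditional_jensen.

(** * One step along the clock *)
Section lindeberg.
Context d (T : measurableType d) (R : realType) (P : probability T R).
Variable (F : nat -> set_system T).
Implicit Types (X V : nat -> T -> R).

(** The pair (S_k, <S>_k), stopped just before the clock would exceed c. Whether it
    moves at a step is known before the step, since the clock is predictable. *)
Fixpoint frozen (c : R) X V (k : nat) (t : T) : R * R :=
  if k is k'.+1 then
    let sv := frozen c X V k' t in
    if sv.2 + V k t <= c then (sv.1 + X k t, sv.2 + V k t) else sv
  else (0, 0).

Lemma partial_sum0 X t : partial_sum X 0 t = 0.
Proof. by rewrite /partial_sum big_geq. Qed.

Lemma partial_sumS X n t : partial_sum X n.+1 t = partial_sum X n t + X n.+1 t.
Proof. by rewrite /partial_sum big_nat_recr. Qed.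

Lemma frozenE c X V n t : (forall i, 0 <= V i t) -> partial_sum V n t <= c ->
  frozen c X V n t = (partial_sum X n t, partial_sum V n t).
Proof.
move=> V0; elim: n => [|n IH] cn; first by rewrite /= !partial_sum0.
rewrite /= IH ?partial_sumS /= -?partial_sumS ?cn//.
by apply: le_trans cn; rewrite partial_sumS lerDl.
Qed.

Lemma measurable_wrt_incr n (Y : T -> R) : is_filtration F ->
  measurable_wrt (F n) Y -> measurable_wrt (F n.+1) Y.
Proof. by move=> hF mY B mB; apply: (filtration_incr hF); exact: mY. Qed.

Lemma frozen_measurable c X V k : is_filtration F ->
  (forall i, measurable_wrt (F i.+1) (X i.+1)) -> (forall i, measurable_wrt (F i) (V i.+1)) ->
  measurable_wrt (F k) (fun t => (frozen c X V k t).1) /\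
  measurable_wrt (F k) (fun t => (frozen c X V k t).2).
Proof.
move=> hF mX mV; elim: k => [|k [m1 m2]].
  by split; apply/(measurable_wrtP _ (filtration_sigma hF 0)); exact: measurable_cst.
have sG := filtration_sigma hF k.+1.
have m1' := (measurable_wrtP _ sG).1 (measurable_wrt_incr hF m1).
have m2' := (measurable_wrtP _ sG).1 (measurable_wrt_incr hF m2).
have mX' := (measurable_wrtP _ sG).1 (mX k).
have mV' := (measurable_wrtP _ sG).1 (measurable_wrt_incr hF (mV k)).
have mg : measurable_fun [set: g_sigma_algebraType (F k.+1)]
    (fun t => (frozen c X V k t).2 + V k.+1 t <= c).
  by apply: measurable_fun_ler => //; apply: measurable_funD.
split; apply/(measurable_wrtP _ sG).
  rewrite (_ : (fun t => _) = fun t => if (frozen c X V k t).2 + V k.+1 t <= c then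
    (frozen c X V k t).1 + X k.+1 t else (frozen c X V k t).1).
    by apply: measurable_fun_ifT => //; apply: measurable_funD.
  by apply/funext => t /=; case: ifP.
rewrite (_ : (fun t => _) = fun t => if (frozen c X V k t).2 + V k.+1 t <= c then
    (frozen c X V k t).2 + V k.+1 t else (frozen c X V k t).2).
  by apply: measurable_fun_ifT => //; apply: measurable_funD.
by apply/funext => t /=; case: ifP.
Qed.

(** The clock is assumed nonnegative everywhere; a general version of the
    conditional variances is so only almost surely. *)
Record tame (p : R) X V : Prop := Tame {
  tame_filtration : is_filtration F ;
  tame_mdiff : is_martingale_difference P F X ;
  tame_var : is_cond_variance P F X V ;
  tame_ge0 : forall i t, 0 <= V i t ;
  tame_moment : forall i, L1 P (fun t => `|X i.+1 t| `^ (2 * p)) }.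

Lemma tame_centered p X V i : tame p X V -> centered P (F i) (X i.+1).
Proof.
move=> [hF hX _ _ _].
have := cond_exp_centered (filtration_sigma hF i) (@filtration_measurable _ _ _ hF i)
  (mdiff_integrable hX i) (mdiff_cond_exp hX i).
by rewrite (_ : (fun t => _) = X i.+1)//; apply/funext => t; rewrite subr0.
Qed.

Lemma tame_measurable p X V i : tame p X V -> measurable_fun [set: T] (X i.+1).
Proof. by move=> h; exact: L1_measurable (tame_centered i h).1. Qed.

Lemma tame_L1_sqr p X V i : 1 < p -> tame p X V -> L1 P (fun t => X i.+1 t ^+ 2).
Proof.
move=> p1 h; have mX := tame_measurable i h.
apply: (@L1_le _ _ _ _ _ (fun t => 1 + `|X i.+1 t| `^ (2 * p))).
- exact: measurable_funX.
- move=> t; rewrite ger0_norm ?sqr_ge0// -powR_sqr.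
  exact: powR_ge_min (sqr_ge0 _) (ltW p1).
- apply: L1D; [exact: L1_cst|exact: tame_moment h i].
Qed.

Lemma tame_centered_var p X V i : 1 < p -> tame p X V ->
  centered P (F i) (fun t => X i.+1 t ^+ 2 - V i.+1 t).
Proof.
move=> p1 h; have hF := tame_filtration h.
exact: cond_exp_centered (filtration_sigma hF i) (@filtration_measurable _ _ _ hF i)
  (tame_L1_sqr i p1 h) (tame_var h i).
Qed.

Lemma tame_var_moment p X V i : 1 < p -> tame p X V -> L1 P (fun t => V i.+1 t `^ p) /\
  Ex P (fun t => V i.+1 t `^ p) <= Ex P (fun t => `|X i.+1 t| `^ (2 * p)).
Proof.
move=> p1 h; have hF := tame_filtration h.
have E : (fun t => `|X i.+1 t| `^ (2 * p)) = fun t => (X i.+1 t ^+ 2) `^ p.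
  by apply/funext => t; rewrite powR_sqr.
rewrite E; apply: (@conditional_jensen _ _ _ _ (F i)) => //.
- exact: filtration_sigma hF i.
- exact: filtration_measurable hF i.
- exact: tame_ge0 h i.+1.
- by move=> t; exact: sqr_ge0.
- exact: cond_exp_measurable (tame_var h i).
- exact: tame_centered_var p1 h.
- by rewrite -E; exact: tame_moment h i.
Qed.

(** The coefficients of the two centered terms in [ss_step] are bounded and known
    before the step, so these terms have expectation zero. *)
Lemma lindeberg_step (p C eps x : R) U A D X V k : 1 < p -> 0 <= C -> 0 < eps -> tame p X V ->
  supersolution p C eps x U A D ->
  Ex P (fun t => U (frozen (1 + eps ^+ 2) X V k.+1 t).1 (frozen (1 + eps ^+ 2) X V k.+1 t).2) <=
  Ex P (fun t => U (frozen (1 + eps ^+ 2) X V k t).1 (frozen (1 + eps ^+ 2) X V k t).2) +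
    2 * C * eps `^ (- (2 * p)) * Ex P (fun t => `|X k.+1 t| `^ (2 * p)).
Proof.
move=> p1 C0 e0 h ss; set c := 1 + eps ^+ 2.
pose E k := Ex P (fun t => U (frozen c X V k t).1 (frozen c X V k t).2).
rewrite -/(E k.+1) -/(E k).
have hF := tame_filtration h.
have sG := filtration_sigma hF k.
have GM := @filtration_measurable _ _ _ hF k.
have mX i := mdiff_adapted (tame_mdiff h) i.
have mV i := cond_exp_measurable (tame_var h i).
have [M HM] := ss_bounded ss.
have [mU mA mD] := ss_measurable ss.
have [m1 m2] := @frozen_measurable c X V k hF mX mV.
have [m1' m2'] := @frozen_measurable c X V k.+1 hF mX mV.
pose s t := (frozen c X V k t).1; pose v t := (frozen c X V k t).2.
pose w t := v t + V k.+1 t.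
have mw : measurable_wrt (F k) w.
  apply/(measurable_wrtP _ sG); apply: measurable_funD; exact/(measurable_wrtP _ sG).
pose gate (B : R -> R -> R) t := if w t <= c then B (s t) (w t) else 0.
have mgate B : measurable2 B -> measurable_wrt (F k) (gate B).
  move=> mB; apply/(measurable_wrtP _ sG).
  apply: measurable_fun_ifT => //.
    by apply: measurable_fun_ler => //; exact/(measurable_wrtP _ sG).
  by apply/(measurable_wrtP _ sG); exact: measurable2_wrt.
have gateA t : `|gate A t| <= M.
  rewrite /gate; case: ifP => _; first by have [] := HM (s t) (w t).
  by rewrite normr0; have [_ /(le_trans (normr_ge0 _)) ] := HM 0 0.
have gateD t : `|gate D t| <= M.
  rewrite /gate; case: ifP => _; first by have [] := HM (s t) (w t).
  by rewrite normr0; have [_ /(le_trans (normr_ge0 _)) ] := HM 0 0.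
have cX := tame_centered k h; have cV := tame_centered_var k p1 h.
have EA := centered_mulb sG GM cX (mgate A mA) gateA.
have ED := centered_mulb sG GM cV (mgate D mD) gateD.
have LA : L1 P (fun t => gate A t * X k.+1 t).
  exact: L1_mulb (measurable_wrt_measurable GM (mgate A mA)) gateA cX.1.
have LD : L1 P (fun t => gate D t * (X k.+1 t ^+ 2 - V k.+1 t)).
  exact: L1_mulb (measurable_wrt_measurable GM (mgate D mD)) gateD cV.1.
have LU (j : nat) : L1 P (fun t => U (frozen c X V j t).1 (frozen c X V j t).2).
  have [n1 n2] := @frozen_measurable c X V j hF mX mV.
  apply: (@L1_bounded _ _ _ _ _ M) => [|t]; last by have [] := HM (frozen c X V j t).1 (frozen c X V j t).2.
  apply: (measurable_wrt_measurable (@filtration_measurable _ _ _ hF j)).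
  exact: measurable2_wrt (filtration_sigma hF j) mU n1 n2.
have [LV VX] := tame_var_moment k p1 h.
have LX := tame_moment h k.
pose ep := eps `^ (- (2 * p)).
have ep0 : 0 <= ep by exact: powR_ge0.
have LXV : L1 P (fun t => C * ep * (`|X k.+1 t| `^ (2 * p) + V k.+1 t `^ p)).
  by apply: L1Z; exact: L1D.
have step t : U (frozen c X V k.+1 t).1 (frozen c X V k.+1 t).2 <=
    U (s t) (v t) + ((gate A t * X k.+1 t + gate D t * (X k.+1 t ^+ 2 - V k.+1 t)) +
    C * ep * (`|X k.+1 t| `^ (2 * p) + V k.+1 t `^ p)).
  rewrite /gate /= -/(s t) -/(v t) -/(w t); case: ifP => wc /=; last first.
    by rewrite !mul0r addr0 add0r lerDl !mulr_ge0 ?addr_ge0 ?powR_ge0.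
  have V0 := tame_ge0 h k.+1 t.
  have := ss_step ss (s t) (X k.+1 t) V0 wc.
  rewrite powRM ?normr_ge0 ?invr_ge0 ?(ltW e0)// powRM ?invr_ge0 ?exprn_ge0 ?(ltW e0)//.
  have e2 : eps^-1 `^ (2 * p) = ep by rewrite /ep !powR_exp ?invr_gt0// lnV ?posrE// mulrN mulNr.
  have -> : (eps ^+ 2)^-1 `^ p = ep.
    by rewrite -exprVn powR_sqr gtr0_norm ?invr_gt0.
  rewrite e2.
  rewrite -mulrDl; lra.
have := Ex_le (LU k.+1) (L1D (LU k) (L1D (L1D LA LD) LXV)) step.
rewrite !ExD//; last 2 first.
- exact: L1D.
- exact: L1D (L1D LA LD) LXV.
rewrite EA ED ExZ ?ExD//; last exact: L1D.
rewrite -/(E k) -/(E k.+1) => /le_trans; apply; rewrite lerD2l.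
have Ce : 0 <= C * ep by rewrite mulr_ge0.
set EX := Ex P (fun t => `|X k.+1 t| `^ (2 * p)).
rewrite !add0r (_ : 2 * C * _ * EX = C * ep * (EX + EX)); last by rewrite /ep; ring.
exact: ler_wpM2l Ce _ _ (lerD (lexx _) VX).
Qed.

End lindeberg.

(** * One-sided normal approximation *)
Section core.
Context d (T : measurableType d) (R : realType) (P : probability T R).
Variable (F : nat -> set_system T).
Implicit Types (X V : nat -> T -> R).

Lemma measurable_partial_sum X n : (forall i, measurable_fun [set: T] (X i.+1)) ->
  measurable_fun [set: T] (partial_sum X n).
Proof.
move=> mX; elim: n => [|n IH].
  by rewrite (_ : partial_sum _ _ = fun=> 0); [exact: measurable_cst|apply/funext => t; rewrite partial_sum0].
rewrite (_ : partial_sum _ _ = fun t => partial_sum X n t + X n.+1 t).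
  exact: measurable_funD.
by apply/funext => t; rewrite partial_sumS.
Qed.

Lemma tame_var_measurable p X V i : tame P F p X V -> measurable_fun [set: T] (V i.+1).
Proof. by move=> h; exact: L1_measurable (cond_exp_integrable (tame_var h i)). Qed.

Lemma Ple_split (A B C : set T) (a b : R) : measurable A -> measurable B -> measurable C ->
  A `<=` B `|` C -> (P B <= a%:E)%E -> (P C <= b%:E)%E -> (P A <= (a + b)%:E)%E.
Proof.
move=> mA mB mC AB Ba Cb.
apply: (@le_trans _ _ (P (B `|` C))); first by rewrite le_measure ?inE//; exact: measurableU.
by apply: le_trans (measureU2 _ mB mC) _; rewrite EFinD leeD.
Qed.

(** On the event that S_n <= x and the clock is near 1, the frozen pair is
    (S_n, <S>_n) and the supersolution is at least 1 there. *)
Lemma one_sided_normal_approx (p : R) : 1 < p -> exists2 C : R, 0 <= C &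
  forall X V n eps x, tame P F p X V -> 0 < eps <= 1 ->
    \sum_(0 <= k < n) Ex P (fun t => `|X k.+1 t| `^ (2 * p)) <= eps `^ (2 * p + 1) ->
    (P [set t | (eps ^+ 2 < `|partial_sum V n t - 1|)%R] <= eps%:E)%E ->
    (P [set t | (partial_sum X n t <= x)%R] <= (Phi x + C * eps)%:E)%E.
Proof.
move=> p1; have [C C0 HC] := @supersolution_exists R p p1.
exists (3 * C + 1) => [|X V n eps x h e01 hL hV]; first by rewrite addr_ge0// mulr_ge0.
have /andP[e0 e1] := e01.
have [U [A [D ss]]] := HC eps x e01.
pose c := 1 + eps ^+ 2.
pose E k := Ex P (fun t => U (frozen c X V k t).1 (frozen c X V k t).2).
have En : E n <= E 0%N + 2 * C * eps `^ (- (2 * p)) *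
    \sum_(0 <= k < n) Ex P (fun t => `|X k.+1 t| `^ (2 * p)).
  elim: {hL hV} n => [|n IH]; first by rewrite big_geq// mulr0 addr0.
  have H := lindeberg_step n p1 C0 e0 h ss; rewrite -/c -/(E n) -/(E n.+1) in H.
  rewrite (le_trans H)// big_nat_recr//= mulrDr addrA lerD2r.
  exact: IH.
have E0 : E 0%N <= Phi x + C * eps.
  by rewrite /E /= Ex_cst; exact: ss_start ss.
have Een : E n <= Phi x + (3 * C) * eps.
  apply: (le_trans En).
  have ep0 : 0 <= 2 * C * eps `^ (- (2 * p)) by rewrite !mulr_ge0// powR_ge0.
  have := ler_wpM2l ep0 hL.
  have -> : 2 * C * eps `^ (- (2 * p)) * eps `^ (2 * p + 1) = 2 * C * eps.
    rewrite -mulrA -powRD; last by apply/implyP => _; rewrite gt_eqF.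
    by rewrite addrA addNr add0r powRr1// ltW.
  lra.
have mX i : measurable_fun [set: T] (X i.+1) := tame_measurable i h.
have mV i : measurable_fun [set: T] (V i.+1) := tame_var_measurable i h.
have mSX := measurable_partial_sum n mX; have mSV := measurable_partial_sum n mV.
pose good := [set t | partial_sum X n t <= x /\ `|partial_sum V n t - 1| <= eps ^+ 2].
have mbad : measurable [set t | eps ^+ 2 < `|partial_sum V n t - 1|].
  rewrite -[X in measurable X]setTI; apply: measurable_fun_ltr => //.
  apply: measurableT_comp => //; apply: measurable_funB => //.
have mle : measurable [set t | partial_sum X n t <= x].
  by rewrite -[X in measurable X]setTI; apply: measurable_fun_ler.
have mgood : measurable good.
  rewrite (_ : good = [set t | partial_sum X n t <= x] `&` ~` [set t | eps ^+ 2 < `|partial_sum V n t - 1|]).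
    by apply: measurableI => //; exact: measurableC.
  by apply/seteqP; split => t /= [h1 h2]; split => //; [apply/negP; rewrite -leNgt|rewrite leNgt; apply/negP].
rewrite (_ : Phi x + (3 * C + 1) * eps = (Phi x + 3 * C * eps) + eps); last by ring.
apply: (Ple_split mle mgood mbad) => //.
  move=> t /= tx; have [tg|tb] := leP `|partial_sum V n t - 1| (eps ^+ 2); [by left|by right].
apply: (@le_trans _ _ (E n)%:E); last by rewrite lee_fin.
have [M HM] := ss_bounded ss; have [mU _ _] := ss_measurable ss.
have hF := tame_filtration h.
have [m1 m2] := @frozen_measurable _ _ _ _ c X V n hF (mdiff_adapted (tame_mdiff h))
  (fun i => cond_exp_measurable (tame_var h i)).
apply: Ex_prob => //.
- apply: (@L1_bounded _ _ _ _ _ M) => [|t].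
    apply: (measurable_wrt_measurable (@filtration_measurable _ _ _ hF n)).
    exact: measurable2_wrt (filtration_sigma hF n) mU m1 m2.
  by have [] := HM (frozen c X V n t).1 (frozen c X V n t).2.
- by move=> t; exact: ss_ge0 ss _ _.
- move=> t [tx tv]; rewrite frozenE; last 2 first.
  + by move=> i; exact: tame_ge0 h i t.
  + by move: tv; rewrite ler_norml /c; lra.
  exact: ss_end ss _ _ tx tv.
Qed.

End core.

(** * Moments of martingales *)
Section power_inequality.
Context {R : realType}.
Implicit Types (a b q t N x : R).

(** The p-th moment of a sum of n martingale differences is of order n^(p/2) for
    p >= 2, and of order n for p <= 2. *)
Definition growth q : R := Num.max (q / 2) 1.

Definition signed_power q a : R := if 0 <= a then `|a| `^ (q - 1) else - `|a| `^ (q - 1).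

Lemma expR_le_quadratic x : expR x <= 1 + x + expR `|x| * x ^+ 2.
Proof.
pose f (y : R) := expR y - y.
have fd (y : R) : is_derive y 1 f (expR y - 1).
  by apply: (is_derive_eq (drvB (drv_expR (drvI y)) (drvI y))); rewrite mulr1.
have ed (y : R) : is_derive y 1 expR (expR y) := is_derive_expR y.
have [c] := mean_value 0 x fd; rewrite /f expR0 subr0 => fE /norm_between0 cx.
have [e] := mean_value 0 c ed; rewrite expR0 subr0 => eE /norm_between0 ec.
have : expR x = 1 + x + (expR c - 1) * x by lra.
move=> ->; rewrite lerD2l eE (le_trans (ler_norm _))//.
rewrite !normrM ger0_norm ?expR_ge0// -mulrA -[x ^+ 2]real_normK ?num_real// expr2.
apply: ler_pM; rewrite ?expR_ge0 ?mulr_ge0 ?ler_wpM2r//.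
by rewrite ler_expR (le_trans (ler_norm _))// (le_trans ec).
Qed.

Lemma powR_step_ge1 q N : 1 <= N -> 1 <= N `^ (growth q - 1).
Proof.
move=> N1; rewrite -[leLHS](powRr0 N) ler_powR// subr_ge0 /growth le_max lexx orbT//.
Qed.

(** The factor N, later the number of steps, splits a quadratic term in such a way
    that the first part, summed over N steps, only costs a constant factor. *)
Lemma sqr_le_step q N t : 1 < q -> 1 <= N -> `|t| <= 1 ->
  t ^+ 2 <= N^-1 + N `^ (growth q - 1) * `|t| `^ q.
Proof.
move=> q1 N1 t1.
have N0 : 0 < N by lra.
have [tN|tN] := leP (t ^+ 2) N^-1.
  by rewrite (le_trans tN)// lerDl mulr_ge0 ?powR_ge0.
have t20 : 0 < t ^+ 2 by rewrite (lt_trans _ tN)// invr_gt0.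
have tp : 0 < `|t| by rewrite normr_gt0 -sqrf_eq0 gt_eqF.
apply: (@le_trans _ _ (N `^ (growth q - 1) * `|t| `^ q)); last first.
  by rewrite lerDr invr_ge0 ltW.
have tq : `|t| `^ q = t ^+ 2 * (t ^+ 2) `^ (q / 2 - 1).
  rewrite -[X in X * _](powRr1 (ltW t20)) -powRD; last by apply/implyP => _; rewrite gt_eqF.
  by rewrite powR_sqr; congr (powR _ _); field.
rewrite tq mulrCA ler_peMr ?(ltW t20)//.
rewrite /growth; have [q2|/ltW q2] := leP (q / 2) 1.
  rewrite subrr powRr0 mul1r.
  have t21 : t ^+ 2 <= 1 by rewrite -[t ^+ 2]real_normK ?num_real// exprn_ile1.
  rewrite -(opprB 1) powRN -[leLHS]invr1 lef_pV2 ?posrE ?powR_gt0//.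
  have o1 : 1 `^ (1 - q / 2) = 1 :> R by rewrite powR1.
  by rewrite -[leRHS]o1 ge0_ler_powR ?nnegrE ?(ltW t20)//; lra.
rewrite -powRM ?(ltW N0) ?(ltW t20)//.
have Nt : 1 <= N * t ^+ 2.
  by rewrite -(@ler_pM2l _ N^-1) ?invr_gt0// mulKf ?gt_eqF// mulr1 ltW.
by rewrite -[leLHS](powRr0 (N * t ^+ 2)) ler_powR//; lra.
Qed.

(** For |b| < |a|/2 this is the expansion of |1 + b/a|^q to second order; otherwise
    all terms are at most a constant times |b|^q. *)
Lemma power_increment q : 1 < q -> exists2 C : R, 0 <= C & forall N a b, 1 <= N ->
  `|a + b| `^ q <= (1 + C / N) * `|a| `^ q + q * signed_power q a * b +
    C * N `^ (growth q - 1) * `|b| `^ q.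
Proof.
move=> q1.
pose C1 := expR q * q ^+ 2.
pose C2 := 3 `^ q + q * 2 `^ (q - 1).
have C10 : 0 <= C1 by rewrite mulr_ge0 ?expR_ge0 ?sqr_ge0.
have C20 : 0 <= C2 by rewrite addr_ge0 ?mulr_ge0 ?powR_ge0//; lra.
exists (C1 + C2) => [|N a b N1]; first by rewrite addr_ge0.
have N0 : 0 < N by lra.
have NR := @powR_step_ge1 q N N1.
have aq := powR_ge0 `|a| q; have bq := powR_ge0 `|b| q.
have [ab|ba] := leP `|a| (2 * `|b|).
  have h1 : `|a + b| `^ q <= 3 `^ q * `|b| `^ q.
    rewrite -powRM// ge0_ler_powR ?nnegrE ?mulr_ge0//; first by lra.
    by rewrite (le_trans (ler_normD _ _))//; lra.
  have h2 : - (q * 2 `^ (q - 1) * `|b| `^ q) <= q * signed_power q a * b.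
    have sa : `|signed_power q a| <= 2 `^ (q - 1) * `|b| `^ (q - 1).
      rewrite (_ : `|signed_power q a| = `|a| `^ (q - 1)); last first.
        by rewrite /signed_power; case: ifP => _; rewrite ?normrN ger0_norm ?powR_ge0.
      by rewrite -powRM// ge0_ler_powR ?nnegrE ?mulr_ge0//; lra.
    have bE : `|b| `^ q = `|b| `^ (q - 1) * `|b|.
      rewrite -[X in _ * X](powRr1 (normr_ge0 b)) -powRD ?subrK//.
      by apply/implyP => /eqP; lra.
    rewrite lerNl (le_trans (ler_norm _))// normrN !normrM (gtr0_norm (lt_trans ltr01 q1)).
    rewrite bE -!mulrA ler_wpM2l//; first by lra.
    by rewrite mulrA ler_wpM2r.
  have h3 : C2 * `|b| `^ q <= (C1 + C2) * N `^ (growth q - 1) * `|b| `^ q.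
    rewrite ler_wpM2r// (@le_trans _ _ ((C1 + C2) * 1))//; first by lra.
    by rewrite ler_wpM2l// addr_ge0.
  have h4 : 0 <= (1 + (C1 + C2) / N) * `|a| `^ q.
    have : 0 <= (C1 + C2) / N by apply: divr_ge0; [exact: addr_ge0|lra].
    by move=> h; apply: mulr_ge0 => //; lra.
  have C2E : C2 * `|b| `^ q = 3 `^ q * `|b| `^ q + q * 2 `^ (q - 1) * `|b| `^ q by rewrite /C2; ring.
  clearbody C1 C2; lra.
have a0 : a != 0 by rewrite -normr_gt0 (le_lt_trans _ ba)// mulr_ge0.
have an0 : 0 < `|a| by rewrite normr_gt0.
pose t := b / a.
have bE : b = a * t by rewrite /t; field.
have t2 : `|t| < 1 / 2.
  by rewrite /t normrM normfV ltr_pdivrMr//; lra.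
have t1 : `|t| <= 1 by lra.
have tp : 0 < 1 + t by move: t2; rewrite ltr_norml; lra.
have aE : signed_power q a * a = `|a| `^ q.
  have -> : `|a| `^ q = `|a| `^ (q - 1) * `|a|.
    rewrite -[X in _ * X](powRr1 (normr_ge0 a)) -powRD ?subrK//.
    by apply/implyP => /eqP; lra.
  rewrite /signed_power; case: ifP => [a1|/negbT]; first by rewrite (ger0_norm a1).
  by rewrite -ltNge => a1; rewrite (ltr0_norm a1) mulrN mulNr.
have h1 : (1 + t) `^ q <= 1 + q * t + C1 * t ^+ 2.
  rewrite powR_exp//.
  have l1 : ln (1 + t) <= t by have := ln_le_sub1 tp; lra.
  apply: (@le_trans _ _ (expR (q * t))); first by rewrite ler_expR ler_wpM2l//; lra.
  apply: le_trans (expR_le_quadratic _) _.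
  rewrite lerD2l exprMn /C1 mulrA ler_wpM2r ?sqr_ge0// ler_wpM2r ?sqr_ge0//.
  by rewrite ler_expR normrM (gtr0_norm (lt_trans ltr01 q1)) ler_piMr//; lra.
have h2 := sqr_le_step q1 N1 t1.
have -> : `|a + b| `^ q = `|a| `^ q * (1 + t) `^ q.
  rewrite -powRM ?(ltW tp)//; congr (powR _ _).
  by rewrite bE -{1}[a]mulr1 -mulrDr normrM (gtr0_norm tp).
have h3 : (1 + t) `^ q <= 1 + q * t + C1 * (N^-1 + N `^ (growth q - 1) * `|t| `^ q).
  by rewrite (le_trans h1)// lerD2l ler_wpM2l.
have bq' : `|b| `^ q = `|a| `^ q * `|t| `^ q by rewrite bE normrM powRM.
apply: le_trans (ler_wpM2l aq h3) _.
rewrite bq' bE (_ : q * signed_power q a * (a * t) = `|a| `^ q * (q * t)); last by rewrite -aE; ring.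
have h4 : 0 <= `|a| `^ q * (C2 * N^-1) by rewrite !mulr_ge0// invr_ge0 ltW.
have h5 : 0 <= `|a| `^ q * (C2 * (N `^ (growth q - 1) * `|t| `^ q)).
  by rewrite !mulr_ge0// powR_ge0.
lra.
Qed.

Lemma powR_sum_le q a b : 1 <= q -> `|a + b| `^ q <= 2 `^ q * (`|a| `^ q + `|b| `^ q).
Proof.
move=> q1; have q0 : 0 <= q by lra.
have m : `|a + b| <= 2 * Num.max `|a| `|b|.
  rewrite (le_trans (ler_normD _ _))//.
  by have [h|/ltW h] := leP `|a| `|b|; lra.
have m0 : 0 <= Num.max `|a| `|b| by rewrite le_max normr_ge0.
apply: (@le_trans _ _ ((2 * Num.max `|a| `|b|) `^ q)).
  by rewrite ge0_ler_powR ?nnegrE// mulr_ge0.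
rewrite powRM// ler_wpM2l ?powR_ge0//.
have := powR_ge0 `|a| q; have := powR_ge0 `|b| q.
by have [h|/ltW h] := leP `|a| `|b|; lra.
Qed.

Lemma signed_power_mul_le q a b : 1 < q -> `|signed_power q a * b| <= `|a| `^ q + `|b| `^ q.
Proof.
move=> q1; have q0 : 0 <= q - 1 by lra.
rewrite normrM (_ : `|signed_power q a| = `|a| `^ (q - 1)); last first.
  by rewrite /signed_power; case: ifP => _; rewrite ?normrN ger0_norm ?powR_ge0.
have E (y : R) : 0 <= y -> y `^ q = y `^ (q - 1) * y.
  move=> y0; rewrite -[X in _ * X](powRr1 y0) -powRD ?subrK//.
  by apply/implyP => /eqP; lra.
have aq := powR_ge0 `|a| q; have bq := powR_ge0 `|b| q.
have [h|/ltW h] := leP `|a| `|b|.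
  apply: (@le_trans _ _ (`|b| `^ q)); last by lra.
  by rewrite (E `|b|)// ler_wpM2r// ge0_ler_powR ?nnegrE.
apply: (@le_trans _ _ (`|a| `^ q)); last by lra.
by rewrite (E `|a|)// ler_wpM2l// powR_ge0.
Qed.

End power_inequality.

Section martingale_moments.
Context d (T : measurableType d) (R : realType) (P : probability T R).
Variable (F : nat -> set_system T).
Implicit Types (Y : nat -> T -> R).

(** The middle term of [power_increment] has mean zero, so the moment m_k of the
    k-th partial sum satisfies m_(k+1) <= (1 + C/n) m_k + C n^(growth q - 1) K,
    and (1 + C/n)^n is at most e^C. *)
Lemma martingale_moment (q : R) : 1 < q -> exists2 C : R, 0 <= C & forall Y K n,
  is_filtration F -> (forall i, measurable_wrt (F i.+1) (Y i.+1)) ->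
  (forall i, centered P (F i) (Y i.+1)) ->
  (forall i, L1 P (fun t => `|Y i.+1 t| `^ q)) ->
  (forall i, Ex P (fun t => `|Y i.+1 t| `^ q) <= K) ->
  (0 < n)%N -> L1 P (fun t => `|partial_sum Y n t| `^ q) /\
  Ex P (fun t => `|partial_sum Y n t| `^ q) <= C * n%:R `^ growth q * K.
Proof.
move=> q1; have [C C0 HC] := @power_increment R q q1.
exists (expR C * C) => [|Y K n hF mY cY iY YK n0]; first by rewrite mulr_ge0 ?expR_ge0.
have K0 : 0 <= K by apply: le_trans (YK 0%N); apply: Ex_ge0 => t; exact: powR_ge0.
pose N : R := n%:R.
have N1 : 1 <= N by rewrite ler1n.
have Np : 0 < N by lra.
have mS k : measurable_wrt (F k) (partial_sum Y k).
  elim: k => [|k IH].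
    rewrite (_ : partial_sum _ _ = fun=> 0); last by apply/funext => t; rewrite partial_sum0.
    by apply/(measurable_wrtP _ (filtration_sigma hF 0)); exact: measurable_cst.
  rewrite (_ : partial_sum _ _ = fun t => partial_sum Y k t + Y k.+1 t); last first.
    by apply/funext => t; rewrite partial_sumS.
  have sG := filtration_sigma hF k.+1.
  apply/(measurable_wrtP _ sG); apply: measurable_funD; apply/(measurable_wrtP _ sG) => //.
  exact: measurable_wrt_incr.
have mST k := measurable_wrt_measurable (@filtration_measurable _ _ _ hF k) (mS k).
have mYT k := measurable_wrt_measurable (@filtration_measurable _ _ _ hF k.+1) (mY k).
have mnorm (f : T -> R) : measurable_fun [set: T] f -> measurable_fun [set: T] (fun t => `|f t| `^ q).
  by move=> mf; apply: L1_powR_measurable; exact: measurableT_comp mf.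
have iS k : L1 P (fun t => `|partial_sum Y k t| `^ q).
  elim: k => [|k IH].
    rewrite (_ : (fun t => _) = fun=> 0); first exact: L1_cst.
    by apply/funext => t; rewrite partial_sum0 normr0 powR0// gt_eqF//; lra.
  apply: (@L1_le _ _ _ _ _ (fun t => 2 `^ q * (`|partial_sum Y k t| `^ q + `|Y k.+1 t| `^ q))).
  - exact: mnorm.
  - move=> t; rewrite ger0_norm ?powR_ge0// partial_sumS; apply: powR_sum_le; exact: ltW.
  - by apply: L1Z; exact: L1D.
split; first exact: iS.
pose E k := Ex P (fun t => `|partial_sum Y k t| `^ q).
pose D := C * N `^ (growth q - 1) * K.
have D0 : 0 <= D by rewrite !mulr_ge0// powR_ge0.
have step k : E k.+1 <= (1 + C / N) * E k + D.
  have mw : measurable_wrt (F k) (fun t => signed_power q (partial_sum Y k t)).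
    have sG := filtration_sigma hF k; apply/(measurable_wrtP _ sG).
    have m1 := (measurable_wrtP _ sG).1 (mS k).
    have m2 : measurable_fun [set: g_sigma_algebraType (F k)] (fun t => `|partial_sum Y k t| `^ (q - 1)).
      by apply: measurableT_comp (@measurable_powR R (q - 1)) _; exact: measurableT_comp m1.
    apply: measurable_fun_ifT => //; last exact: measurable_funN.
    by apply: measurable_fun_ler => //; exact: measurable_cst.
  have Lw : L1 P (fun t => signed_power q (partial_sum Y k t) * Y k.+1 t).
    apply: (@L1_le _ _ _ _ _ (fun t => `|partial_sum Y k t| `^ q + `|Y k.+1 t| `^ q)).
    - apply: measurable_funM => //.
      exact: measurable_wrt_measurable (@filtration_measurable _ _ _ hF k) mw.
    - by move=> t; exact: signed_power_mul_le.
    - exact: L1D.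
  have Ew := centered_mul (filtration_sigma hF k) (@filtration_measurable _ _ _ hF k) (cY k) mw Lw.
  have L2 : L1 P (fun t => (1 + C / N) * `|partial_sum Y k t| `^ q +
      q * (signed_power q (partial_sum Y k t) * Y k.+1 t)).
    by apply: L1D; exact: L1Z.
  have L3 : L1 P (fun t => C * N `^ (growth q - 1) * `|Y k.+1 t| `^ q) by exact: L1Z.
  have := Ex_le (iS k.+1) (L1D L2 L3).
  rewrite ExD// ExD; [|exact: L1Z|exact: L1Z].
  rewrite !ExZ// Ew mulr0 addr0 => H.
  apply: le_trans (H _) _; last first.
    by rewrite lerD2l /D ler_wpM2l// mulr_ge0// powR_ge0.
  by move=> t; rewrite partial_sumS mulrA; exact: HC.
have bound k : E k <= expR (C / N) ^+ k * k%:R * D.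
  elim: k => [|k IH].
    rewrite mulr0 mul0r /E (_ : (fun t => _) = fun=> 0) ?Ex_cst//.
    by apply/funext => t; rewrite partial_sum0 normr0 powR0// gt_eqF//; lra.
  apply: le_trans (step k) _.
  have e1 : 1 + C / N <= expR (C / N) by exact: expR_ge1Dx.
  have CN : 0 <= C / N by rewrite divr_ge0// ltW.
  have e2 : 1 <= expR (C / N) ^+ k.+1 by rewrite exprn_ege1//; lra.
  have X0 : 0 <= expR (C / N) ^+ k * k%:R * D.
    by apply: mulr_ge0 => //; apply: mulr_ge0 => //; rewrite exprn_ge0 ?expR_ge0.
  apply: (@le_trans _ _ (expR (C / N) * (expR (C / N) ^+ k * k%:R * D) + expR (C / N) ^+ k.+1 * D)).
    apply: lerD; last by rewrite ler_peMl.
    apply: ler_pM => //; first by lra.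
    by apply: Ex_ge0 => t; exact: powR_ge0.
  by rewrite -natr1 exprS; lra.
have := bound n; rewrite -/N.
have -> : expR (C / N) ^+ n = expR C.
  by rewrite -expRM_natl -/N; congr expR; field; rewrite gt_eqF.
have NN : N `^ growth q = N * N `^ (growth q - 1).
  have gE : growth q = 1 + (growth q - 1) by rewrite addrC subrK.
  have NR : (1 + (growth q - 1) == 0) ==> (N != 0) by apply/implyP => _; rewrite gt_eqF.
  transitivity (N `^ (1 + (growth q - 1))); first by rewrite -gE.
  by rewrite (powRD NR) powRr1 ?ltW.
by rewrite /D NN => /le_trans; apply; rewrite le_eqVlt; apply/orP; left; apply/eqP; ring.
Qed.

End martingale_moments.

(** * From sums to Student's statistic *)
Section student_pointwise.
Context d (T : measurableType d) (R : realType).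
Implicit Types (X V : nat -> T -> R) (t : T).

Lemma partial_sumZ (c : R) X n t : partial_sum (fun i t => c * X i t) n t = c * partial_sum X n t.
Proof. by rewrite /partial_sum mulr_sumr. Qed.

Lemma sample_varianceE X n t : (2 <= n)%N ->
  sample_variance X n t =
  (partial_sum (fun i t => X i t ^+ 2) n t - partial_sum X n t ^+ 2 / n%:R) / (n%:R - 1).
Proof.
move=> n2; have N1 : (1 : R) < n%:R by rewrite ltr1n.
rewrite /sample_variance -mulr_suml; congr (_ / _).
set mu := sample_mean X n t.
rewrite (eq_bigr (fun i => X i t ^+ 2 + (- 2 * mu * X i t + mu ^+ 2))); last by move=> i _; ring.
rewrite !big_split/= -mulr_sumr -/(partial_sum X n t) -/(partial_sum (fun i t => X i t ^+ 2) n t).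
rewrite big_const_nat subn1 /= iter_addr_0 -[_ *+ n]mulr_natr /mu /sample_mean.
by field; rewrite gt_eqF//; lra.
Qed.

(** The three hypotheses on the partial sums say that the sample variance is
    sigma2 (1 + O(eps)); the sign of x decides in which direction the error in the
    sample deviation moves the threshold. *)
Lemma studentE X V n t (sigma2 eps x : R) : (2 <= n)%N -> 0 < sigma2 -> 0 < eps ->
  8 * eps <= 1 / 2 ->
  1 <= n%:R * eps ->
  `|partial_sum V n t / (n%:R * sigma2) - 1| <= eps ^+ 2 ->
  `|partial_sum (fun i t => X i t ^+ 2 - V i t) n t| <= n%:R * sigma2 * eps ->
  partial_sum X n t ^+ 2 <= n%:R * sigma2 * (n%:R * eps) ->
  student_le X n x t ->
  partial_sum X n t / Num.sqrt (n%:R * sigma2) <=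
    x * (if 0 <= x then 1 + 8 * eps else 1 - 8 * eps).
Proof.
move=> n2 s0 e0 e8 Ne hV hM hS.
set N : R := n%:R in Ne hV hM hS *.
have N2 : 2 <= N by rewrite ler_nat.
set S := partial_sum X n t in hS *.
set W := partial_sum V n t in hV.
pose Q := partial_sum (fun i t => X i t ^+ 2) n t.
have QW : partial_sum (fun i t => X i t ^+ 2 - V i t) n t = Q - W.
  by rewrite /partial_sum sumrB.
rewrite QW in hM.
have Ns0 : 0 < N * sigma2 by rewrite mulr_gt0//; lra.
pose q2 := sample_variance X n t / sigma2.
have q2E : q2 = N / (N - 1) * (Q / (N * sigma2) - S ^+ 2 / (N * sigma2) / N).
  rewrite /q2 sample_varianceE// -/Q -/S -/N; field.
  by rewrite !gt_eqF//; lra.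
have h1 : `|Q / (N * sigma2) - W / (N * sigma2)| <= eps.
  rewrite -mulrBl normrM normfV (gtr0_norm Ns0) ler_pdivrMr// mulrC.
  by rewrite mulrC [leRHS]mulrC.
have h2 : S ^+ 2 / (N * sigma2) / N <= eps.
  rewrite ler_pdivrMr; last lra.
  by rewrite ler_pdivrMr// mulrC [eps * N]mulrC.
have h3 : 0 <= S ^+ 2 / (N * sigma2) / N by rewrite !divr_ge0 ?sqr_ge0// ?(ltW Ns0)//; lra.
have e2 : eps ^+ 2 <= eps by rewrite expr2 ler_piMr//; lra.
have hN : N^-1 <= eps.
  by rewrite -[leLHS]mul1r ler_pdivrMr ?[eps * N]mulrC//; lra.
have hN1 : N / (N - 1) <= 2 by rewrite ler_pdivrMr; lra.
have hN0 : 0 < N / (N - 1) by rewrite divr_gt0; lra.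
pose u := Q / (N * sigma2) - S ^+ 2 / (N * sigma2) / N - 1 + N^-1.
have q2u : q2 - 1 = N / (N - 1) * u.
  by rewrite q2E /u; field; rewrite !gt_eqF//; lra.
have ub : `|u| <= 4 * eps.
  have Ni : 0 < N^-1 by rewrite invr_gt0; lra.
  move: h1 hV; rewrite !ler_norml /u => /andP[a1 a2] /andP[a3 a4].
  by apply/andP; split; lra.
have q21 : `|q2 - 1| <= 8 * eps.
  rewrite q2u normrM (gtr0_norm hN0) (_ : 8 * eps = 2 * (4 * eps)); last by ring.
  by rewrite ler_pM// ltW.
have q20 : 0 < q2 by move: q21; rewrite ler_norml; lra.
pose q := Num.sqrt q2.
have q0 : 0 <= q := sqrtr_ge0 _.
have qq : q ^+ 2 = q2 by rewrite sqr_sqrtr// ltW.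
have qb : `|q - 1| <= 8 * eps.
  apply: le_trans q21.
  have -> : q2 - 1 = (q - 1) * (q + 1) by rewrite -qq; ring.
  by rewrite normrM ler_peMr// ger0_norm; lra.
have sdE : sample_sd X n t = Num.sqrt sigma2 * q.
  rewrite /sample_sd /q -sqrtrM ?(ltW s0)//; congr Num.sqrt.
  by rewrite /q2; field; rewrite gt_eqF.
have rN : 0 < Num.sqrt N by rewrite sqrtr_gt0; lra.
have rs : 0 < Num.sqrt sigma2 by rewrite sqrtr_gt0.
rewrite /student_le /= sdE /sample_mean -/S -/N.
have NE : N = Num.sqrt N ^+ 2 by rewrite sqr_sqrtr//; lra.
have -> : Num.sqrt N * (S / N) = S / Num.sqrt N.
  by rewrite {2}NE; field; rewrite gt_eqF.
move=> H.
have H' : S / Num.sqrt (N * sigma2) <= x * q.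
  rewrite sqrtrM; last lra.
  rewrite invfM mulrA ler_pdivrMr//.
  by rewrite (le_trans H)//; lra.
apply: (le_trans H').
move: qb; rewrite ler_norml => /andP[qb1 qb2].
case: ifPn => [x0|]; first by rewrite ler_wpM2l//; lra.
rewrite -ltNge => x0; rewrite ler_wnM2l//; [exact: ltW|lra].
Qed.

End student_pointwise.

Section student.
Context d (T : measurableType d) (R : realType) (P : probability T R).
Variable (F : nat -> set_system T).
Implicit Types (X V : nat -> T -> R).

Lemma measurable_wrtZ G (c : R) (Y : T -> R) : sigma_algebra [set: T] G ->
  measurable_wrt G Y -> measurable_wrt G (fun t => c * Y t).
Proof.
move=> sG /(measurable_wrtP _ sG) mY; apply/(measurable_wrtP _ sG).
by apply: measurable_funM => //; exact: measurable_cst.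
Qed.

Lemma is_cond_expZ G (c : R) (Z Y : T -> R) : sigma_algebra [set: T] G ->
  (forall A, G A -> measurable A) -> L1 P Z -> is_cond_exp P G Z Y ->
  is_cond_exp P G (fun t => c * Z t) (fun t => c * Y t).
Proof.
move=> sG GM LZ [mY iY YE]; split.
- exact: measurable_wrtZ.
- exact: L1Z.
- move=> A GA; have mA := GM A GA.
  under eq_integral do rewrite EFinM.
  rewrite integralZl//; last exact: integrableS iY.
  under [RHS]eq_integral do rewrite EFinM.
  by rewrite integralZl ?YE//; exact: integrableS LZ.
Qed.

Lemma tameZ (p c : R) X V : 1 < p -> tame P F p X V ->
  tame P F p (fun i t => c * X i t) (fun i t => c ^+ 2 * V i t).
Proof.
move=> p1 h; have hF := tame_filtration h; have hX := tame_mdiff h.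
split => //.
- split=> i.
  + exact: (measurable_wrtZ c (filtration_sigma hF i.+1) (mdiff_adapted hX i)).
  + exact: (L1Z c (mdiff_integrable hX i)).
  + have := is_cond_expZ c (filtration_sigma hF i) (@filtration_measurable _ _ _ hF i)
      (mdiff_integrable hX i) (mdiff_cond_exp hX i).
    by rewrite (_ : (fun t => c * cst 0 t) = cst 0)//; apply/funext => t; rewrite mulr0.
- move=> i; have := is_cond_expZ (c ^+ 2) (filtration_sigma hF i) (@filtration_measurable _ _ _ hF i)
    (tame_L1_sqr i p1 h) (tame_var h i).
  by rewrite (_ : (fun t => c ^+ 2 * X i.+1 t ^+ 2) = fun t => (c * X i.+1 t) ^+ 2)//;
    apply/funext => t; rewrite exprMn.
- by move=> i t; rewrite mulr_ge0 ?sqr_ge0// (tame_ge0 h).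
- move=> i; rewrite (_ : (fun t => _) = fun t => `|c| `^ (2 * p) * `|X i.+1 t| `^ (2 * p)).
    by apply: L1Z; exact: tame_moment h i.
  by apply/funext => t; rewrite normrM powRM.
Qed.

Lemma markov_powR (q c : R) (Y : T -> R) : 0 < q -> 0 < c -> measurable_fun [set: T] Y ->
  L1 P (fun t => `|Y t| `^ q) ->
  (P [set t | (c < `|Y t|)%R] <= (Ex P (fun t => `|Y t| `^ q) / c `^ q)%:E)%E.
Proof.
move=> q0 c0 mY iY; have cq : 0 < c `^ q by rewrite powR_gt0.
rewrite mulrC -ExZ//; apply: Ex_prob.
- rewrite -[X in measurable X]setTI; apply: measurable_fun_ltr => //.
  exact: measurableT_comp.
- exact: L1Z.
- by move=> t; rewrite mulr_ge0 ?powR_ge0// invr_ge0 ltW.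
- move=> t /= ct; rewrite mulrC ler_pdivlMr// mul1r ge0_ler_powR ?nnegrE ?(ltW c0) ?(ltW q0)//.
  exact: ltW.
Qed.

Lemma L1_powR_add (q : R) (f g : T -> R) : 1 <= q ->
  measurable_fun [set: T] f -> measurable_fun [set: T] g ->
  L1 P (fun t => `|f t| `^ q) -> L1 P (fun t => `|g t| `^ q) -> L1 P (fun t => `|f t + g t| `^ q).
Proof.
move=> q1 mf mg If Ig.
apply: (@L1_le _ _ _ _ _ (fun t => 2 `^ q * (`|f t| `^ q + `|g t| `^ q))).
- by apply: L1_powR_measurable; apply: measurableT_comp => //; exact: measurable_funD.
- by move=> t; rewrite ger0_norm ?powR_ge0//; exact: powR_sum_le.
- by apply: L1Z; exact: L1D.
Qed.

Lemma L1_powR_partial_sum (q : R) X n : 1 <= q -> (forall i, measurable_fun [set: T] (X i.+1)) ->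
  (forall i, L1 P (fun t => `|X i.+1 t| `^ q)) -> L1 P (fun t => `|partial_sum X n t| `^ q).
Proof.
move=> q1 mX iX; elim: n => [|n IH].
  rewrite (_ : (fun t => _) = fun=> 0); first exact: L1_cst.
  by apply/funext => t; rewrite partial_sum0 normr0 powR0// gt_eqF//; lra.
rewrite (_ : (fun t => _) = fun t => `|partial_sum X n t + X n.+1 t| `^ q).
  by apply: L1_powR_add => //; exact: measurable_partial_sum.
by apply/funext => t; rewrite partial_sumS.
Qed.

End student.

(** * The exceptional events *)
Section rates.
Context {R : realType}.
Implicit Types (p N L : R).

Lemma powR_inv_cancel (L a : R) : 0 <= L -> 0 < a -> (L `^ a^-1) `^ a = L.
Proof. by move=> L0 a0; rewrite -powRrM mulVf ?gt_eqF// powRr1. Qed.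

(** The exponents that occur in the exceptional events are larger than needed:
    (p - 1)(p + 1) <= (p - growth p)(2p + 1), and 2 (p - 1) <= 2p + 1. *)
Lemma rate_exponents p N e : 1 < p -> 1 <= N -> e <= 1 ->
  N `^ (1 - p) <= e `^ (2 * p + 1) -> 0 < e ->
  N `^ (growth p - p) <= e `^ (p + 1) /\ 1 <= N * e ^+ 2.
Proof.
move=> p1 N1 e1 hN e0.
have N0 : 0 < N by lra.
have p21 : 0 < 2 * p + 1 by lra.
have ln0 : 0 <= ln N by exact: ln_ge0.
have hl : (1 - p) * ln N <= (2 * p + 1) * ln e.
  by rewrite -ler_expR -!powR_exp.
have g1 : growth p = 1 /\ p <= 2 \/ growth p = p / 2 /\ 2 <= p.
  by rewrite /growth; have [h|/ltW h] := leP (p / 2) 1; [left|right]; split; lra.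
split.
  rewrite !powR_exp// ler_expR.
  rewrite -(ler_pM2l p21) [leRHS]mulrCA.
  apply: le_trans (ler_wpM2l _ hl); last by lra.
  rewrite -subr_ge0.
  have -> : (p + 1) * ((1 - p) * ln N) - (2 * p + 1) * ((growth p - p) * ln N) =
    (p ^+ 2 + p + 1 - (2 * p + 1) * growth p) * ln N + 0 by ring.
  rewrite addr0 mulr_ge0//.
  by case: g1 => -[-> h]; [nra|lra].
have Np : 0 < N * e ^+ 2 by rewrite mulr_gt0// exprn_gt0.
rewrite -ler_ln ?posrE// ln1 lnM ?posrE ?exprn_gt0// lnXn// -mulr_natl.
have : 0 <= (2 * p + 1) * (ln N + 2 * ln e).
  rewrite mulrDr mulrCA.
  have : 2 * ((1 - p) * ln N) <= 2 * ((2 * p + 1) * ln e) by rewrite ler_wpM2l.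
  have : 0 <= 3 * ln N by rewrite mulr_ge0.
  lra.
by rewrite pmulr_rge0.
Qed.

End rates.

Section student.
Context d (T : measurableType d) (R : realType) (P : probability T R).
Variable (F : nat -> set_system T).
Implicit Types (X V : nat -> T -> R).

Lemma L1_clock_deviation (p c : R) X V n : 1 < p -> tame P F p X V ->
  L1 P (fun t => `|c * partial_sum V n t - 1| `^ p).
Proof.
move=> p1 h; have p1' := ltW p1.
have mV i : measurable_fun [set: T] (V i.+1) := tame_var_measurable i h.
apply: (@L1_powR_add _ _ _ P p (fun t => c * partial_sum V n t) (fun=> -1)) => //.
- apply: measurable_funM; first exact: measurable_cst.
  exact: measurable_partial_sum.
- rewrite (_ : (fun t => _) = fun t => `|c| `^ p * `|partial_sum V n t| `^ p).
    apply: L1Z; apply: L1_powR_partial_sum => // i.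
    rewrite (_ : (fun t => _) = fun t => V i.+1 t `^ p); first exact: (tame_var_moment i p1 h).1.
    by apply/funext => t; rewrite ger0_norm// (tame_ge0 h).
  by apply/funext => t; rewrite normrM powRM.
- exact: L1_cst.
Qed.

Lemma measurable_student X n x : (forall i, measurable_fun [set: T] (X i.+1)) ->
  measurable (student_le X n x : set T).
Proof.
move=> mX; have mS := measurable_partial_sum n mX.
have mean : measurable_fun [set: T] (sample_mean X n).
  by apply: measurable_funM => //; exact: measurable_cst.
have mvar : measurable_fun [set: T] (sample_variance X n).
  have mX2 i : measurable_fun [set: T] (fun t => (X i.+1 t - sample_mean X n t) ^+ 2 / (n%:R - 1)).
    apply: measurable_funM; last exact: measurable_cst.
    by apply: measurable_funX; exact: measurable_funB.
  exact: (@measurable_partial_sum _ T R (fun i t => (X i t - sample_mean X n t) ^+ 2 / (n%:R - 1)) n mX2).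
have m1 : measurable_fun [set: T] (fun t => Num.sqrt n%:R * sample_mean X n t).
  by apply: measurable_funM => //; exact: measurable_cst.
have m2 : measurable_fun [set: T] (fun t => x * sample_sd X n t).
  by apply: measurable_funM; [exact: measurable_cst|exact: measurable_root].
by rewrite -[X in measurable X]setTI; apply: measurable_fun_ler.
Qed.

Lemma clock_deviation_prob (p c eps : R) X V n : 1 < p -> tame P F p X V -> 0 < eps ->
  Ex P (fun t => `|c * partial_sum V n t - 1| `^ p) <= eps `^ (2 * p + 1) ->
  (P [set t | (eps ^+ 2 < `|c * partial_sum V n t - 1|)%R] <= eps%:E)%E.
Proof.
move=> p1 h e0 hE; have p0 : 0 < p by lra.
have mV i : measurable_fun [set: T] (V i.+1) := tame_var_measurable i h.
have mY : measurable_fun [set: T] (fun t => c * partial_sum V n t - 1).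
  apply: measurable_funB => //; apply: measurable_funM; first exact: measurable_cst.
  exact: measurable_partial_sum.
apply: le_trans (markov_powR p0 (exprn_gt0 2 e0) mY (L1_clock_deviation c n p1 h)) _.
rewrite lee_fin ler_pdivrMr ?powR_gt0 ?exprn_gt0//; apply: le_trans hE _.
rewrite powR_sqr (gtr0_norm e0) powRD; last by apply/implyP => _; rewrite gt_eqF.
by rewrite powRr1 ?(ltW e0)// mulrC.
Qed.

(** [X_i^2] and its conditional expectation [V_i] have partial sums that
    agree to relative accuracy [eps]: their difference is a martingale with
    increments in L^p, and [eps] is large against its natural scale. *)
Lemma square_deviation_prob (p m sigma2 : R) : 1 < p -> 0 < sigma2 -> 0 <= m ->
  exists2 C : R, 0 <= C & forall X V n eps, tame P F p X V ->
    (forall i, Ex P (fun t => `|X i.+1 t| `^ (2 * p)) = m) -> (0 < n)%N -> 0 < eps ->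
    n%:R `^ (growth p - p) <= eps `^ (p + 1) ->
    (P [set t | (n%:R * sigma2 * eps < `|partial_sum (fun i t => X i t ^+ 2 - V i t) n t|)%R]
      <= (C * eps)%:E)%E.
Proof.
move=> p1 s0 m0; have p0 : 0 < p by lra.
have [C C0 HC] := martingale_moment P F p1.
have sp : 0 < sigma2 `^ p by rewrite powR_gt0.
pose K := 2 `^ p * (m + m).
have K0 : 0 <= K by rewrite mulr_ge0 ?addr_ge0 ?powR_ge0.
exists (C * K / sigma2 `^ p) => [|X V n eps h hm n0 e0 re]; first exact: divr_ge0 (mulr_ge0 C0 K0) (powR_ge0 _ _).
have hF := tame_filtration h.
have N0 : 0 < n%:R :> R by rewrite ltr0n.
have mX i : measurable_fun [set: T] (X i.+1) := tame_measurable i h.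
have mV i : measurable_fun [set: T] (V i.+1) := tame_var_measurable i h.
have mXV i : measurable_wrt (F i.+1) (fun t => X i.+1 t ^+ 2 - V i.+1 t).
  have sG := filtration_sigma hF i.+1; apply/(measurable_wrtP _ sG).
  apply: measurable_funB; first apply: measurable_funX; apply/(measurable_wrtP _ sG).
    exact: mdiff_adapted (tame_mdiff h) i.
  exact: measurable_wrt_incr hF (cond_exp_measurable (tame_var h i)).
have X2p i : (fun t => `|X i.+1 t| `^ (2 * p)) = fun t => `|X i.+1 t ^+ 2| `^ p.
  by apply/funext => t; rewrite (ger0_norm (sqr_ge0 _)) powR_sqr.
have Vp i : (fun t => V i.+1 t `^ p) = fun t => `|- V i.+1 t| `^ p.
  by apply/funext => t; rewrite normrN ger0_norm// (tame_ge0 h).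
have LX i : L1 P (fun t => `|X i.+1 t ^+ 2| `^ p) by rewrite -X2p; exact: tame_moment h i.
have LV i : L1 P (fun t => `|- V i.+1 t| `^ p) by rewrite -Vp; exact: (tame_var_moment i p1 h).1.
have LXV i : L1 P (fun t => `|X i.+1 t ^+ 2 - V i.+1 t| `^ p).
  apply: (@L1_powR_add _ _ _ P p (fun t => X i.+1 t ^+ 2) (fun t => - V i.+1 t)) => //.
  - exact: ltW.
  - exact: measurable_funX.
  - exact: measurable_funN.
have EXV i : Ex P (fun t => `|X i.+1 t ^+ 2 - V i.+1 t| `^ p) <= K.
  apply: (@le_trans _ _ (Ex P (fun t => 2 `^ p * (`|X i.+1 t ^+ 2| `^ p + `|- V i.+1 t| `^ p)))).
    apply: Ex_le => //; first by apply: L1Z; exact: L1D.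
    by move=> t; apply: powR_sum_le; exact: ltW.
  rewrite ExZ ?ExD//; last exact: L1D.
  rewrite /K ler_wpM2l ?powR_ge0// -X2p hm lerD2l -Vp -(hm i).
  exact: (tame_var_moment i p1 h).2.
have [LM EM] := HC (fun i t => X i t ^+ 2 - V i t) K n hF mXV
  (fun i => tame_centered_var i p1 h) LXV EXV n0.
have mM : measurable_fun [set: T] (partial_sum (fun i t => X i t ^+ 2 - V i t) n).
  apply: measurable_partial_sum => i.
  exact: measurable_wrt_measurable (@filtration_measurable _ _ _ hF i.+1) (mXV i).
have Nse : 0 < n%:R * sigma2 * eps by rewrite !mulr_gt0.
apply: le_trans (markov_powR p0 Nse mM LM) _.
rewrite lee_fin ler_pdivrMr ?powR_gt0//; apply: (le_trans EM).
rewrite !powRM ?mulr_ge0 ?(ltW N0) ?(ltW s0) ?(ltW e0)//.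
have gE : n%:R `^ growth p = n%:R `^ p * n%:R `^ (growth p - p) :> R.
  by rewrite -powRD 1?addrC ?subrK//; apply/implyP => _; rewrite gt_eqF.
have epE : eps `^ (p + 1) = eps * eps `^ p.
  rewrite powRD; last by apply/implyP => _; rewrite gt_eqF.
  by rewrite powRr1 ?(ltW e0)// mulrC.
rewrite gE epE in re *.
have -> : C * K / sigma2 `^ p * eps * (n%:R `^ p * sigma2 `^ p * eps `^ p) =
    C * K * n%:R `^ p * (eps * eps `^ p) by field; rewrite gt_eqF.
have -> : C * (n%:R `^ p * n%:R `^ (growth p - p)) * K =
    C * K * n%:R `^ p * n%:R `^ (growth p - p) by ring.
by rewrite ler_wpM2l//; exact: mulr_ge0 (mulr_ge0 C0 K0) (powR_ge0 _ _).
Qed.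

(** This makes the term [S_n^2 / n] of the sample variance negligible. *)
Lemma sum_deviation_prob (p sigma2 : R) : 1 < p -> 0 < sigma2 ->
  exists2 C : R, 0 <= C & forall X V n eps, tame P F p X V ->
    (forall i, Ex P (fun t => X i.+1 t ^+ 2) = sigma2) -> (0 < n)%N -> 0 < eps ->
    1 <= n%:R * eps ^+ 2 ->
    (P [set t | (Num.sqrt (n%:R * sigma2 * (n%:R * eps)) < `|partial_sum X n t|)%R]
      <= (C * eps)%:E)%E.
Proof.
move=> p1 s0.
have [C C0 HC] := @martingale_moment _ T R P F 2 ltac:(lra).
exists C => // X V n eps h hs n0 e0 re.
have N0 : 0 < n%:R :> R by rewrite ltr0n.
have sqE (Y : T -> R) : (fun t => `|Y t| `^ 2) = fun t => Y t ^+ 2.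
  by apply/funext => t; rewrite powR_mulrn// real_normK ?num_real.
have LX2 i : L1 P (fun t => `|X i.+1 t| `^ 2) by rewrite sqE; exact: tame_L1_sqr p1 h.
have EX2 i : Ex P (fun t => `|X i.+1 t| `^ 2) <= sigma2 by rewrite sqE hs.
have [LS ES] := HC X sigma2 n (tame_filtration h) (mdiff_adapted (tame_mdiff h))
  (fun i => tame_centered i h) LX2 EX2 n0.
have Nse : 0 < n%:R * sigma2 * (n%:R * eps) by rewrite !mulr_gt0.
have sNse : 0 < Num.sqrt (n%:R * sigma2 * (n%:R * eps)) by rewrite sqrtr_gt0.
have mSX := measurable_partial_sum n (fun i => tame_measurable i h).
apply: le_trans (markov_powR (ltr0n _ 2) sNse mSX LS) _.
rewrite lee_fin ler_pdivrMr ?powR_gt0//; apply: (le_trans ES).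
rewrite powR_mulrn ?sqrtr_ge0// sqr_sqrtr ?(ltW Nse)//.
have -> : growth 2 = 1 :> R by rewrite /growth divff// maxxx.
rewrite powRr1 ?ler0n//.
have -> : C * eps * (n%:R * sigma2 * (n%:R * eps)) = C * n%:R * sigma2 * (n%:R * eps ^+ 2) by ring.
by rewrite ler_peMr// !mulr_ge0// ltW.
Qed.

Lemma scaled_moment_sum (p m sigma2 c : R) X V n : tame P F p X V ->
  (forall i, Ex P (fun t => `|X i.+1 t| `^ (2 * p)) = m) -> (0 < n)%N -> 0 < sigma2 ->
  0 < c -> c ^+ 2 = (n%:R * sigma2)^-1 ->
  \sum_(0 <= k < n) Ex P (fun t => `|c * X k.+1 t| `^ (2 * p)) =
  m / sigma2 `^ p * n%:R `^ (1 - p).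
Proof.
move=> h hm n0 s0 c0 c2; have N0 : 0 < n%:R :> R by rewrite ltr0n.
rewrite (eq_bigr (fun=> c `^ (2 * p) * m)); last first.
  move=> i _; rewrite -(hm i) -ExZ; last exact: tame_moment h i.
  by congr Ex; apply/funext => t; rewrite normrM (gtr0_norm c0) powRM// ltW.
rewrite big_const_nat subn0 iter_addr_0 -[_ *+ n]mulr_natl.
have -> : c `^ (2 * p) = n%:R `^ (- p) / sigma2 `^ p.
  rewrite -{1}(gtr0_norm c0) -powR_sqr c2 !powR_exp ?invr_gt0 ?mulr_gt0// -expRN -expRD.
  by rewrite lnV ?posrE ?mulr_gt0// lnM ?posrE//; congr expR; ring.
have -> : n%:R `^ (1 - p) = n%:R * n%:R `^ (- p) :> R.
  rewrite powRD; last by apply/implyP => _; rewrite gt_eqF.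
  by rewrite powRr1// ltW.
by field; rewrite gt_eqF ?powR_gt0.
Qed.

(** Outside the three exceptional events [studentE] reduces the event to one about
    S_n alone, with a threshold that is changed by a factor 1 + O(eps). *)
Lemma student_upper (p m sigma2 : R) : 1 < p -> 0 < sigma2 -> 0 <= m -> exists2 C : R, 0 <= C &
  forall X V n x, tame P F p X V ->
    (forall i, Ex P (fun t => `|X i.+1 t| `^ (2 * p)) = m) ->
    (forall i, Ex P (fun t => X i.+1 t ^+ 2) = sigma2) -> (2 <= n)%N ->
    (P (student_le X n x) <= (Phi x + C * (n%:R `^ (1 - p) +
      Ex P (fun t => `|partial_sum V n t / (n%:R * sigma2) - 1| `^ p)) `^ (2 * p + 1)^-1)%:E)%E.
Proof.
move=> p1 s0 m0.
have p21 : 0 < 2 * p + 1 by lra.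
have p21' : 1 <= 2 * p + 1 by lra.
have sixteenth_le1 : 1 / 16 <= 1 :> R by lra.
have half_small (e : R) : e <= 1 / 16 -> 8 * e <= 1 / 2 by move=> ?; lra.
have factor_large (e t : R) : 0 < e -> e <= 1 / 16 -> t = 1 + 8 * e \/ t = 1 - 8 * e ->
    1 / 2 <= t /\ `|t - 1| = 8 * e.
  move=> e0 e16 [->|->]; split; [lra| |lra|].
    by rewrite addrAC subrr add0r gtr0_norm// mulr_gt0.
  by rewrite addrAC subrr add0r normrN gtr0_norm// mulr_gt0.
have [Ca Ca0 HCa] := one_sided_normal_approx P F p1.
have [Cb Cb0 HCb] := square_deviation_prob p1 s0 m0.
have [Cc Cc0 HCc] := sum_deviation_prob p1 s0.
have [Cs Cs0 HCs] := @Phi_scale R.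
have sp : 0 < sigma2 `^ p by rewrite powR_gt0.
(* Lyapunov's ratio is m / sigma2^p times n^(1-p), hence this factor. *)
pose C1 := 1 + m / sigma2 `^ p.
have C11 : 1 <= C1 by rewrite lerDl divr_ge0// ltW.
have C10 : 0 < C1 by lra.
have C1m : m / sigma2 `^ p <= C1 by rewrite lerDr.
have C1p : C1 <= C1 `^ (2 * p + 1) by rewrite -[leLHS]powRr1 ?(ltW C10)// ler_powR.
pose C2 := Ca + Cs * 8 + 16 + 1 + Cb + Cc.
have C20 : 0 <= C2 by rewrite /C2; lra.
have C2_16 (e : R) : 1 / 16 < e -> 1 <= C2 * e by move=> he; rewrite /C2; nra.
have collect (y z e : R) : y <= z + Cs * (8 * e) -> 0 <= e ->
    y + Ca * e + (e + (Cb * e + Cc * e)) <= z + C2 * e.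
  by move=> h1 h2; rewrite /C2; nra.
exists (C2 * C1) => [|X V n x h hm hs n2]; first by rewrite mulr_ge0// ltW.
set N : R := n%:R.
have N1 : 1 <= N by rewrite ler1n (leq_trans _ n2).
have N0 : 0 < N := lt_le_trans ltr01 N1.
have Ns0 : 0 < N * sigma2 by rewrite mulr_gt0.
set dev := Ex P _.
have dev0 : 0 <= dev by apply: Ex_ge0 => t; exact: powR_ge0.
set L := _ + dev.
have Np0 : 0 < N `^ (1 - p) by rewrite powR_gt0.
have NL : N `^ (1 - p) <= L by rewrite lerDl.
have devL : dev <= L by rewrite lerDr ltW.
have L0 : 0 < L := lt_le_trans Np0 NL.
set B := L `^ _.
have B0 : 0 < B by rewrite powR_gt0.
rewrite -mulrA; move epsd : (C1 * B) => eps.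
have e0 : 0 < eps by rewrite -epsd mulr_gt0.
have mX i : measurable_fun [set: T] (X i.+1) := tame_measurable i h.
have mst := measurable_student n x mX.
(* For large eps the bound exceeds 1. *)
have [e16|e16] := ltP (1 / 16) eps.
  apply: le_trans (probability_le1 _ mst) _; rewrite lee_fin.
  by rewrite (le_trans (C2_16 _ e16))// lerDr Phi_ge0.
have e1 : eps <= 1 := le_trans e16 sixteenth_le1.
have BL : B `^ (2 * p + 1) = L by rewrite /B powR_inv_cancel// ltW.
have Le : C1 * L <= eps `^ (2 * p + 1).
  by rewrite -epsd powRM ?(ltW C10) ?(ltW B0)// BL ler_wpM2r// ltW.
have Le1 : L <= eps `^ (2 * p + 1) by apply: le_trans Le; rewrite ler_peMl// ltW.
have [re1 re2] := rate_exponents p1 N1 e1 (le_trans NL Le1) e0.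
have n0 : (0 < n)%N := ltnW n2.
pose c := (Num.sqrt (N * sigma2))^-1.
have c0 : 0 < c by rewrite invr_gt0 sqrtr_gt0.
have c2 : c ^+ 2 = (N * sigma2)^-1 by rewrite exprVn sqr_sqrtr// ltW.
pose bad1 := [set t | eps ^+ 2 < `|c ^+ 2 * partial_sum V n t - 1|].
pose bad2 := [set t | N * sigma2 * eps < `|partial_sum (fun i t => X i t ^+ 2 - V i t) n t|].
pose bad3 := [set t | Num.sqrt (N * sigma2 * (N * eps)) < `|partial_sum X n t|].
have P1 : (P bad1 <= eps%:E)%E.
  apply: clock_deviation_prob p1 h e0 _; apply: le_trans Le1; apply: le_trans devL.
  by rewrite /dev; under eq_fun do rewrite c2 mulrC.
have P2 : (P bad2 <= (Cb * eps)%:E)%E by exact: HCb h hm n0 e0 re1.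
have P3 : (P bad3 <= (Cc * eps)%:E)%E by exact: HCc h hs n0 e0 re2.
pose xt := x * (if 0 <= x then 1 + 8 * eps else 1 - 8 * eps).
pose main := [set t | partial_sum (fun i t => c * X i t) n t <= xt].
have P0 : (P main <= (Phi xt + Ca * eps)%:E)%E.
  apply: (HCa _ _ _ _ _ (tameZ c p1 h)); first by rewrite e0 e1.
    rewrite (scaled_moment_sum h hm n0 s0 c0 c2); apply: le_trans Le.
    exact: ler_pM (divr_ge0 m0 (ltW sp)) (ltW Np0) C1m NL.
  rewrite (_ : [set t | _] = bad1)//.
  by apply/funext => t; rewrite /bad1 /= partial_sumZ.
have mV i : measurable_fun [set: T] (V i.+1) := tame_var_measurable i h.
have mlt (Y : T -> R) (r : R) : measurable_fun [set: T] Y -> measurable [set t | r < `|Y t|].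
  move=> mY; rewrite -[X in measurable X]setTI; apply: measurable_fun_ltr => //.
  exact: measurableT_comp.
have mb1 : measurable bad1.
  apply: mlt; apply: measurable_funB => //; apply: measurable_funM; first exact: measurable_cst.
  exact: measurable_partial_sum.
have mb2 : measurable bad2.
  apply: mlt; apply: measurable_partial_sum => i.
  by apply: measurable_funB => //; exact: measurable_funX.
have mb3 : measurable bad3 by apply: mlt; exact: measurable_partial_sum.
have mmain : measurable main.
  rewrite -[X in measurable X]setTI; apply: measurable_fun_ler => //.
  apply: measurable_partial_sum => i.
  by apply: measurable_funM => //; exact: measurable_cst.
have Pxt : Phi xt <= Phi x + Cs * (8 * eps).
  have [|t12 tE] := factor_large eps (if 0 <= x then 1 + 8 * eps else 1 - 8 * eps) e0 e16.
    by case: ifP; [left|right].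
  have := HCs x _ t12; rewrite -/xt tE => /(le_trans (ler_norm _)).
  by rewrite lerBlDl.
have cover : student_le X n x `<=` main `|` (bad1 `|` (bad2 `|` bad3)).
  move=> t st.
  have [b1|b1] := ltP (eps ^+ 2) `|c ^+ 2 * partial_sum V n t - 1|.
    by right; left.
  have [b2|b2] := ltP (N * sigma2 * eps) `|partial_sum (fun i t => X i t ^+ 2 - V i t) n t|.
    by right; right; left.
  have [b3|b3] := ltP (Num.sqrt (N * sigma2 * (N * eps))) `|partial_sum X n t|.
    by right; right; right.
  left; rewrite /main /= partial_sumZ /c mulrC.
  have Ne : 1 <= n%:R * eps.
    by apply: le_trans re2 _; rewrite -/N ler_wpM2l ?(ltW N0)// expr2 ler_piMr// ltW.
  apply: (studentE n2 s0 e0 (half_small _ e16) Ne _ b2 _ st).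
    by move: b1; rewrite c2 mulrC.
  rewrite -[leLHS]real_normK ?num_real// -[leRHS]sqr_sqrtr; last first.
    by rewrite !mulr_ge0// ltW.
  by apply: ler_exprn2r.
have PE : (P (student_le X n x) <= ((Phi xt + Ca * eps) + (eps + (Cb * eps + Cc * eps)))%:E)%E.
  apply: (Ple_split mst mmain _ cover P0); first by do 2 apply: measurableU => //.
  apply: (Ple_split _ mb1 _ (@subset_refl _ _) P1); first by do 2 apply: measurableU => //.
    exact: measurableU.
  apply: (Ple_split _ mb2 mb3 (@subset_refl _ _) P2 P3); exact: measurableU.
apply: (le_trans PE); rewrite lee_fin.
exact: collect Pxt (ltW e0).
Qed.

End student.

(** * Versions of the conditional variances, and stationarity *)
Section versions.
Context d (T : measurableType d) (R : realType) (P : probability T R).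
Implicit Types (X V : nat -> T -> R).

Definition nonneg_part V (i : nat) (t : T) : R := Num.max (V i t) 0.

(** On the event Y < 0, which belongs to G, the difference Z - Y is positive but has
    integral zero. *)
Lemma cond_exp_ae_ge0 (G : set_system T) (Z Y : T -> R) : sigma_algebra [set: T] G ->
  (forall A, G A -> measurable A) -> L1 P Z -> (forall t, 0 <= Z t) -> is_cond_exp P G Z Y ->
  {ae P, forall t, 0 <= Y t}.
Proof.
move=> sG GM LZ Z0 hY; have cZY := cond_exp_centered sG GM LZ hY.
have [mY LY _] := hY.
pose A := Y @^-1` `]-oo, 0[%classic.
have GA : G A by apply: mY; exact: measurable_itv.
have mA := GM A GA.
pose f t := \1_A t * (Z t - Y t).
have f0 t : 0 <= f t.
  rewrite /f indicE; have [|] := boolP (t \in A); last by rewrite mul0r.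
  by rewrite inE /A /= in_itv/= mul1r => Yt; rewrite subr_ge0 (le_trans (ltW Yt)).
have Lf : L1 P f.
  apply: (@L1_mulb _ _ _ P (\1_A) _ 1); [exact: measurable_indic| |exact: cZY.1].
  by move=> t; rewrite indicE; case: (_ \in _); rewrite /= ?normr1 ?normr0.
have Ef : Ex P f = 0 := centered_indic cZY GA.
have If : (\int[P]_t `|(f t)%:E| = 0)%E.
  under eq_integral do rewrite gee0_abs ?lee_fin//.
  by rewrite ExE// Ef.
have mf : measurable_fun [set: T] (EFin \o f) by apply/measurable_EFinP; exact: L1_measurable Lf.
have := (ae_eq_integral_abs P measurableT mf).1 If.
apply: filterS => t H.
have : f t = 0 by apply: EFin_inj; exact: (H I).
rewrite /f indicE leNgt; have [|tA] := boolP (t \in A).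
  by rewrite inE /A /= in_itv/= mul1r => Yt; have := Z0 t; lra.
by move=> _; apply/negP => Yt; move: tA; rewrite notin_setE; apply; rewrite /A /= in_itv.
Qed.

Lemma cond_exp_nonneg_part (G : set_system T) (Z Y : T -> R) : sigma_algebra [set: T] G ->
  (forall A, G A -> measurable A) -> L1 P Z -> (forall t, 0 <= Z t) -> is_cond_exp P G Z Y ->
  is_cond_exp P G Z (fun t => Num.max (Y t) 0).
Proof.
move=> sG GM LZ Z0 hY; have Y0 := cond_exp_ae_ge0 sG GM LZ Z0 hY.
have [mY LY YE] := hY.
have mmax : measurable_wrt G (fun t => Num.max (Y t) 0).
  apply/(measurable_wrtP _ sG); apply: measurable_maxr; last exact: measurable_cst.
  exact/(measurable_wrtP _ sG).
have mYT := measurable_wrt_measurable GM mY; have mmT := measurable_wrt_measurable GM mmax.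
split => //.
- apply: (@L1_le _ _ _ _ _ (fun t => `|Y t|)) => //; last exact: L1_norm.
  move=> t; have [Yt|/ltW Yt] := leP (Y t) 0; last by [].
  by rewrite normr0.
- move=> A GA; rewrite -YE//; apply: ae_eq_integral; first exact: GM.
  + by apply/measurable_EFinP; exact: measurable_funTS.
  + by apply/measurable_EFinP; exact: measurable_funTS.
  + by move: Y0; apply: filterS => t Yt _ /=; rewrite max_l.
Qed.

Lemma partial_sum_nonneg_part_ae V n : (forall i, {ae P, forall t, 0 <= V i.+1 t}) ->
  {ae P, forall t, partial_sum V n t = partial_sum (nonneg_part V) n t}.
Proof.
move=> V0; have := ae_foralln V0; apply: filterS => t Vt.
elim: n => [|n IH]; first by rewrite !partial_sum0.
by rewrite !partial_sumS IH /nonneg_part max_l.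
Qed.

End versions.

Section stationarity.
Context d (T : measurableType d) (R : realType) (P : probability T R).
Implicit Types (X : nat -> T -> R).

(** Stationarity of the blocks of length 1 says that all X_i have the same law. *)
Lemma stationary_integral X (f : R -> R) k : strictly_stationary P X ->
  (forall i, measurable_fun [set: T] (X i.+1)) -> measurable_fun [set: R] f ->
  (forall y, 0 <= f y) ->
  (\int[P]_t (f (X k.+1 t))%:E = \int[P]_t (f (X 1%N t))%:E)%E.
Proof.
move=> stat mX mf f0.
pose X_ i : {RV P >-> R} := mfun_Sub (mem_set (mX i)).
have D (i : nat) : (\int[P]_t (f (X i.+1 t))%:E = \int[distribution P (X_ i)]_y (f y)%:E)%E.
  rewrite ge0_integral_distribution//; exact/measurable_EFinP.
rewrite !D; apply: eq_measure_integral => B mB _.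
rewrite /distribution /pushforward /=.
pose A : set (1.-tuple R) := (fun u => tnth u ord0) @^-1` B.
have mA : measurable A.
  by rewrite -[A]setTI; apply: measurable_tnth.
have := stat k 1%N A mA; rewrite /A /preimage /= /block.
under eq_fun do rewrite tnth_mktuple addn0.
by under [X in _ = P X -> _]eq_fun do rewrite tnth_mktuple addn0.
Qed.

End stationarity.

(** * The two-sided bound *)

(** An upper bound for the complement, at -x, is a lower bound for A, since
    1 - Phi(x) = Phi(-x). *)
Lemma std_normal_distE {d : measure_display} {T : measurableType d} {R : realType}
  (P : probability T R) (A : set T) (x c : R) : measurable A ->
  (P A <= (Phi x + c)%:E)%E -> (P (~` A) <= (Phi (- x) + c)%:E)%E ->
  (`|P A - std_normal_cdf x| <= c%:E)%E.
Proof.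
move=> mA; rewrite probability_setC// std_normal_cdfE Phi_opp.
have /fineK <- : P A \is a fin_num by exact: fin_num_measure.
move: (fine (P A)) => a; rewrite -!EFinB /= !lee_fin => h1 h2.
by rewrite ler_norml; apply/andP; split; lra.
Qed.

Lemma student_setC {d : measure_display} {T : measurableType d} {R : realType}
  (X : nat -> T -> R) n x :
  ~` (student_le X n x) `<=` student_le (fun i t => -1 * X i t) n (- x).
Proof.
move=> t /negP; rewrite -ltNge => /ltW H; rewrite /student_le /=.
have mE : sample_mean (fun i t => -1 * X i t) n t = - sample_mean X n t.
  by rewrite /sample_mean partial_sumZ mulN1r mulNr.
have sE : sample_sd (fun i t => -1 * X i t) n t = sample_sd X n t.
  rewrite /sample_sd /sample_variance mE; congr Num.sqrt.
  by apply: eq_bigr => i _; congr (_ / _); ring.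
by rewrite mE sE mulrN mulNr lerN2.
Qed.

Theorem corollary3p1 (d : measure_display) (T : measurableType d) (R : realType)
  (P : probability T R) (F : nat -> set_system T) (X : nat -> T -> R)
  (p sigma2 : R)
  (F_filtration : is_filtration F)
  (X_mdiff : is_martingale_difference P F X)
  (X_stationary : strictly_stationary P X)
  (p_gt1 : 1 < p)
  (X_moment : ('E_P[fun t => (`|X 1%N t| `^ (2 * p))%R] < +oo)%E)
  (sigma2E : ('E_P[fun t => (X 1%N t ^+ 2)%R] = sigma2%:E)%E)
  (sigma2_gt0 : 0 < sigma2) :
  exists C : R,
    forall V : nat -> T -> R, is_cond_variance P F X V ->
    forall n : nat, (2 <= n)%N ->
    (ereal_sup [set `|P (student_le X n x) - std_normal_cdf x| | x in [set: R]]
     <= C%:E *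
        ((n%:R `^ (1 - p))%:E +
         'E_P[fun t => (`|partial_sum V n t / (n%:R * sigma2) - 1| `^ p)%R])
        `^ (2 * p + 1)^-1)%E.
Proof.
have mX i : measurable_fun [set: T] (X i.+1) := L1_measurable (mdiff_integrable X_mdiff i).
have mabs : measurable_fun [set: R] (fun y : R => `|y| `^ (2 * p)).
  by apply: L1_powR_measurable; exact: normr_measurable.
have msqr : measurable_fun [set: R] (fun y : R => y ^+ 2) by exact: measurable_funX.
have EX i : (\int[P]_t (`|X i.+1 t| `^ (2 * p))%:E = \int[P]_t (`|X 1%N t| `^ (2 * p))%:E)%E.
  exact: (stationary_integral (f := fun y => `|y| `^ (2 * p))) X_stationary mX mabs (fun y => powR_ge0 _ _).
have EX2 i : (\int[P]_t (X i.+1 t ^+ 2)%:E = sigma2%:E)%E.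
  rewrite (stationary_integral (f := fun y => y ^+ 2) i X_stationary mX msqr (fun y => sqr_ge0 _)).
  by move: sigma2E; rewrite unlock.
have LX i : L1 P (fun t => `|X i.+1 t| `^ (2 * p)).
  apply/integrableP; split.
    by apply/measurable_EFinP; exact: measurableT_comp mabs (mX i).
  under eq_integral do rewrite /= ger0_norm ?powR_ge0//.
  by rewrite EX; move: X_moment; rewrite unlock.
pose m := Ex P (fun t => `|X 1%N t| `^ (2 * p)).
have hm i : Ex P (fun t => `|X i.+1 t| `^ (2 * p)) = m by rewrite /m /Ex /Rintegral EX.
have hs i : Ex P (fun t => X i.+1 t ^+ 2) = sigma2 by rewrite /Ex /Rintegral EX2.
have m0 : 0 <= m by apply: Ex_ge0 => t; exact: powR_ge0.
have [C C0 HC] := student_upper P F p_gt1 sigma2_gt0 m0.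
exists C => V hV n n2.
have LX2 i : L1 P (fun t => X i.+1 t ^+ 2).
  apply: (@L1_le _ _ _ _ _ (fun t => 1 + `|X i.+1 t| `^ (2 * p))).
  - exact: measurable_funX.
  - move=> t; rewrite ger0_norm ?sqr_ge0// -powR_sqr.
    exact: powR_ge_min (sqr_ge0 _) (ltW p_gt1).
  - by apply: L1D; [exact: L1_cst|].
have sG i := filtration_sigma F_filtration i.
have GM i := @filtration_measurable _ _ _ F_filtration i.
have V0 i := cond_exp_ae_ge0 (sG i) (GM i) (LX2 i) (fun t => sqr_ge0 _) (hV i).
have h : tame P F p X (nonneg_part V).
  split => //.
  - by move=> i; exact: cond_exp_nonneg_part (sG i) (GM i) (LX2 i) (fun t => sqr_ge0 _) (hV i).
  - by move=> i t; rewrite /nonneg_part le_max lexx orbT.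
have hN : tame P F p (fun i t => -1 * X i t) (nonneg_part V).
  have := tameZ (-1) p_gt1 h.
  by rewrite (_ : (fun i t => (-1) ^+ 2 * nonneg_part V i t) = nonneg_part V)//;
    apply/funext => i; apply/funext => t; rewrite sqrrN expr1n mul1r.
pose D := Ex P (fun t => `|partial_sum (nonneg_part V) n t / (n%:R * sigma2) - 1| `^ p).
have mdev (W : nat -> T -> R) : (forall i, measurable_fun [set: T] (W i.+1)) ->
    measurable_fun [set: T] (fun t => (`|partial_sum W n t / (n%:R * sigma2) - 1| `^ p)%:E).
  move=> mW; apply/measurable_EFinP; apply: measurableT_comp (@measurable_powR R p) _.
  apply: measurableT_comp => //; apply: measurable_funB; last exact: measurable_cst.
  by apply: measurable_funM; [exact: measurable_partial_sum|exact: measurable_cst].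
have DE : ('E_P[fun t => (`|partial_sum V n t / (n%:R * sigma2) - 1| `^ p)%R] = D%:E)%E.
  rewrite unlock -ExE; last first.
    have := L1_clock_deviation ((n%:R * sigma2)^-1) n p_gt1 h.
    by under eq_fun do rewrite mulrC.
  apply: ge0_ae_eq_integral => //.
  - by apply: mdev => i; exact: L1_measurable (cond_exp_integrable (hV i)).
  - by apply: mdev => i; exact: (tame_var_measurable i h).
  - apply: (filterS _ (partial_sum_nonneg_part_ae n V0)) => t tE _.
    by rewrite tE.
rewrite DE -EFinD poweR_EFin -EFinM.
apply: ge_ereal_sup => _ [x _ <-].
have mst := measurable_student n x mX.
apply: std_normal_distE => //; first exact: HC.
apply: (@le_trans _ _ (P (student_le (fun i t => -1 * X i t) n (- x)))).
  rewrite le_measure ?inE//; last exact: student_setC.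
  - exact: measurableC.
  - by apply: measurable_student => i; exact: tame_measurable i hN.
apply: (HC _ (nonneg_part V) n (- x) hN _ _ n2) => i.
- by rewrite -(hm i); congr Ex; apply/funext => t; rewrite mulN1r normrN.
- by rewrite -(hs i); congr Ex; apply/funext => t; rewrite mulN1r sqrrN.
Qed.
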